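(* Let $\phi$ be a pseudo-Anosov map on a surface $S$ with $b_1(M(S,\phi))>1$, and let $N=M(S,\phi)$. Then: (a) there exist infinitely many different drilling equivalence classes of closed orbits of the suspension flow in $N$; (b) there exist infinitely many different branched covering equivalence classes of closed orbits $c$ in $N$ satisfying $d(c)>1$ and $\gcd(d(c),|\mathrm{Tor}(H_1(N;\mathbb{Z}))|)=1$.
   Context: Manifolds are oriented and homeomorphisms preserve orientation. A surface $S$ is compact, connected, with $\chi(S)<0$. For a pseudo-Anosov map $\phi:S\to S$, let $M(S,\phi)=S\times[0,1]/(x,0)\sim(\phi(x),1)$ be its mapping torus; $[S]\in H^1(N;\mathbb{Z})$ denotes the class dual to the fiber $S$ of $N=M(S,\phi)$. Thurston norm: for $\alpha\in H^1(N;\mathbb{Z})\cong H_2(N,\partial N;\mathbb{Z})$, $\|\alpha\|=\inf |\chi(T_0)|$ over properly embedded oriented surfaces $(T,\partial T)\subset(N,\partial N)$ dual to $\alpha$, where $T_0$ is $T$ with its sphere and disc components removed; it extends to a norm on $H^1(N;\mathbb{R})$ whose unit ball is a polyhedron. The fibered cone $C$ containing $[S]$ is the open cone over the open top-dimensional face $F$ of the unit ball with $[S]\in\mathbb{R}_+\cdot F$. Let $x\in H_1(N;\mathbb{Z})/\mathrm{Tor}$ be the class dual to $C$, i.e. $\|\alpha\|=\langle\alpha,x\rangle$ for all $\alpha\in C$. The suspension flow on $N$ is the flow in the $[0,1]$-direction (for the pseudo-Anosov representative $\phi$). A closed orbit $c$ means a primitive one (it traverses its image circle exactly once), oriented so that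 it intersects $S$ positively; its homology class is also denoted $c$. Let $d(c)$ be the greatest common divisor of the coordinates of $c$ in the free abelian group $H_1(N;\mathbb{Z})/\mathrm{Tor}$. Two closed orbits $c_1,c_2$ are drilling equivalent if $c_1+x$ and $c_2+x$ are linearly dependent in $H_1(N;\mathbb{Z})/\mathrm{Tor}$. They are branched covering equivalent if $d(c_1)x+(d(c_1)-1)c_1$ and $d(c_2)x+(d(c_2)-1)c_2$ are linearly dependent in $H_1(N;\mathbb{Z})/\mathrm{Tor}$. *)

(* Defs.v *)
From HB Require Import structures.
From mathcomp Require Import all_boot all_order all_algebra generic_quotient.
From mathcomp Require Import all_classical all_reals all_analysis.
From mathcomp Require Import finmap complex freeg.
Import Order.TTheory GRing.Theory Num.Theory numFieldNormedType.Exports.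

Set Implicit Arguments.
Unset Strict Implicit.
Unset Printing Implicit Defensive.

Local Open Scope classical_set_scope.
Local Open Scope ring_scope.

Section Manifolds.
Variable R : realType.

(* [f], with inverse [g], is a homeomorphism from the subspace [A] onto the
   subspace [B]; values outside of [A] and [B] are irrelevant. *)
Definition homeo_on (X Y : topologicalType) (A : set X) (B : set Y)
    (f : X -> Y) (g : Y -> X) : Prop :=
  [/\ f @` A `<=` B, g @` B `<=` A, {in A, cancel f g} & {in B, cancel g f}] /\
  {within A, continuous f} /\ {within B, continuous g}.

Definition homeomorphic_sets (X Y : topologicalType) (A : set X) (B : set Y) :=
  exists f g, homeo_on A B f g.

Record homeomorphism (X : topologicalType) := Homeomorphism {
  hfun :> X -> X;
  hinv : X -> X;
  hfunK : cancel hfun hinv;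
  hinvK : cancel hinv hfun;
  hfun_continuous : continuous hfun;
  hinv_continuous : continuous hinv }.

Definition half_space n : set 'rV[R]_n.+1 := [set v | 0 <= v 0 0].
Arguments half_space n : clear implicits.

(* Second countability is not required: it is automatic for compact spaces. *)
Definition manifold n (X : topologicalType) : Prop :=
  hausdorff_space X /\
  forall p : X, exists (U : set X) (V : set 'rV[R]_n.+1),
    [/\ open U, U p, open V & homeomorphic_sets U (V `&` half_space n)].

Definition interior_point n (X : topologicalType) (p : X) : Prop :=
  exists (U : set X) (V : set 'rV[R]_n.+1),
    [/\ open U, U p, open V & homeomorphic_sets U V].

Definition mboundary n (X : topologicalType) : set X :=
  ~` [set p | interior_point n p].

Definition sphere : set 'rV[R]_3 := [set v | \sum_i v 0 i ^+ 2 = 1].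
Definition disc : set 'rV[R]_2 := [set v | \sum_i v 0 i ^+ 2 <= 1].

(* Locally flat, properly embedded surface in a 3-manifold: near each of its
   points the pair (N, T) looks like (R^3, R^2), or like the corresponding pair
   of half-spaces along the boundary of N. *)
Definition properly_embedded_surface (N : topologicalType) (T : set N) : Prop :=
  compact T /\
  forall p, T p -> exists (U : set N) (V : set 'rV[R]_3) f g,
    [/\ open U, U p, open V, homeo_on U (V `&` half_space 2) f g
      & forall y, U y -> (T y <-> f y 0 ord_max = 0)].

End Manifolds.
Arguments mboundary R n X : clear implicits.
Arguments manifold R n X : clear implicits.
Arguments half_space R n : clear implicits.

Section SingularHomology.
Variable R : realType.

Definition std_simplex k : set 'rV[R]_k.+1 :=
  [set v | (forall i, 0 <= v 0 i) /\ \sum_i v 0 i = 1].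
Arguments std_simplex k : clear implicits.

Definition simplex k : topologicalType := set_type (std_simplex k).

Definition vmap_row m n (f : 'I_m.+1 -> 'I_n.+1) (v : 'rV[R]_m.+1) :
  'rV[R]_n.+1 := \row_j \sum_(i | f i == j) v 0 i.

Lemma vmap_row_simplex m n (f : 'I_m.+1 -> 'I_n.+1) (v : simplex m) :
  vmap_row f (set_val v) \in std_simplex n.
Proof.
apply/mem_set; have [v0 v1] := set_valP v; split=> [i|].
  by rewrite mxE sumr_ge0.
rewrite -[RHS]v1 [RHS](partition_big f predT)//=.
by apply: eq_bigr => j _; rewrite mxE.
Qed.

(* The affine map between standard simplices that is [f] on vertices. *)
Definition vmap m n (f : 'I_m.+1 -> 'I_n.+1) (v : simplex m) : simplex n :=
  SigSub (vmap_row_simplex f v).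

(* Keys are arbitrary functions; continuity is imposed by [is_chain]. *)
Definition chain k (X : topologicalType) := {freeg (simplex k -> X) / int}.

Definition bd k (X : topologicalType) : chain k X -> chain k.-1 X :=
  match k with
  | 0 => fun=> 0
  | k'.+1 => fglift (fun s : simplex k'.+1 -> X =>
      \sum_(i < k'.+2) (-1) ^+ i *: (<< s \o vmap (fintype.lift i) >> : chain k' X))
  end.

Definition push k (X Y : topologicalType) (f : X -> Y) : chain k X -> chain k Y :=
  fglift (fun s : simplex k -> X => << f \o s >> : chain k Y).

Definition evalc k (X : topologicalType) (a : (simplex k -> X) -> int) :
  chain k X -> int := fglift (a : _ -> int^o).

(* Cap product with a 1-cochain: evaluate on the edge spanned by vertices 0, 1
   and keep the face spanned by vertices 1, ..., k+1. *)
Definition cap k (X : topologicalType) (c : chain k.+1 X)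
    (a : (simplex 1 -> X) -> int) : chain k X :=
  fglift (fun s : simplex k.+1 -> X =>
    a (s \o vmap (lshift k : 'I_2 -> 'I_k.+2))
      *: (<< s \o vmap (fintype.lift ord0) >> : chain k X)) c.

Section Subspaces.
Variables (k : nat) (X : topologicalType).
Implicit Types (A B : set X) (c z : chain k X).

(* For B `<=` A, the relative homology H_k(A, B) consists of the [cycle A B]
   modulo [homologous A B]; the absolute case is B = set0. *)
Definition is_chain j A (c : chain j X) : Prop :=
  forall s : simplex j -> X, s \in dom c -> continuous s /\ range s `<=` A.

Definition cycle A B c : Prop := is_chain A c /\ is_chain B (bd c).

Definition homologous A B c c' : Prop :=
  exists (d : chain k.+1 X) (e : chain k X),
    [/\ is_chain A d, is_chain B e & c - c' = bd d + e].

(* For a compact k-manifold A with boundary B, an orientation of A: a relative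
   cycle that generates H_k(A, A \ p) at each interior point p. *)
Definition orientation A B c : Prop :=
  cycle A B c /\
  forall p, (A `\` B) p -> forall z, cycle A (A `\ p) z ->
    exists m : int, homologous A (A `\ p) z (m *: c).

(* [h] induces an isomorphism from H_k(A; Z)/Tor onto Z^n. *)
Definition homology_coords A n (h : chain k X -> 'rV[int]_n) : Prop :=
  [/\ forall z z', cycle A set0 z -> cycle A set0 z' -> h (z + z') = h z + h z',
      forall u, exists2 z, cycle A set0 z & h z = u
    & forall z, cycle A set0 z ->
        (h z = 0 <-> exists2 m : int, 0 < m & homologous A set0 (m *: z) 0)].

Definition betti A : nat :=
  xget 0%N [set n | exists h : chain k X -> 'rV[int]_n, homology_coords A h].

Definition torsion_classes A : set (set (chain k X)) :=
  [set E | exists z, [/\ cycle A set0 z,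
     exists2 m : int, 0 < m & homologous A set0 (m *: z) 0
   & E = [set z' | cycle A set0 z' /\ homologous A set0 z' z]]].

Definition torsion_order A : nat := #|` fset_set (torsion_classes A)|.

End Subspaces.

Definition euler (X : topologicalType) (A : set X) : int :=
  \sum_(k < 3) (-1) ^+ k * (betti k A)%:Z.

Definition orientation_preserving (X : topologicalType) (n : nat)
    (o : chain n.+1 X) (f : X -> X) : Prop :=
  homologous setT (mboundary R n X) (push f o) o.

End SingularHomology.

Section MappingTorus.
Local Open Scope quotient_scope.
Variables (R : realType) (S : topologicalType) (phi : homeomorphism S).

Definition unit_itv : topologicalType := set_type (`[0, 1]%classic : set R).

Definition mt_rel (p q : S * unit_itv) : bool :=
  [|| p == q,
      [&& set_val p.2 == 0, set_val q.2 == 1 & q.1 == phi p.1] |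
      [&& set_val q.2 == 0, set_val p.2 == 1 & p.1 == phi q.1]].

Lemma mt_rel_refl : reflexive mt_rel.
Proof. by move=> p; rewrite /mt_rel eqxx. Qed.

Lemma mt_rel_sym : symmetric mt_rel.
Proof. by move=> p q; rewrite /mt_rel eq_sym; congr orb; rewrite orbC. Qed.

Lemma mt_rel_trans : transitive mt_rel.
Proof.
have val2 (p q : S * unit_itv) (t : R) : set_val p.2 = t -> set_val q.2 = t ->
    p.1 = q.1 -> p = q.
  by case: p q => [a b] [c d] /= <- /val_inj -> ->.
have n01 : 0 <> 1 :> R by move/eqP; rewrite eq_sym oner_eq0.
move=> q p r.
case/or3P => [/eqP->//|/and3P[/eqP p0 /eqP q1 /eqP qp]|/and3P[/eqP q0 /eqP p1 /eqP pq]].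
  case/or3P => [/eqP<-|/and3P[/eqP q0 _ _]|/and3P[/eqP r0 _ /eqP qr]].
  - by rewrite /mt_rel p0 q1 qp !eqxx orbT.
  - by case: n01; rewrite -q0.
  - rewrite (val2 p r 0 p0 r0) ?mt_rel_refl //.
    by apply: (can_inj (hfunK phi)); rewrite -qp -qr.
case/or3P => [/eqP<-|/and3P[_ /eqP r1 /eqP rq]|/and3P[_ /eqP q1 _]].
- by rewrite /mt_rel q0 p1 pq !eqxx !orbT.
- by rewrite (val2 p r 1 p1 r1) ?mt_rel_refl // pq rq.
- by case: n01; rewrite -q0.
Qed.

Canonical mt_equiv := EquivRel mt_rel mt_rel_refl mt_rel_sym mt_rel_trans.

Definition mapping_torus : topologicalType :=
  quotient_topology {eq_quot mt_rel}.

Definition mt_pi (p : S * unit_itv) : mapping_torus :=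
   \pi_({eq_quot mt_rel}) p.

Lemma frac_unit_itv (t : R) : t - (Num.floor t)%:~R \in `[0, 1]%classic.
Proof.
apply/mem_set => /=; rewrite in_itv /= subr_ge0 Num.Theory.floor_le /= lerBlDl -intrD1 ltW //.
exact: floorD1_gt.
Qed.

Definition frac_part (t : R) : unit_itv := SigSub (frac_unit_itv t).

Definition iter_homeo (m : int) (x : S) : S :=
  match m with
  | Posz n => iter n phi x
  | Negz n => iter n.+1 (hinv phi) x
  end.

(* Image of (x, 0) under the suspension flow at time t; as (y, 1) is glued to
   (phi^-1 y, 0), the first return map of the upward flow is phi^-1. *)
Definition flow_line (x : S) (t : R) : mapping_torus :=
  mt_pi (iter_homeo (- Num.floor t) x, frac_part t).

(* T is the smallest period of the flow line through (x, 0). *)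
Definition flow_period (x : S) (T : R) : Prop :=
  [/\ 0 < T, flow_line x T = flow_line x 0
    & forall t, 0 < t < T -> flow_line x t <> flow_line x 0].

Definition flow_loop (x : S) (T : R) : chain R 1 mapping_torus :=
  << (fun v : simplex R 1 => flow_line x (T * set_val v 0 ord_max)) >>.

Definition fiber_incl (x : S) : mapping_torus := mt_pi (x, frac_part 0).

End MappingTorus.

Section PseudoAnosov.
Variables (R : realType) (S : topologicalType).

(* Charts of the complement of the singularities in which one foliation is by
   level sets of the first coordinate, with transverse measure |dx|, and the
   other by level sets of the second one, with transverse measure |dy|. *)
Definition flat_chart : Type := (set S * (S -> R * R))%type.

Definition is_sign (e : R) : Prop := e = 1 \/ e = -1.

Definition foliation_atlas (A : set flat_chart) (U : set S) : Prop :=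
  [/\ \bigcup_(c in A) c.1 = U,
      forall c, A c -> open c.1 /\
        exists V : set (R * R), open V /\ exists g, homeo_on c.1 V c.2 g
    & forall c d p, A c -> A d -> c.1 p -> d.1 p ->
        exists e1 e2 a b, [/\ is_sign e1, is_sign e2 & \forall y \near p,
          d.2 y = (e1 * (c.2 y).1 + a, e2 * (c.2 y).2 + b)]].

(* Around P (a point or a boundary component) the pair of foliations is, in a
   coordinate z on a punctured disc, given by |Re d(z^(k/2))| and
   |Im d(z^(k/2))|; this has k prongs at z = 0. *)
Definition prong (A : set flat_chart) (P : set S) (k : nat) : Prop :=
  exists (U : set S) (psi : S -> R * R) (g : R * R -> S) (r : R),
    [/\ open U, P `<=` U, 0 < r,
        homeo_on (U `\` P) [set z | 0 < z.1 ^+ 2 + z.2 ^+ 2 < r ^+ 2] psi g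
      & forall e : R, 0 < e -> exists W : set S, [/\ open W, P `<=` W &
          forall y, (W `&` U `\` P) y ->
            (psi y).1 ^+ 2 + (psi y).2 ^+ 2 < e]] /\
    forall c p, A c -> (c.1 `&` U `\` P) p ->
      exists e1 e2 a b, [/\ is_sign e1, is_sign e2 & \forall y \near p,
        ((e1 * ((c.2 y).1 - a)) +i* (e2 * ((c.2 y).2 - b)))%C ^+ 2
        = ((psi y).1 +i* (psi y).2)%C ^+ k].

(* Boundary components are treated as punctures: the foliations live on the
   interior of S, with at least one prong at each end. *)
Definition pseudo_anosov (phi : homeomorphism S) : Prop :=
  exists (A : set flat_chart) (Sigma : set S) (lambda : R),
  [/\ 1 < lambda,
      finite_set Sigma /\ Sigma `<=` ~` mboundary R 1 S,
      foliation_atlas A (~` mboundary R 1 S `\` Sigma),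
      (forall p, Sigma p -> exists2 k, (3 <= k)%N & prong A [set p] k) /\
      (forall p, mboundary R 1 S p -> exists2 k, (1 <= k)%N &
         prong A (connected_component (mboundary R 1 S) p) k)
    & phi @` Sigma = Sigma /\
      forall c d p, A c -> A d -> c.1 p -> d.1 (phi p) ->
        exists e1 e2 a b, [/\ is_sign e1, is_sign e2 & \forall y \near p,
          d.2 (phi y) = (e1 * lambda * (c.2 y).1 + a,
                         e2 * lambda^-1 * (c.2 y).2 + b)]].

End PseudoAnosov.

Section ThurstonNorm.
Variables (R : realType) (N : topologicalType) (b : nat).
(* [o] is an orientation cycle of the 3-manifold N. The map [h] gives
   coordinates on H_1(N; Z)/Tor (see [homology_coords]); then H^1(N; Z) and
   H^1(N; R) are identified with row vectors acting by the pairing [dot]. *)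
Variables (o : chain R 3 N) (h : chain R 1 N -> 'rV[int]_b).

Definition dot (K : pzRingType) (u v : 'rV[K]_b) : K := \sum_i u 0 i * v 0 i.

Definition to_real (u : 'rV[int]_b) : 'rV[R]_b := map_mx intr u.

Definition represents (a : (simplex R 1 -> N) -> int) (alpha : 'rV[int]_b) :=
  forall z, cycle setT set0 z -> evalc a z = dot alpha (h z).

(* The 2-chain t is Poincare-Lefschetz dual to alpha. *)
Definition dual_to (alpha : 'rV[int]_b) (t : chain R 2 N) : Prop :=
  exists a, represents a alpha /\
    homologous setT (mboundary R 2 N) (cap o a) t.

(* T without its sphere and disc components. *)
Definition essential_part (T : set N) : set N :=
  [set p | [/\ T p,
     ~ homeomorphic_sets (connected_component T p) (@sphere R)
   & ~ homeomorphic_sets (connected_component T p) (@disc R)]].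

Definition thurston_norm_int (alpha : 'rV[int]_b) : R :=
  inf [set x | exists (T : set N) (t : chain R 2 N),
    [/\ properly_embedded_surface R T,
        orientation T (T `&` mboundary R 2 N) t,
        dual_to alpha t
      & x = `|euler R (essential_part T)|%:~R]].

Definition is_norm (nu : 'rV[R]_b -> R) : Prop :=
  [/\ forall u, nu u = 0 -> u = 0,
      forall u v, nu (u + v) <= nu u + nu v
    & forall c u, nu (c *: u) = `|c| * nu u].

Definition is_thurston_norm (nu : 'rV[R]_b -> R) : Prop :=
  is_norm nu /\ forall alpha, nu (to_real alpha) = thurston_norm_int alpha.

(* F is the top-dimensional closed face of the unit ball of nu cut out by the
   supporting hyperplane <., y> = 1. *)
Definition top_face (nu : 'rV[R]_b -> R) (y : 'rV[R]_b) (F : set 'rV[R]_b) :=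
  [/\ forall u, nu u <= 1 -> dot u y <= 1,
      F = [set u | nu u <= 1 /\ dot u y = 1]
    & exists M : 'M[R]_b, M \in unitmx /\ forall i, F (row i M)].

Definition open_face (y : 'rV[R]_b) (F : set 'rV[R]_b) : set 'rV[R]_b :=
  [set u | F u /\ \forall v \near u, dot v y = 1 -> F v].

Definition top_face_cone (nu : 'rV[R]_b -> R) (C : set 'rV[R]_b) : Prop :=
  exists y F, top_face nu y F /\
    C = [set u | exists t v, [/\ 0 < t, open_face y F v & u = t *: v]].

Definition divisibility (u : 'rV[int]_b) : nat :=
  \big[gcdn/0%N]_(i < b) absz (u 0 i).

Definition lin_dep (u v : 'rV[int]_b) : Prop :=
  exists m n : int, (m, n) <> (0, 0) /\ m *: u + n *: v = 0.

Definition drilling_equiv (x : 'rV[int]_b) (c1 c2 : chain R 1 N) : Prop :=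
  lin_dep (h c1 + x) (h c2 + x).

Definition branched_class (x u : 'rV[int]_b) : 'rV[int]_b :=
  (divisibility u)%:Z *: x + ((divisibility u)%:Z - 1) *: u.

Definition branched_equiv (x : 'rV[int]_b) (c1 c2 : chain R 1 N) : Prop :=
  lin_dep (branched_class x (h c1)) (branched_class x (h c2)).

End ThurstonNorm.

(* A primitive closed orbit of the suspension flow, oriented so that it
   intersects the fiber, whose dual class is [s], positively. *)
Definition closed_orbit (R : realType) (S : topologicalType)
    (phi : homeomorphism S) (b : nat)
    (h : chain R 1 (mapping_torus R phi) -> 'rV[int]_b) (s : 'rV[int]_b)
    (c : chain R 1 (mapping_torus R phi)) : Prop :=
  exists x T, [/\ flow_period phi x T,
    c = flow_loop phi x T \/ c = - flow_loop phi x T & 0 < dot s (h c)].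

(* The classes, for a relation E on the elements of O, of those elements of O
   that satisfy P. *)
Definition classes_of (X : Type) (O P : set X) (E : X -> X -> Prop) :
  set (set X) :=
  [set K | exists c, [/\ O c, P c & K = [set c' | O c' /\ E c c']]].

(* Main.v *)
Require Import Defs.
From HB Require Import structures.
From mathcomp Require Import all_boot all_order all_algebra.
From mathcomp Require Import all_classical all_reals all_analysis.
From mathcomp Require Import finmap complex freeg.
From mathcomp Require Import zify ring lra.
Import Order.TTheory GRing.Theory Num.Theory numFieldNormedType.Exports.

(* Flat squares in the regular part of S are linked by "crossings": some power
   of phi carries one square affinely across another. A packing argument gives
   recurrence, hence any two squares are linked; the crossings of a base square
   by itself compose, and each has a fixed point. So the class of a crossing
   loop is a multiple k c of the class of a closed orbit c, and these loop
   classes form a semigroup. Joining the points of the mapping torus to the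
   base square defines a potential for paths, up to boundaries and differences
   of crossing loops; hence these differences exhaust H_1.

   (a) Finitely many drilling classes would put the classes c of all orbits on
   finitely many lines through -x. For independent loop classes r, v, write
   J r + v = k c: the integer k is bounded because k divides a nonzero minor of
   v and r, while the lines force k to grow with J.

   (b) Take loop classes u, v with u nonzero modulo every prime divisor of the
   order of the torsion, m a multiple of this order, and q a large prime. The
   word u^q v^(q m) has a fixed point whose orbit has class c with
   q (u + m v) = k c. If q divided k, the orbit would be so short that blocks of
   u's and of v's of equal duration would start at the same point, making u and
   v dependent. So q divides d(c), d(c) is prime to the torsion, and for q large
   the branched class avoids any given finite set of lines. *)

(** Crossings play the role of the transitions of a Markov partition without a partition: a crossing
    amounts to two inequalities, so that composing crossings and finding their fixed points is
    elementary algebra. The obstacle is recurrence. Here it does not come from an invariant measure: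
    long horizontal strips cannot hide near a singularity or a boundary component, so the stretched
    images of a square cut the vertical axes of finitely many squares, and disjoint images would
    need too much length. Homology is handled by one principle: a function from points to 1-chains
    that is compatible with short paths modulo a subgroup forces every 1-cycle into that subgroup.
    With chains that end at the base square it shows that loops exhaust the homology. With flow
    boxes it shows that the first homology is finitely generated, hence that its torsion is finite,
    which makes [torsion_order] a positive number and the congruences of (b) meaningful. The class
    of the fibre pairs positively with [x] and with closed orbits, so the vectors compared by the
    two equivalences are never zero. *)

Set Implicit Arguments.
Unset Strict Implicit.
Unset Printing Implicit Defensive.

Local Open Scope classical_set_scope.
Local Open Scope ring_scope.

(** * Chains modulo boundaries *)

(* [ring] does not apply to a mere [zmodType]. *)
Inductive zexp := ZVar of nat | ZZero | ZAdd of zexp & zexp | ZOpp of zexp.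

Fixpoint zeval (V : zmodType) (env : seq V) (e : zexp) : V :=
  match e with
  | ZVar i => nth 0 env i
  | ZZero => 0
  | ZAdd a b => zeval env a + zeval env b
  | ZOpp a => - zeval env a
  end.

Fixpoint zcoef (i : nat) (e : zexp) : int :=
  match e with
  | ZVar j => if i == j then 1 else 0
  | ZZero => 0
  | ZAdd a b => zcoef i a + zcoef i b
  | ZOpp a => - zcoef i a
  end.

Lemma zeval_coef (V : zmodType) (env : seq V) e :
  zeval env e = \sum_(i < size env) env`_i *~ zcoef i e.
Proof.
elim: e => [j||a IHa b IHb|a IHa] /=; rewrite ?IHa ?IHb.
- have [jlt|jge] := ltnP j (size env); last first.
    rewrite nth_default // big1 // => i _; case: eqP => [ij|_]; last by rewrite mulr0z.
    by move: (ltn_ord i); rewrite ij ltnNge jge.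
  rewrite (bigD1 (Ordinal jlt)) //= eqxx mulr1z big1 ?addr0 // => i /eqP ni.
  by case: eqP => [ij|_]; [case: ni; apply: val_inj | rewrite mulr0z].
- by rewrite big1 // => i _; rewrite mulr0z.
- by rewrite -big_split; apply: eq_bigr => i _; rewrite mulrzDr.
- by rewrite -sumrN; apply: eq_bigr => i _; rewrite mulrNz.
Qed.

Lemma zeval_eq (V : zmodType) (env : seq V) e1 e2 :
  all (fun i => zcoef i e1 == zcoef i e2) (iota 0 (size env)) ->
  zeval env e1 = zeval env e2.
Proof.
move=> /allP H; rewrite !zeval_coef; apply: eq_bigr => i _.
by rewrite (eqP (H i _)) // mem_iota /= add0n.
Qed.

Ltac z_index x l :=
  lazymatch l with
  | cons x _ => constr:(O)
  | cons _ ?l' => let n := z_index x l' in constr:(S n)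
  end.
Ltac z_insert x l :=
  lazymatch l with
  | context [cons x _] => l
  | _ => constr:(cons x l)
  end.
Ltac z_vars t l :=
  lazymatch t with
  | @GRing.add _ ?a ?b => let l' := z_vars a l in z_vars b l'
  | @GRing.opp _ ?a => z_vars a l
  | @GRing.zero _ => l
  | _ => z_insert t l
  end.
Ltac z_reify t l :=
  lazymatch t with
  | @GRing.add _ ?a ?b =>
      let a' := z_reify a l in let b' := z_reify b l in constr:(ZAdd a' b')
  | @GRing.opp _ ?a => let a' := z_reify a l in constr:(ZOpp a')
  | @GRing.zero _ => constr:(ZZero)
  | _ => let n := z_index t l in constr:(ZVar n)
  end.
Ltac zmod :=
  lazymatch goal with
  | |- @eq ?T ?a ?b =>
    let l0 := constr:(@nil T) in
    let l1 := z_vars a l0 in let l2 := z_vars b l1 in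
    let ea := z_reify a l2 in let eb := z_reify b l2 in
    refine (@zeval_eq _ l2 ea eb _); vm_compute; reflexivity
  end.

Lemma scale_int (V : lmodType int) (n : int) (v : V) : n *: v = v *~ n.
Proof. by rewrite -scaler_int intz. Qed.

Section FreeLift.
Variables (K : choiceType) (V : lmodType int) (f : K -> V).
Implicit Types a b : {freeg K / int}.

Lemma fglift0 : fglift f 0 = 0.
Proof. by have := lift_is_additive f 0 0; rewrite !subrr. Qed.

Lemma fgliftN a : fglift f (- a) = - fglift f a.
Proof. by have := lift_is_additive f 0 a; rewrite !sub0r fglift0 sub0r. Qed.

Lemma fgliftD : {morph fglift f : a b / a + b}.
Proof. by move=> a b; rewrite -{1}[b]opprK lift_is_additive fgliftN opprK. Qed.

Lemma fgliftMz a (n : int) : fglift f (a *~ n) = fglift f a *~ n.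
Proof.
have H (m : nat) : fglift f (a *+ m) = fglift f a *+ m.
  by elim: m => [|m IH]; rewrite ?fglift0 // !mulrS fgliftD IH.
by case: n => n; rewrite ?NegzE ?mulrNz -!pmulrn ?fgliftN H.
Qed.

End FreeLift.

Section Chains.
Variables (R : realType) (N : topologicalType).
Local Notation ch := (chain R 1 N).

Lemma is_chainD k (A : set N) (c d : chain R k N) :
  is_chain A c -> is_chain A d -> is_chain A (c + d).
Proof.
by move=> Ac Ad s /domD_subset; rewrite mem_cat => /orP[/Ac|/Ad].
Qed.

Lemma is_chainN k (A : set N) (c : chain R k N) : is_chain A c -> is_chain A (- c).
Proof. by move=> Ac s; rewrite domN => /Ac. Qed.

Lemma is_chain0 k (A : set N) : is_chain A (0 : chain R k N).
Proof. by move=> s; rewrite dom0. Qed.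

Lemma is_chainU k (s : simplex R k -> N) :
  continuous s -> is_chain setT (<< s >> : chain R k N).
Proof. by move=> cs u; rewrite domU1 inE => /eqP ->; split. Qed.

(** Standard simplices are non-empty, so no singular simplex has its range in the empty set.
    Relative cycles modulo [set0] thereby become cycles in the usual sense. *)
Lemma is_chain_set0 k (c : chain R k N) : is_chain set0 c -> c = 0.
Proof.
move=> H; apply/eqP; rewrite -dom_eq0; apply/eqP.
case E : (dom c) => [//|s l]; have /H[_ sub] : s \in dom c by rewrite E mem_head.
have v1 : (delta_mx 0 0 : 'rV[R]_k.+1) \in @std_simplex R k.
  apply/mem_set; split=> [i|]; first by rewrite mxE; case: eqP => //=; case: eqP.
  by rewrite (bigD1 ord0)//= mxE !eqxx big1 ?addr0// => i; rewrite mxE => /negPf ->; rewrite andbF.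
by case: (sub (s (SigSub v1))); exists (SigSub v1).
Qed.

Lemma bdD k : {morph @bd R k.+1 N : a b / a + b}.
Proof. exact: fgliftD. Qed.

Lemma bd0 k : @bd R k.+1 N 0 = 0.
Proof. by apply: (addrI (bd (0 : chain R k.+1 N))); rewrite -bdD !addr0. Qed.

Lemma bdN k (a : chain R k.+1 N) : bd (- a) = - bd a.
Proof. by apply: (addrI (bd a)); rewrite -bdD !subrr bd0. Qed.

Lemma bdU k (s : simplex R k.+1 -> N) :
  bd (<< s >> : chain R k.+1 N) =
  \sum_(i < k.+2) (-1) ^+ i *: (<< s \o vmap (fintype.lift i) >> : chain R k N).
Proof. by rewrite /= liftU scale1r. Qed.

(** A subgroup of the 1-chains that contains the boundaries. One argument then serves for the
    boundaries themselves, for differences of loops, and for the subgroup generated by given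
    cycles. *)
Definition modulus (G : ch -> Prop) : Prop :=
  [/\ G 0, forall a b, G a -> G b -> G (a - b)
    & forall d : chain R 2 N, is_chain setT d -> G (bd d)].

Definition boundary (c : ch) : Prop := exists2 d : chain R 2 N, is_chain setT d & c = bd d.

Lemma modulus_boundary : modulus boundary.
Proof.
split=> [|a b [d cd ->] [e ce ->]|d cd]; last by exists d.
  by exists 0; [exact: is_chain0|rewrite bd0].
by exists (d - e); [apply: is_chainD => //; exact: is_chainN|rewrite bdD bdN].
Qed.

Section Modulus.
Variable (G : ch -> Prop).
Hypothesis GM : modulus G.

Lemma mod0 : G 0. Proof. by case: GM. Qed.
Lemma modB a b : G a -> G b -> G (a - b). Proof. by case: GM => _ + _; apply. Qed.
Lemma modN a : G a -> G (- a). Proof. by move=> Ga; rewrite -sub0r; apply: modB => //; exact: mod0. Qed.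
Lemma modD a b : G a -> G b -> G (a + b).
Proof. by move=> Ga Gb; rewrite -[b]opprK; apply: modB => //; apply: modN. Qed.
Lemma mod_le a : boundary a -> G a.
Proof. by case: GM => _ _ H [d cd ->]; apply: H. Qed.
Lemma modMn a n : G a -> G (a *+ n).
Proof. by move=> Ga; elim: n => [|n IH]; [rewrite mulr0n; exact: mod0|rewrite mulrS; exact: modD]. Qed.
Lemma modMz a n : G a -> G (a *~ n).
Proof. by move=> Ga; case: n => n; [rewrite -pmulrn|rewrite NegzE mulrNz -pmulrn; apply: modN]; apply: modMn. Qed.
Lemma mod_sum (I : Type) (r : seq I) (P : pred I) (F : I -> ch) :
  (forall i, P i -> G (F i)) -> G (\sum_(i <- r | P i) F i).
Proof.
by move=> H; apply: (big_ind G) => //; [exact: mod0|move=> a b; apply: modD].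
Qed.
End Modulus.

(** Arcs in charts, flow lines and paths in [N] are all affine segments seen through some [Psi];
    homotopies then take place in convex sets. *)
Definition line (E : normedModType R) (Psi : E -> N) (p q : E) : ch :=
  << (fun v : simplex R 1 => Psi (set_val v 0 ord0 *: p + set_val v 0 ord_max *: q)) >>.

End Chains.
Arguments modulus_boundary {R N}.

Lemma conv_itv (R : realType) (l u a b t : R) :
  l <= a <= u -> l <= b <= u -> 0 <= t <= 1 -> l <= (1 - t) * a + t * b <= u.
Proof. by move=> /andP[? ?] /andP[? ?] /andP[? ?]; apply/andP; split; nra. Qed.

Definition is_convex (R : realType) (E : normedModType R) (D : set E) : Prop :=
  forall p q t, D p -> D q -> 0 <= t <= 1 -> D ((1 - t) *: p + t *: q).

Lemma within_comp2 (X Y Z : topologicalType) (A : set X) (D : set Y) (f : X -> Y) (g : Y -> Z) :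
  {within A, continuous f} -> (forall x, A x -> D (f x)) -> {within D, continuous g} ->
  {within A, continuous (g \o f)}.
Proof.
move=> /subspace_continuousP cf Df /subspace_continuousP cg; apply/subspace_continuousP => x Ax.
move=> B nB; have := cf x Ax _ (cg _ (Df _ Ax) _ nB).
rewrite /within /= /nbhs /=; apply: filterS => y H Ay; exact: H Ay (Df _ Ay).
Qed.

Lemma within_comp (X Y Z : topologicalType) (D : set Y) (f : X -> Y) (g : Y -> Z) :
  continuous f -> (forall x, D (f x)) -> {within D, continuous g} ->
  continuous (g \o f).
Proof.
move=> cf Df cg; apply/continuous_subspace_setT; apply: within_comp2 cg => //.
exact: continuous_subspaceT.
Qed.

Lemma vertex_coord_continuous (R : realType) k (i : 'I_k.+1) :
  continuous (fun v : simplex R k => set_val v 0 i).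
Proof.
move=> v; apply: (@continuous_comp _ _ _ set_val (fun M : 'rV[R]_k.+1 => M 0 i)).
  exact: (@initial_continuous (@std_simplex R k) 'rV[R]_k.+1 set_val).
exact: coord_continuous.
Qed.

Section WithinContinuous.
Variables (R : realType) (X : topologicalType) (E : normedModType R) (A : set X).

Lemma within_add (f g : X -> E) : {within A, continuous f} -> {within A, continuous g} ->
  {within A, continuous (fun x => f x + g x)}.
Proof.
move=> /subspace_continuousP cf /subspace_continuousP cg; apply/subspace_continuousP => x Ax.
by apply: cvgD; [exact: cf|exact: cg].
Qed.

Lemma within_scale (f : X -> R) (g : X -> E) :
  {within A, continuous f} -> {within A, continuous g} ->
  {within A, continuous (fun x => f x *: g x)}.
Proof.
move=> /subspace_continuousP cf /subspace_continuousP cg; apply/subspace_continuousP => x Ax.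
by apply: cvgZ; [exact: cf|exact: cg].
Qed.

Lemma continuous_add (f g : X -> E) : continuous f -> continuous g ->
  continuous (fun x => f x + g x).
Proof. by move=> cf cg x; apply: cvgD; [exact: cf|exact: cg]. Qed.

Lemma continuous_scale (f : X -> R) (g : X -> E) : continuous f -> continuous g ->
  continuous (fun x => f x *: g x).
Proof. by move=> cf cg x; apply: cvgZ; [exact: cf|exact: cg]. Qed.
End WithinContinuous.

(** * Images of segments and triangles as singular chains *)

Section Lines.
Variables (R : realType) (N : topologicalType) (E : normedModType R).
Implicit Types (Psi : E -> N) (D : set E).

Lemma simplex1P (v : simplex R 1) :
  [/\ 0 <= set_val v 0 ord0, 0 <= set_val v 0 ord_max &
      set_val v 0 ord0 = 1 - set_val v 0 ord_max].
Proof.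
have [v0 v1] := set_valP v; split=> //.
move: v1; rewrite !big_ord_recl big_ord0 addr0 => v1.
have <- : fintype.lift ord0 ord0 = ord_max :> 'I_2 by apply: val_inj.
by rewrite -v1; ring.
Qed.

Lemma simplex2P (v : simplex R 2) :
  [/\ 0 <= set_val v 0 ord0, 0 <= set_val v 0 1, 0 <= set_val v 0 ord_max &
      set_val v 0 ord0 + set_val v 0 1 + set_val v 0 ord_max = 1].
Proof.
have [v0 v1] := set_valP v; split=> //.
move: v1; rewrite !big_ord_recl big_ord0 addr0 addrA => <-.
by congr (_ + set_val v 0 _ + set_val v 0 _); apply: val_inj.
Qed.

Lemma convex3 D p q r a b c : is_convex D -> D p -> D q -> D r ->
  0 <= a -> 0 <= b -> 0 <= c -> a + b + c = 1 -> D (a *: p + b *: q + c *: r).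
Proof.
move=> cD Dp Dq Dr a0 b0 c0 abc.
have [c1|c1] := eqVneq c 1.
  have -> : a = 0 by lra.
  have -> : b = 0 by lra.
  by rewrite c1 !scale0r !add0r scale1r.
have c1' : 0 < 1 - c by rewrite subr_gt0 lt_neqAle c1 /=; lra.
have c1u : 1 - c != 0 by rewrite gt_eqF.
have -> : a *: p + b *: q = (1 - c) *: ((1 - (b / (1 - c))) *: p + (b / (1 - c)) *: q).
  rewrite scalerDr !scalerA; congr (_ *: _ + _ *: _); last by field.
  by rewrite mulrBr mulr1 mulrCA divff // mulr1; lra.
apply: (cD) => //; last by apply/andP; split; lra.
by apply: (cD) => //; apply/andP; split; [rewrite divr_ge0 // ltW|rewrite ler_pdivrMr //; lra].
Qed.

Lemma line_continuous D Psi p q : is_convex D -> {within D, continuous Psi} ->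
  D p -> D q ->
  continuous (fun v : simplex R 1 => Psi (set_val v 0 ord0 *: p + set_val v 0 ord_max *: q)).
Proof.
move=> cD cPsi Dp Dq.
apply: (@within_comp _ _ _ D (fun v : simplex R 1 => set_val v 0 ord0 *: p + set_val v 0 ord_max *: q)) => //.
  by apply: continuous_add; apply: continuous_scale; do ?[exact: vertex_coord_continuous|exact: cst_continuous].
move=> v; have [v0 v1 e] := simplex1P v; rewrite e; apply: (cD) => //; apply/andP; split=> //.
by rewrite -subr_ge0 -e.
Qed.

Lemma line_bd (Psi : E -> N) p q :
  bd (line Psi p q) = << (fun=> Psi q) >> - << (fun=> Psi p) >>.
Proof.
rewrite /line bdU !big_ord_recl big_ord0 addr0 expr0 scale1r expr1 scaleN1r.
have s0 (v : simplex R 0) : set_val v 0 0 = 1.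
  by have [_] := set_valP v; rewrite big_ord_recl big_ord0 addr0.
congr (<< _ >> - << _ >>); apply/funext => v /=; congr Psi; rewrite !mxE.
  rewrite !(big_mkcond (fun _ => _ == _)) !big_ord_recl !big_ord0 /= s0 !addr0.
  by rewrite scale0r add0r scale1r.
rewrite !(big_mkcond (fun _ => _ == _)) !big_ord_recl !big_ord0 /= s0 !addr0.
by rewrite scale0r addr0 scale1r.
Qed.

(** The three lines are the faces of the affine triangle [p], [q], [r] seen through [Psi]. *)
Lemma line_tri (D : set E) Psi p q r : is_convex D -> {within D, continuous Psi} ->
  D p -> D q -> D r -> boundary (line Psi p q + line Psi q r - line Psi p r).
Proof.
move=> cD cPsi Dp Dq Dr.
pose s (v : simplex R 2) := Psi (set_val v 0 ord0 *: p + set_val v 0 1 *: q + set_val v 0 ord_max *: r).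
exists (<< s >> : chain R 2 N).
  apply: is_chainU; apply: (@within_comp _ _ _ D (fun v : simplex R 2 => set_val v 0 ord0 *: p + set_val v 0 1 *: q + set_val v 0 ord_max *: r)) => //.
    by do 2?apply: continuous_add; apply: continuous_scale; do ?[exact: vertex_coord_continuous|exact: cst_continuous].
  by move=> v; have [v0 v1 v2 e] := simplex2P v; apply: convex3.
rewrite bdU !big_ord_recl big_ord0 addr0 expr0 scale1r expr1 scaleN1r.
rewrite /= /bump /= -signr_odd /= expr0 scale1r addrA addrAC.
rewrite [in LHS]addrC -!addrA [in LHS]addrC -!addrA.
rewrite [in LHS]addrCA; congr (_ + (_ - _)); rewrite /line; congr (<< _ >>);
  apply/funext => v /=; congr Psi; rewrite !mxE
   !(big_mkcond (fun _ => _ == _)) !big_ord_recl !big_ord0 /= ?addr0 ?add0r ?scale0r ?addr0 ?add0r.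
all: have -> : fintype.lift ord0 ord0 = ord_max :> 'I_2 by apply: val_inj.
all: done.
Qed.

(** For a constant map and equal vertices, [line_tri] reads c + c - c with three equal lines. *)
Lemma line_const Psi p : boundary (line Psi p p).
Proof.
have -> : line Psi p p = line (fun=> Psi p) p p.
  rewrite /line; congr (<< _ >>); apply/funext => v.
  by rewrite -scalerDl; have [_ _ ->] := simplex1P v; rewrite subrK scale1r.
have := @line_tri setT (fun=> Psi p) p p p; rewrite -addrA subrr addr0; apply => //.
exact/continuous_subspaceT/cst_continuous.
Qed.

Lemma line_rev (D : set E) Psi p q : is_convex D -> {within D, continuous Psi} ->
  D p -> D q -> boundary (line Psi p q + line Psi q p).
Proof.
move=> cD cPsi Dp Dq.
have -> : line Psi p q + line Psi q p =
  (line Psi p q + line Psi q p - line Psi p p) + line Psi p p by zmod.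
apply: (modD modulus_boundary); last exact: line_const.
exact: line_tri cPsi _ _ _.
Qed.
End Lines.

Lemma line_ext (R : realType) (N : topologicalType) (E E' : normedModType R)
    (Psi : E -> N) (Psi' : E' -> N) p q p' q' :
  (forall t, 0 <= t <= 1 ->
     Psi ((1 - t) *: p + t *: q) = Psi' ((1 - t) *: p' + t *: q')) ->
  line Psi p q = line Psi' p' q'.
Proof.
move=> H; rewrite /line; congr (<< _ >>); apply/funext => v.
have [v0 v1 e] := simplex1P v; rewrite e H //; apply/andP; split=> //.
by rewrite -subr_ge0 -e.
Qed.

Section Paths.
Variables (R : realType) (N : topologicalType) (E : normedModType R).

Lemma itv_convex (a b : R) : @is_convex R R^o `[a, b].
Proof.
by move=> p q t /=; rewrite !in_itv /=; exact: conv_itv.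
Qed.

Definition unit_square : set (R^o * R^o) := [set z | 0 <= z.1 <= 1 /\ 0 <= z.2 <= 1].

Lemma unit_square_convex : is_convex unit_square.
Proof.
by move=> p q t [? ?] [? ?] ?; split; exact: conv_itv.
Qed.

Lemma square_boundary (Psi : R^o * R^o -> N) : {within unit_square, continuous Psi} ->
  boundary (line Psi (0, 0) (0, 1) + line Psi (0, 1) (1, 1)
    - line Psi (0, 0) (1, 0) - line Psi (1, 0) (1, 1)).
Proof.
move=> cPsi.
have -> : line Psi (0, 0) (0, 1) + line Psi (0, 1) (1, 1)
    - line Psi (0, 0) (1, 0) - line Psi (1, 0) (1, 1) =
  (line Psi (0, 0) (0, 1) + line Psi (0, 1) (1, 1) - line Psi (0, 0) (1, 1))
  - (line Psi (0, 0) (1, 0) + line Psi (1, 0) (1, 1) - line Psi (0, 0) (1, 1)) by zmod.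
by apply: (modB modulus_boundary); apply: line_tri cPsi _ _ _;
  rewrite /unit_square /=; try (split; lra); exact: unit_square_convex.
Qed.

Lemma conv01 (t : R) : (1 - t) *: (0 : R^o) + t *: (1 : R^o) = t.
Proof. by rewrite /GRing.scale /= mulr0 mulr1 add0r. Qed.

Lemma conv_same (V : lmodType R) (p : V) (t : R) : (1 - t) *: p + t *: p = p.
Proof. by rewrite -scalerDl subrK scale1r. Qed.

Lemma pair_conv (a b c d t : R) : (1 - t) *: ((a, b) : R^o * R^o) + t *: ((c, d) : R^o * R^o) =
  ((1 - t) * a + t * c, (1 - t) * b + t * d).
Proof. by []. Qed.

(** Straight-line homotopy inside [D], read as a square whose two sides over the end points of [tau]
    are constant. *)
Lemma line_homotopy01 (D : set E) (Psi : E -> N) (tau : R^o -> E) :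
  is_convex D -> {within D, continuous Psi} ->
  {within `[0, 1], continuous tau} -> (forall t, 0 <= t <= 1 -> D (tau t)) ->
  boundary (line (Psi \o tau) 0 1 - line Psi (tau 0) (tau 1)).
Proof.
move=> cD cPsi ctau Dtau.
pose H (z : R^o * R^o) := (1 - z.1) *: tau z.2 + z.1 *: ((1 - z.2) *: tau 0 + z.2 *: tau 1).
have D0 : D (tau 0) by apply: Dtau; lra.
have D1 : D (tau 1) by apply: Dtau; lra.
have c1 : continuous (fun z : R^o * R^o => z.1 : R) by move=> z; exact: cvg_fst.
have c2 : continuous (fun z : R^o * R^o => z.2 : R) by move=> z; exact: cvg_snd.
have cN (f : R^o * R^o -> R) : continuous f -> continuous (fun z => 1 - f z : R^o).
  by move=> cf z; apply: cvgB; [exact: cvg_cst|exact: cf].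
have cH : {within unit_square, continuous (Psi \o H)}.
  apply: (@within_comp2 _ _ _ _ D H) => //; last first.
    move=> [s t] /= [s01 t01]; apply: (cD) => //; first exact: Dtau.
    exact: (cD).
  apply: within_add; apply: within_scale.
  - exact/continuous_subspaceT/cN.
  - refine (@within_comp2 _ _ _ unit_square (`[0, 1]%classic : set R^o) (fun z : R^o * R^o => z.2) tau _ _ _) => //.
      exact/continuous_subspaceT.
    all: try by move=> z [_ ?] /=; rewrite in_itv.
  - exact/continuous_subspaceT.
  - apply: continuous_subspaceT; apply: continuous_add; apply: continuous_scale => //;
      by [exact: cN|exact: cst_continuous].
have := square_boundary cH.
have -> : line (Psi \o H) (0, 0) (0, 1) = line (Psi \o tau) 0 1.
  apply: line_ext => t t01 /=; congr Psi; rewrite ?conv01 pair_conv /H /= !mulr0 !mulr1 ?add0r ?addr0 ?subrK.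
  by rewrite subr0 scale1r scale0r addr0.
have -> : line (Psi \o H) (1, 0) (1, 1) = line Psi (tau 0) (tau 1).
  apply: line_ext => t t01 /=; congr Psi; rewrite ?conv01 pair_conv /H /= !mulr0 !mulr1 ?add0r ?addr0 ?subrK.
  by rewrite subrr scale0r add0r scale1r.
have -> : line (Psi \o H) (0, 1) (1, 1) = line (Psi \o H) (0, 1) (0, 1).
  apply: line_ext => t t01; rewrite [in RHS]conv_same pair_conv /=; congr Psi.
  by rewrite /H /= !mulr1 mulr0 add0r subrK !subrr !scale0r !scale1r !add0r conv_same subr0 scale1r addr0.
have -> : line (Psi \o H) (0, 0) (1, 0) = line (Psi \o H) (0, 0) (0, 0).
  apply: line_ext => t t01; rewrite [in RHS]conv_same pair_conv /=; congr Psi.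
  by rewrite /H /= !mulr0 mulr1 !add0r !subr0 !scale0r !scale1r !addr0 conv_same.
set x := line (Psi \o tau) 0 1; set y := line Psi _ _; set u := line (Psi \o H) (0, 1) (0, 1).
set v := line (Psi \o H) (0, 0) (0, 0) => h.
have -> : x - y = (x + u - v - y) - u + v by zmod.
apply: (modD modulus_boundary); last exact: line_const.
by apply: (modB modulus_boundary) h _; exact: line_const.
Qed.

Lemma line_homotopy (D : set E) (Psi : E -> N) (tau : R^o -> E) (a b : R) : a <= b ->
  is_convex D -> {within D, continuous Psi} ->
  {within `[a, b], continuous tau} -> (forall t, a <= t <= b -> D (tau t)) ->
  boundary (line (Psi \o tau) a b - line Psi (tau a) (tau b)).
Proof.
move=> ab cD cPsi ctau Dtau.
pose g (t : R^o) : R^o := (1 - t) * a + t * b.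
have gab t : 0 <= t <= 1 -> a <= g t <= b.
  by move=> /andP[? ?]; rewrite /g; apply/andP; split; nra.
have := @line_homotopy01 D Psi (tau \o g) cD cPsi.
have -> : line (Psi \o (tau \o g)) 0 1 = line (Psi \o tau) a b.
  apply: line_ext => t t01 /=; congr (Psi (tau _)).
  by rewrite /g /GRing.scale /= mulr0 mulr1 add0r.
rewrite /comp /g subr0 subrr !mul1r !mul0r addr0 add0r; apply.
- apply: (@within_comp2 _ _ _ _ `[a, b]%classic g) => //.
    apply: continuous_subspaceT; apply: continuous_add; apply: continuous_scale;
     do ?exact: cst_continuous; last by move=> ?; exact: cvg_id.
    by move=> z; apply: cvgB; [exact: cvg_cst|exact: cvg_id].
  all: try by move=> t /=; rewrite !in_itv /=; exact: gab.
- by move=> t t01; apply/Dtau/gab.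
Qed.
End Paths.

(** The supremum of the points where [P] holds is attained and cannot lie below [b], because near it
    [P] passes between any two points. This replaces subdivisions by a Lebesgue number. *)
Lemma itv_induction (R : realType) (P : R -> Prop) (a b : R) : a <= b ->
  (forall t, a <= t <= b -> exists2 e, 0 < e & forall u v, a <= u <= b -> a <= v <= b ->
     `|u - t| < e -> `|v - t| < e -> P u -> P v) ->
  P a -> P b.
Proof.
move=> ab loc Pa.
pose A := [set t | a <= t <= b /\ P t].
have A0 : A a by rewrite /A /=; split=> //; rewrite lexx ab.
have ubA : ubound A b by move=> t [/andP[]].
have sA : has_sup A by split; [exists a|exists b].
pose c := sup A.
have ac : a <= c by exact: (ub_le_sup (proj2 sA)).
have cb : c <= b by apply: ge_sup => //; exists a.
have cab : a <= c <= b by rewrite ac cb.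
have [e e0 H] := loc c cab.
have [u [uab Pu] ltu] := sup_adherent e0 sA.
have uc : u <= c by exact: (ub_le_sup (proj2 sA)).
have Pc : P c.
  apply: (H u) => //; last by rewrite subrr normr0.
  by rewrite ltr_norml; apply/andP; rewrite -/c in ltu; split; lra.
have [cltb|] := ltP c b; last by move=> bc; rewrite (@le_anti _ _ b c) // bc cb.
pose v := Num.min b (c + e / 2).
have cv : c < v by rewrite lt_min cltb /=; lra.
have vb : v <= b by rewrite ge_min lexx.
have ve : v <= c + e / 2 by rewrite ge_min lexx orbT.
have vab : a <= v <= b by apply/andP; split; lra.
have Pv : P v.
  apply: (H c) => //; first by rewrite subrr normr0.
  by rewrite ltr_norml; apply/andP; split; lra.
have : v <= c by exact: (ub_le_sup (proj2 sA)).
by rewrite leNgt cv.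
Qed.

Lemma zero_itv01 (R : realType) : 0 <= (0 : R) <= 1.
Proof. by rewrite lexx ler01. Qed.

Section Potential.
Variables (R : realType) (N : topologicalType) (G : chain R 1 N -> Prop).
Hypothesis GM : modulus G.
Variable f : N -> chain R 1 N.
Hypothesis f_local : forall xi, exists W : set N, [/\ open W, W xi &
  forall (gam : R^o -> N) a b, a <= b -> {within `[a, b], continuous gam} ->
    (forall t, a <= t <= b -> W (gam t)) -> G (line gam a b - (f (gam a) - f (gam b)))].

(** The local identities add up when paths are concatenated; the induction along the parameter
    performs this telescoping. *)
Lemma potential_path (gam : R^o -> N) : {within `[0, 1], continuous gam} ->
  G (line gam 0 1 - (f (gam 0) - f (gam 1))).
Proof.
move=> cg; pose P t := G (line gam 0 t - (f (gam 0) - f (gam t))).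
apply: (@itv_induction R P 0 1) => //; last first.
  rewrite /P subrr subr0; apply: (mod_le GM); exact: line_const.
move=> t t01; have [W [oW Wt H]] := f_local (gam t).
have D01 w : 0 <= w <= 1 -> (`[0, 1]%classic : set R^o) w by rewrite /= in_itv.
move/subspace_continuousP: (cg) => /(_ t (D01 _ t01) W (open_nbhs_nbhs (conj oW Wt))).
rewrite {1}/nbhs /= /within /= => /nbhs_ballP[e /= e0 He]; exists e => // u v u01 v01 ue ve Pu.
have We w : 0 <= w <= 1 -> `|w - t| < e -> W (gam w).
  by move=> w01 we; apply: He; rewrite /= ?in_itv // /ball /= distrC.
have HW w : u <= w <= v \/ v <= w <= u -> W (gam w).
  move=> hw; apply: We; first by move: u01 v01 => /andP[? ?] /andP[? ?]; case: hw => /andP[? ?]; apply/andP; split; lra.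
  move: ue ve; rewrite !ltr_norml => /andP[? ?] /andP[? ?].
  by case: hw => /andP[? ?]; apply/andP; split; lra.
have cuv a b : 0 <= a <= 1 -> 0 <= b <= 1 -> {within `[a, b], continuous gam}.
  move=> /andP[? ?] /andP[? ?]; apply: continuous_subspaceW cg => w /=.
  by rewrite !in_itv /= => /andP[? ?]; apply/andP; split; lra.
have z01 := zero_itv01 R.
have tri : boundary (line gam 0 u + line gam u v - line gam 0 v).
  by apply: line_tri cg _ _ _; do ?[exact: itv_convex|exact: D01].
have key : G (line gam u v - (f (gam u) - f (gam v))).
  have [uv|/ltW vu] := leP u v; first by apply: H => //; [exact: cuv|move=> w ?; apply: HW; left].
  have {}H : G (line gam v u - (f (gam v) - f (gam u))).
    by apply: H => //; [exact: cuv|move=> w ?; apply: HW; right].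
  have rv : boundary (line gam u v + line gam v u).
    by apply: line_rev cg _ _; do ?[exact: itv_convex|exact: D01].
  have -> : line gam u v - (f (gam u) - f (gam v)) =
    (line gam u v + line gam v u) - (line gam v u - (f (gam v) - f (gam u))) by zmod.
  by apply: (modB GM) => //; exact: mod_le.
rewrite /P; have -> : line gam 0 v - (f (gam 0) - f (gam v)) =
  (line gam 0 u - (f (gam 0) - f (gam u))) + (line gam u v - (f (gam u) - f (gam v)))
  - (line gam 0 u + line gam u v - line gam 0 v) by zmod.
by apply: (modB GM); [exact: (modD GM)|exact: mod_le].
Qed.

Definition vertex (t : R) : 'rV[R]_2 := (1 - t) *: delta_mx 0 ord0 + t *: delta_mx 0 ord_max.

Lemma vertexE t i : vertex t 0 i = if i == ord0 then 1 - t else t.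
Proof.
by rewrite !mxE !eqxx /=; case: i => [[|[|[]]]] //= ?; rewrite ?mulr1 ?mulr0 ?addr0 ?add0r.
Qed.

Lemma vertex_simplex t : 0 <= t <= 1 -> vertex t \in @std_simplex R 1.
Proof.
move=> /andP[t0 t1]; apply/mem_set; split=> [i|].
  by rewrite vertexE; case: ifP => _ //; rewrite subr_ge0.
by rewrite !big_ord_recl big_ord0 !vertexE /= addr0 subrK.
Qed.

(** Clamping makes the parametrisation of the edge a total continuous function, so that a singular
    1-simplex becomes a path defined on all reals. *)
Definition clamp (t : R) : R := Num.max 0 (Num.min 1 t).

Lemma clamp_itv t : 0 <= clamp t <= 1.
Proof. by rewrite /clamp le_max lexx /= ge_max ler01 ge_min lexx. Qed.

Lemma clampE t : 0 <= t <= 1 -> clamp t = t.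
Proof. by move=> /andP[t0 t1]; rewrite /clamp min_r // max_r. Qed.

Definition edge_point (t : R) : simplex R 1 := SigSub (vertex_simplex (clamp_itv t)).

Lemma edge_point_continuous : continuous (edge_point : R^o -> simplex R 1).
Proof.
apply: continuous_comp_initial; rewrite [_ \o _](_ : _ = vertex \o clamp); last exact: funext.
move=> t; apply: continuous_comp; last first.
  apply: continuous_add; apply: continuous_scale; do ?exact: cst_continuous.
    by move=> z; apply: cvgB; [exact: cvg_cst|exact: cvg_id].
  by move=> ?; exact: cvg_id.
apply: continuous_max; first exact: cvg_cst.
by apply: continuous_min; [exact: cvg_cst|exact: cvg_id].
Qed.

Lemma simplex1_eq (u v : simplex R 1) :
  set_val u 0 ord_max = set_val v 0 ord_max -> u = v.
Proof.
move=> e; apply: val_inj; apply/rowP => i.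
have [_ _ eu] := simplex1P u; have [_ _ ev] := simplex1P v.
case: (unliftP ord_max i) => [j ->|->] //.
by rewrite (_ : fintype.lift _ _ = ord0) ?eu ?ev ?e //; apply: val_inj; case: j => [[]].
Qed.

Lemma edge_pointK (v : simplex R 1) : edge_point (set_val v 0 ord_max) = v.
Proof.
have [v0 v1 e] := simplex1P v.
apply: simplex1_eq; rewrite /= vertexE /= clampE //.
by apply/andP; split=> //; rewrite -subr_ge0 -e.
Qed.

Lemma vertex0_simplex : (const_mx 1 : 'rV[R]_1) \in @std_simplex R 0.
Proof. by apply/mem_set; split=> [i|]; rewrite ?big_ord_recl ?big_ord0 mxE ?addr0. Qed.
Definition simplex0 : simplex R 0 := SigSub vertex0_simplex.

Lemma edge_line (s : simplex R 1 -> N) : line (s \o edge_point : R^o -> N) 0 1 = << s >>.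
Proof.
rewrite /line; congr (<< _ >>); apply/funext => v /=.
by rewrite /GRing.scale /= mulr0 mulr1 add0r edge_pointK.
Qed.

(** Modulo [G], a simplex is the difference of [f] at its end points. Summed over [z], these
    differences are, up to sign, the value at [bd z] of the linear extension [F] of [f] to 0-chains,
    which is zero. *)
Lemma cycle_modulus (z : chain R 1 N) : Defs.cycle setT set0 z -> G z.
Proof.
move=> [zT /is_chain_set0 bdz].
pose F := fglift (fun s : simplex R 0 -> N => f (s simplex0) : chain R 1 N).
have Fbd (s : simplex R 1 -> N) :
    F (bd (<< s >> : chain R 1 N)) = f (s (edge_point 1)) - f (s (edge_point 0)).
  rewrite -edge_line line_bd /F fgliftD fgliftN !liftU !scale1r /=; congr (f (s _) - f (s _)).
have Fz : \sum_(s <- dom z) coeff s z *: (f (s (edge_point 1)) - f (s (edge_point 0))) = 0.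
  rewrite -[RHS](fglift0 (fun s : simplex R 0 -> N => f (s simplex0) : chain R 1 N)) -bdz.
  rewrite -[in RHS](freeg_sumE z) (big_morph _ (@bdD R N 0) (@bd0 R N 0)).
  rewrite (big_morph _ (fgliftD _) (fglift0 _)); apply: eq_bigr => s _.
  have -> : << coeff s z *g s >> = (<< s >> : chain R 1 N) *~ coeff s z.
    by rewrite freegU_mulz intz.
  by rewrite /bd fgliftMz fgliftMz -/(bd (<< s >> : chain R 1 N)) -Fbd scale_int.
have -> : z = \sum_(s <- dom z) coeff s z *: (<< s >> - (f (s (edge_point 0)) - f (s (edge_point 1)))).
  rewrite -[LHS]addr0 -[in X in _ + X]Fz -{1}(freeg_sumE z) -big_split; apply: eq_bigr => s _.
  have -> : << coeff s z *g s >> = coeff s z *: (<< s >> : chain R 1 N).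
    by rewrite scale_int freegU_mulz intz.
  by rewrite /= -scalerDr opprB.
rewrite big_seq; apply: (mod_sum GM) => s sz.
rewrite scale_int; apply: (modMz GM); rewrite -edge_line; apply: potential_path.
have [cs _] := zT s sz.
by apply: continuous_subspaceT => t; apply: continuous_comp; [exact: edge_point_continuous|exact: cs].
Qed.
End Potential.

Lemma near_gt_of (R : realType) (a x : R) : a < x -> \forall y \near (x : R^o), a < y.
Proof. by move=> ax; apply: open_nbhs_nbhs; split=> //; exact: open_gt. Qed.

(** * The suspension flow *)

Section Flow.
Local Open Scope quotient_scope.
Variables (R : realType) (S : topologicalType) (phi : homeomorphism S).
Local Notation N := (mapping_torus R phi).
Local Notation iterh := (iter_homeo phi).
Local Notation mtpi := (@mt_pi R S phi).

Lemma iterhS (n : int) x : iterh (n + 1) x = phi (iterh n x).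
Proof.
case: n => [n|[|n]] /=; first by rewrite addn1.
  by rewrite hinvK.
by rewrite hinvK subn1.
Qed.

Lemma iterhP (n : int) x : iterh (n - 1) x = hinv phi (iterh n x).
Proof. by rewrite -[n in RHS](subrK 1) iterhS hfunK. Qed.

Lemma iterhD (m n : int) x : iterh (m + n) x = iterh m (iterh n x).
Proof.
elim/int_rect: m => [|m IH|m IH]; first by rewrite add0r.
  by rewrite -addn1 PoszD addrAC iterhS IH iterhS.
have e (k : int) : - m.+1%:Z + k = (- m%:Z + k) - 1 by lia.
by rewrite e iterhP IH -[- m.+1%:Z]addr0 e iterhP addr0.
Qed.

Lemma iterhK (n : int) x : iterh (- n) (iterh n x) = x.
Proof. by rewrite -iterhD addNr. Qed.

Lemma iterhVK (n : int) x : iterh n (iterh (- n) x) = x.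
Proof. by rewrite -iterhD subrr. Qed.

Lemma iterh_continuous (n : int) : continuous (iterh n).
Proof.
have H (f : S -> S) m : continuous f -> continuous (iter m f).
  move=> cf; elim: m => [|m IH] x /=; first exact: cvg_id.
  by apply: (@continuous_comp _ _ _ (iter m f) f); [exact: IH|exact: cf].
by case: n => n /=; apply: (H _ _.+1) || apply: H; [exact: hfun_continuous|exact: hinv_continuous].
Qed.

(** The quotient map from S x R onto the mapping torus, by the translations of [Fl_shift]. Working
    upstairs avoids the gluing of the two ends of S x [0,1]. *)
Definition Fl (z : S * R^o) : N := flow_line phi z.1 z.2.

Lemma flow_shift x (t : R) (n : int) : flow_line phi x (t + n%:~R) = flow_line phi (iterh (- n) x) t.
Proof.
rewrite /flow_line; have fl : Num.floor (t + n%:~R) = Num.floor t + n.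
  by rewrite floorDrz ?intr_int // intrKfloor.
rewrite fl opprD iterhD; congr (mtpi (_, _)); apply: val_inj => /=.
by rewrite fl intrD; ring.
Qed.

Lemma Fl_shift x (t : R) (n : int) : Fl (iterh n x, t + n%:~R) = Fl (x, t).
Proof. by rewrite /Fl /= flow_shift iterhK. Qed.

Definition clamp_unit (t : R) : unit_itv R := SigSub (mem_set (clamp_itv t) : clamp t \in `[0, 1]%classic).

Lemma glue x : mtpi (x, clamp_unit 1) = mtpi (hinv phi x, clamp_unit 0).
Proof.
apply/eqmodP; rewrite /= /mt_rel /=; apply/or3P; apply: Or33.
by rewrite hinvK eqxx !set_valE /= !clampE ?eqxx // ?lexx ?ler01.
Qed.

(** [flow_line] is defined with the floor, which jumps at the integers. The formula with the clamped
    height remains true at the right end, by the gluing, so adjacent strips overlap at integer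
    heights. *)
Lemma flow_strip (n : int) x (t : R) : n%:~R <= t <= n%:~R + 1 ->
  flow_line phi x t = mtpi (iterh (- n) x, clamp_unit (t - n%:~R)).
Proof.
move=> /andP[nt tn].
have [tn1|tn1] := ltP t (n%:~R + 1).
  have fl : Num.floor t = n by apply/eqP; rewrite floor_eq nt intrD.
  rewrite /flow_line fl; congr (mtpi (_, _)); apply: val_inj => /=.
  by rewrite fl clampE //; lra.
have -> : t = n%:~R + 1 by apply/eqP; rewrite eq_le tn tn1.
have -> : n%:~R + 1 - n%:~R = 1 :> R by ring.
rewrite glue -[n%:~R + 1]add0r -intrD1 flow_shift /flow_line floor0 opprD iterhP.
congr (mtpi (_, _)); apply: val_inj => /=.
by rewrite floor0 clampE ?lexx ?ler01 // subr0.
Qed.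

Lemma clamp_unit_continuous : continuous (clamp_unit : R^o -> unit_itv R).
Proof.
apply: continuous_comp_initial => t.
apply: continuous_max; first exact: cvg_cst.
by apply: continuous_min; [exact: cvg_cst|exact: cvg_id].
Qed.

Lemma mtpi_continuous : continuous mtpi.
Proof. exact: pi_continuous. Qed.

Lemma continuous_pair (X Y Z : topologicalType) (f : X -> Y) (g : X -> Z) :
  continuous f -> continuous g -> continuous (fun x => (f x, g x)).
Proof. by move=> cf cg x; apply: cvg_pair; [exact: cf|exact: cg]. Qed.

Definition strip (n : int) (z : S * R^o) : N :=
  mtpi (iterh (- n) z.1, clamp_unit (z.2 - n%:~R)).

Lemma strip_continuous n : continuous (strip n).
Proof.
move=> z; apply: (@continuous_comp _ _ _
  (fun z : S * R^o => (iterh (- n) z.1, clamp_unit (z.2 - n%:~R))) mtpi); last exact: mtpi_continuous.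
apply: continuous_pair => {}z.
  by apply: continuous_comp; [exact: cvg_fst|exact: iterh_continuous].
apply: (@continuous_comp _ _ _ (fun z : S * R^o => z.2 - n%:~R : R^o) clamp_unit); last exact: clamp_unit_continuous.
by apply: cvgB; [exact: cvg_snd|exact: cvg_cst].
Qed.

Lemma Fl_continuous : continuous Fl.
Proof.
move=> [x t] O /= nO.
suff : \forall z \near (x, t), O (Fl z) by [].
pose n := Num.floor t; have nt : n%:~R <= t by exact: floor_le.
have tn : t < n%:~R + 1 by rewrite -intrD1; exact: floorD1_gt.
have En : Fl (x, t) = strip n (x, t) by rewrite /Fl (@flow_strip n) //= nt ltW.
have On : \forall z \near (x, t), O (strip n z).
  by apply: strip_continuous; rewrite -En.
have snd_near (P : set R) : nbhs (t : R^o) P -> \forall z \near (x, t), P z.2.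
  by move=> nP; apply: (@cvg_snd _ _ (nbhs x) (nbhs (t : R^o))).
have near_lt : \forall z \near (x, t), z.2 < n%:~R + 1.
  by apply: (snd_near (fun u => u < _)); exact: lt_nbhsl.
have [ltnt|lent] := ltP n%:~R t.
  have near_gt : \forall z \near (x, t), n%:~R < z.2.
    by apply: (snd_near (fun u => _ < u)); exact: near_gt_of.
  near=> z.
  rewrite /Fl (@flow_strip n); first by near: z.
  by apply/andP; split; apply: ltW; near: z.
(* At an integer height the strips above and below both give [Fl (x, t)], and each side of [t] is
   treated with its own strip. *)
have tE : t = n%:~R by apply/eqP; rewrite eq_le lent nt.
have En1 : Fl (x, t) = strip (n - 1) (x, t).
  by rewrite /Fl (@flow_strip (n - 1)) //= intrB tE; lra.
have On1 : \forall z \near (x, t), O (strip (n - 1) z).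
  by apply: strip_continuous; rewrite -En1.
have near_gt : \forall z \near (x, t), n%:~R - 1 < z.2.
  by apply: (snd_near (fun u => _ < u)); apply: near_gt_of; rewrite tE; lra.
near=> z.
rewrite /Fl.
have z1 : z.2 < n%:~R + 1 by near: z.
have z2 : n%:~R - 1 < z.2 by near: z.
have [zn|nz] := ltP z.2 n%:~R.
  by rewrite (@flow_strip (n - 1)); [near: z|rewrite intrB; lra].
by rewrite (@flow_strip n); [near: z|rewrite nz ltW].
Unshelve. all: by end_near.
Qed.

(** Fractional heights are below 1, so the gluing clauses of [mt_rel] cannot apply and the two
    representatives coincide. *)
Lemma Fl_eq x y (t u : R) : Fl (x, t) = Fl (y, u) ->
  exists n : int, u = t + n%:~R /\ y = iterh n x.
Proof.
rewrite /Fl /= /flow_line => /eqmodP; rewrite /= /mt_rel /=.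
have lt1 (v : R) : v - (Num.floor v)%:~R < 1 by rewrite ltrBlDl -intrD1 floorD1_gt.
have n1 (v : R) : (v - (Num.floor v)%:~R == 1) = false by apply/negbTE; rewrite neq_lt lt1.
rewrite !n1 !andbF /= orbF => /eqP[exy etu].
exists (Num.floor u - Num.floor t); split.
  by rewrite intrB; lra.
by rewrite iterhD exy iterhVK.
Qed.

Lemma mtpi_Fl p : mtpi p = Fl (p.1, set_val p.2).
Proof.
have /andP[p0 p1] : 0 <= set_val p.2 <= 1 by have := set_valP p.2; rewrite /= in_itv.
rewrite /Fl (@flow_strip 0) /= ?add0r ?p0 ?p1 // subr0; congr mtpi.
by case: p p0 p1 => a s /= ? ?; congr pair; apply: val_inj; rewrite /= clampE //; apply/andP.
Qed.

Lemma Fl_surj (xi : N) : exists x t, 0 <= t <= 1 /\ xi = Fl (x, t).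
Proof.
pose p := repr xi; exists p.1, (set_val p.2); split.
  by have := set_valP p.2; rewrite /= in_itv.
by rewrite -mtpi_Fl /p /mt_pi reprK.
Qed.

Lemma Fl_open (O : set (S * R^o)) : open O -> open (Fl @` O).
Proof.
move=> oO; rewrite /open /= /quotient_open.
(* The saturation of [O] is the union of its integer translates. *)
have -> : \pi_N @^-1` (Fl @` O) =
    \bigcup_(n in [set: int]) ((fun p : S * unit_itv R => (iterh n p.1, set_val p.2 + n%:~R : R^o)) @^-1` O).
  apply/seteqP; split => p /=.
    move=> [[y u] Oyu]; rewrite -[RHS]/(mtpi p) mtpi_Fl => /esym /Fl_eq[n [eu ey]].
    by exists n => //=; rewrite -eu -ey.
  move=> [n _ /= Op]; exists (iterh n p.1, set_val p.2 + n%:~R) => //.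
  by rewrite Fl_shift -mtpi_Fl.
apply: bigcup_open => n _; apply: open_comp oO => p _.
apply: continuous_pair => {}p.
  by apply: continuous_comp; [exact: cvg_fst|exact: iterh_continuous].
apply: (@cvgD _ R^o); last exact: cvg_cst.
apply: (@continuous_comp _ _ _ snd (set_val : unit_itv R -> R)); first exact: cvg_snd.
exact: (@initial_continuous (`[0, 1]%classic : set R) R set_val).
Qed.

Lemma Fl_inj (O : set (S * R^o)) (a b : R) : b - a <= 1 -> (forall z, O z -> a < z.2 < b) ->
  forall z w, O z -> O w -> Fl z = Fl w -> z = w.
Proof.
move=> ab OI [x t] [y u] /OI /= /andP[? ?] /OI /= /andP[? ?] /Fl_eq[n [eu ey]].
have n0 : n = 0.
  have : -1 < (n%:~R : R) < 1 by lra.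
  rewrite -[-1](_ : (-1)%:~R = _) // -[X in _ < _ < X](_ : 1%:~R = _) // !ltr_int.
  by lia.
by rewrite ey eu n0 addr0.
Qed.

(** On [O] the open map [Fl] is injective, so a section chosen over its image is continuous
    there. *)
Lemma Fl_lift (O : set (S * R^o)) (gam : R^o -> N) (a b : R) : open O ->
  (forall z w, O z -> O w -> Fl z = Fl w -> z = w) ->
  {within `[a, b], continuous gam} ->
  (forall t, a <= t <= b -> (Fl @` O) (gam t)) ->
  exists tau : R^o -> S * R^o, {within `[a, b], continuous tau} /\
    forall t, a <= t <= b -> O (tau t) /\ Fl (tau t) = gam t.
Proof.
move=> oO injO cgam gO.
have /choice[sec secP] : forall xi : N, exists z : S * R^o, (Fl @` O) xi -> O z /\ Fl z = xi.
  move=> xi; have [[z Oz zE]|nO] := pselect ((Fl @` O) xi); first by exists z.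
  by have [x [t _]] := Fl_surj xi; exists (x, t).
exists (sec \o gam); split; last by move=> t tab; apply/secP/gO.
apply/subspace_continuousP => t tab B nB.
have tab' : a <= t <= b by move: tab; rewrite /= in_itv.
have [Ot Et] := secP _ (gO t tab').
have : nbhs (sec (gam t)) (B `&` O) by apply: filterI => //; exact: open_nbhs_nbhs.
move=> B't; pose B' : set (S * R^o) := interior (B `&` O).
have oB' : open B' by exact: open_interior.
have sB' : B' `<=` B `&` O by exact: interior_subset.
have oF : nbhs (gam t) (Fl @` B').
  by apply: open_nbhs_nbhs; split; [exact: Fl_open|exists (sec (gam t))].
move/subspace_continuousP: (cgam) => /(_ t tab _ oF).
rewrite /within /= /nbhs /=; apply: filterS => u H uab.
have [z B'z zE] := H uab.
have [Bz Oz] := sB' z B'z.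
have uab' : a <= u <= b by move: uab; rewrite in_itv.
have [Ou Eu] := secP _ (gO u uab').
have e : sec (gam u) = z by apply: injO => //; rewrite Eu zE.
by rewrite -[X in B X]/(sec (gam u)) e.
Qed.
End Flow.

(** * Flat squares and crossings *)

Section Plane.
Variable R : realType.
Implicit Types (z w : R * R) (l r : R).

Definition box l : set (R * R) := [set z | `|z.1| < l /\ `|z.2| < l].

Lemma nbhs_pairP z (P : set (R * R)) : nbhs z P <->
  exists2 r, 0 < r & forall w, `|w.1 - z.1| < r -> `|w.2 - z.2| < r -> P w.
Proof.
split=> [/nbhs_ballP[r /= r0 H]|[r r0 H]].
  by exists r => // w w1 w2; apply: H; split; rewrite /ball /= distrC.
apply/nbhs_ballP; exists r => //= w [w1 w2]; apply: H; by rewrite distrC.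
Qed.

Lemma box_open l : open (box l).
Proof.
rewrite openE => z [z1 z2]; apply/nbhs_pairP.
exists (Num.min (l - `|z.1|) (l - `|z.2|)); first by rewrite lt_min !subr_gt0 z1.
move=> w; rewrite !lt_min => /andP[h1 _] /andP[_ h2]; split.
  by have := ler_normD (w.1 - z.1) z.1; rewrite subrK; lra.
by have := ler_normD (w.2 - z.2) z.2; rewrite subrK; lra.
Qed.

Lemma box0 l : 0 < l -> box l 0.
Proof. by move=> l0; rewrite /box /= normr0. Qed.

Lemma box_le l r z : l <= r -> box l z -> box r z.
Proof. by move=> lr [? ?]; split; apply: lt_le_trans lr. Qed.

Lemma sign_norm (e : R) : is_sign e -> `|e| = 1.
Proof. by case=> ->; rewrite ?normrN normr1. Qed.

Lemma is_signM (e f : R) : is_sign e -> is_sign f -> is_sign (e * f).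
Proof. by case=> -> [] ->; rewrite ?mulr1 ?mul1r ?mulrNN ?mulr1; [left|right|right|left]. Qed.

Definition seg z w (t : R) : R * R := ((1 - t) * z.1 + t * w.1, (1 - t) * z.2 + t * w.2).

Lemma conv_lt (a b l t : R) : 0 <= t -> t <= 1 -> `|a| < l -> `|b| < l ->
  `|(1 - t) * a + t * b| < l.
Proof.
move=> t0 t1 al bl; apply: (@le_lt_trans _ _ ((1 - t) * `|a| + t * `|b|)).
  apply: le_trans (ler_normD _ _) _.
  by rewrite !normrM (ger0_norm t0) (@ger0_norm _ (1 - t)) // subr_ge0.
have [ab|/ltW ba] := leP `|a| `|b|.
  by have := mulr_ge0 (_ : 0 <= 1 - t) (_ : 0 <= `|b| - `|a|); rewrite !subr_ge0 => /(_ t1 ab); lra.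
by have := mulr_ge0 t0 (_ : 0 <= `|a| - `|b|); rewrite !subr_ge0 => /(_ ba); lra.
Qed.

Lemma affine_continuous (a b c d : R) : continuous (fun z : R * R => (a * z.1 + b, c * z.2 + d)).
Proof.
apply: continuous_pair => z; (apply: (@cvgD _ R^o); last exact: cvg_cst);
  apply: cvgM; do ?[exact: cvg_cst|exact: cvg_fst|exact: cvg_snd].
Qed.

Lemma shift_continuous z0 : continuous (fun z : R * R => (z0.1 + z.1, z0.2 + z.2)).
Proof.
have := affine_continuous (a := 1) (b := z0.1) (c := 1) (d := z0.2).
by under eq_fun do rewrite !mul1r addrC [_ + z0.2]addrC.
Qed.

Lemma seg_box l z w t : 0 <= t <= 1 -> box l z -> box l w -> box l (seg z w t).
Proof.
move=> /andP[t0 t1] [z1 z2] [w1 w2]; split=> /=.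
  exact: conv_lt.
exact: conv_lt.
Qed.

Lemma seg_near z w t (P : set (R * R)) : nbhs (seg z w t) P ->
  exists2 e, 0 < e & forall u, `|u - t| < e -> P (seg z w u).
Proof.
move=> /nbhs_pairP[r r0 H].
pose m := 1 + `|w.1 - z.1| + `|w.2 - z.2|.
have m0 : 0 < m by rewrite /m; have := normr_ge0 (w.1 - z.1); have := normr_ge0 (w.2 - z.2); lra.
exists (r / m); first exact: divr_gt0.
move=> u; rewrite ltr_pdivlMr // => ut; apply: H => /=.
  have -> : (1 - u) * z.1 + u * w.1 - ((1 - t) * z.1 + t * w.1) = (u - t) * (w.1 - z.1) by ring.
  rewrite normrM; apply: le_lt_trans ut; apply: ler_wpM2l => //.
  by rewrite /m; have := normr_ge0 (w.2 - z.2); lra.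
have -> : (1 - u) * z.2 + u * w.2 - ((1 - t) * z.2 + t * w.2) = (u - t) * (w.2 - z.2) by ring.
rewrite normrM; apply: le_lt_trans ut; apply: ler_wpM2l => //.
by rewrite /m; have := normr_ge0 (w.1 - z.1); lra.
Qed.

Lemma seg0 z w : seg z w 0 = z.
Proof. by rewrite /seg !mul0r !addr0 subr0 !mul1r; case: z. Qed.
Lemma seg1 z w : seg z w 1 = w.
Proof. by rewrite /seg subrr !mul0r !add0r !mul1r; case: w. Qed.

(* [aff k m] with [k = (e1, e2, (a1, a2))]: expansion by [m] horizontally,
   contraction by [m] vertically. *)
Definition aff (m : R) (k : R * R * (R * R)) z : R * R :=
  (k.1.1 * m * z.1 + k.2.1, k.1.2 * m^-1 * z.2 + k.2.2).

Definition signs (k : R * R * (R * R)) : Prop := is_sign k.1.1 /\ is_sign k.1.2.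

Lemma aff_seg m k z w t : aff m k (seg z w t) = seg (aff m k z) (aff m k w) t.
Proof. by congr (_, _) => /=; ring. Qed.

(** The values at a point and at one horizontal and one vertical neighbour of it determine all
    coefficients. *)
Lemma aff_unique m k k' z : m != 0 ->
  nbhs z [set w | aff m k w = aff m k' w] -> forall w, aff m k w = aff m k' w.
Proof.
move=> m0 /nbhs_pairP[r r0 H].
have r2 : r / 2 < r by lra.
have r20 : 0 < r / 2 by lra.
have h0 : aff m k z = aff m k' z by apply: H; rewrite subrr normr0.
have h1 : aff m k (z.1 + r / 2, z.2) = aff m k' (z.1 + r / 2, z.2).
  by apply: H => /=; rewrite ?subrr ?normr0 // addrC addKr gtr0_norm.
have h2 : aff m k (z.1, z.2 + r / 2) = aff m k' (z.1, z.2 + r / 2).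
  by apply: H => /=; rewrite ?subrr ?normr0 // addrC addKr gtr0_norm.
move: h0 h1 h2 => [h01 h02] [h11 _] [_ h22].
have cancel_r (x y x' y' u : R) : x * u + y = x' * u + y' ->
    x * (u + r / 2) + y = x' * (u + r / 2) + y' -> x = x'.
  move=> e1 e2; have : (x - x') * (r / 2) = 0 by lra.
  by move/eqP; rewrite mulf_eq0 (gt_eqF r20) orbF subr_eq0 => /eqP.
have s1 := cancel_r _ _ _ _ _ h01 h11.
have s2 := cancel_r _ _ _ _ _ h02 h22.
move=> w; rewrite /aff; congr (_, _).
  by rewrite s1 in h01 *; congr (_ + _); apply: addrI h01.
by rewrite s2 in h02 *; congr (_ + _); apply: addrI h02.
Qed.
End Plane.

Section Squares.
Variables (R : realType) (S : topologicalType) (phi : homeomorphism S).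
Variables (A : set (flat_chart R S)) (M : set S) (lambda : R).
Hypotheses (S_haus : hausdorff_space S) (lambda_gt1 : 1 < lambda)
  (atlas : foliation_atlas A M) (M_phi : forall p, M p -> M (phi p))
  (phi_flat : forall c d p, A c -> A d -> c.1 p -> d.1 (phi p) ->
        exists e1 e2 a b, [/\ is_sign e1, is_sign e2 & \forall y \near p,
          d.2 (phi y) = (e1 * lambda * (c.2 y).1 + a,
                         e2 * lambda^-1 * (c.2 y).2 + b)]).

Lemma chart_open c : A c -> open c.1.
Proof. by case: atlas => _ H _ /H[]. Qed.

Lemma chart_M c p : A c -> c.1 p -> M p.
Proof. by case: atlas => <- _ _ Ac cp; exists c. Qed.

Lemma chart_at p : M p -> exists2 c, A c & c.1 p.
Proof. by case: atlas => <- _ _ [c Ac cp]; exists c. Qed.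

Lemma M_open : open M.
Proof. by case: atlas => <- H _; apply: bigcup_open => c /H[]. Qed.

Lemma chart_cont c p : A c -> c.1 p -> {for p, continuous c.2}.
Proof.
move=> Ac cp; case: atlas => _ /(_ c Ac)[oc [V [oV [g [_ [cc _]]]]]] _.
by move: cc; rewrite continuous_open_subspace // => /(_ p); apply; exact: mem_set.
Qed.

Lemma lambda_gt0 : 0 < lambda. Proof. exact: lt_trans lambda_gt1. Qed.
Lemma lambdaX_gt0 n : 0 < lambda ^+ n. Proof. by rewrite exprn_gt0 // lambda_gt0. Qed.
Lemma lambdaX_neq0 n : lambda ^+ n != 0. Proof. by rewrite gt_eqF // lambdaX_gt0. Qed.

Lemma iter_M n p : M p -> M (iter n phi p).
Proof. by move=> Mp; elim: n => [|n IH] //=; exact: M_phi. Qed.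

Lemma iter_phi_continuous n : continuous (iter n phi).
Proof. exact: (@iterh_continuous S phi n). Qed.

Lemma iter_flat n c d p : A c -> A d -> c.1 p -> d.1 (iter n phi p) ->
  exists2 k, signs k & \forall y \near p, d.2 (iter n phi y) = aff (lambda ^+ n) k (c.2 y).
Proof.
elim: n d => [|n IH] d Ac Ad cp /= dp.
  case: atlas => _ _ /(_ c d p Ac Ad cp dp)[e1 [e2 [a [b [s1 s2 H]]]]].
  exists (e1, e2, (a, b)) => //; apply: filterS H => y ->.
  by rewrite /aff /= expr0 invr1 !mulr1.
have [c' Ac' c'p] := chart_at (iter_M n (chart_M Ac cp)).
have [k [s1 s2] H] := IH c' Ac Ac' cp c'p.
have [f1 [f2 [a [b [t1 t2 K]]]]] := phi_flat Ac' Ad c'p dp.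
exists (f1 * k.1.1, f2 * k.1.2, (f1 * lambda * k.2.1 + a, f2 * lambda^-1 * k.2.2 + b)).
  by split; exact: is_signM.
have K' := iter_phi_continuous K.
near=> y; have -> : d.2 (phi (iter n phi y)) = (f1 * lambda * (c'.2 (iter n phi y)).1 + a,
   f2 * lambda^-1 * (c'.2 (iter n phi y)).2 + b) by near: y.
have -> : c'.2 (iter n phi y) = aff (lambda ^+ n) k (c.2 y) by near: y.
by rewrite /aff /= exprS invfM; congr (_, _); ring.
Unshelve. all: by end_near.
Qed.

(** [q] inverts a chart up to the translation by [c0]. The last clause says that no point of the
    chart with coordinates in the translated box is missed; openness and unique continuation rest on
    it. *)
Definition is_square (q : R * R -> S) (l : R) : Prop :=
  0 < l /\ exists c c0, [/\ A c,
    forall z, box l z -> c.1 (q z) /\ c.2 (q z) = (c0.1 + z.1, c0.2 + z.2),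
    forall z, box l z -> {for z, continuous q}
  & forall y z, c.1 y -> box l z -> c.2 y = (c0.1 + z.1, c0.2 + z.2) -> q z = y].

Lemma square_gt0 q l : is_square q l -> 0 < l. Proof. by case. Qed.

Lemma square_M q l z : is_square q l -> box l z -> M (q z).
Proof. by case=> _ [c [c0 [Ac H _ _]]] /H[] /(chart_M Ac). Qed.

Lemma square_inj q l z w : is_square q l -> box l z -> box l w -> q z = q w -> z = w.
Proof.
case=> _ [c [c0 [Ac H _ _]]] /H[_ e1] /H[_ e2] e.
by move: e1; rewrite e e2 => -[/addrI h1 /addrI h2]; case: z w h1 h2 {e e2} => [? ?] [? ?] /= -> ->.
Qed.

Lemma square_cont q l z : is_square q l -> box l z -> {for z, continuous q}.
Proof. by case=> _ [c [c0 [Ac _ H _]]]; exact: H. Qed.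

Lemma square_open q l (O : set (R * R)) : is_square q l -> open O -> open (q @` (box l `&` O)).
Proof.
move=> sq oO; have oB : open (box l `&` O) by apply: openI => //; exact: box_open.
case: sq => _ [c [c0 [Ac H _ K]]].
rewrite openE => _ [z [bz Oz] <-]; have [cz ez] := H z bz.
have cc : c.2 @ q z --> (c0.1 + z.1, c0.2 + z.2) by rewrite -ez; exact: chart_cont.
have : nbhs (c0.1 + z.1, c0.2 + z.2) [set w | (box l `&` O) (w.1 - c0.1, w.2 - c0.2)].
  have /nbhs_pairP[r r0 Hr] : nbhs z (box l `&` O) by exact: open_nbhs_nbhs.
  apply/nbhs_pairP; exists r => // w /= w1 w2; apply: Hr => /=.
    by rewrite (_ : _ - z.1 = w.1 - (c0.1 + z.1)) //; ring.
  by rewrite (_ : _ - z.2 = w.2 - (c0.2 + z.2)) //; ring.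
move=> /cc nw; have nc : nbhs (q z) c.1 by apply: open_nbhs_nbhs; split => //; exact: chart_open.
rewrite /interior; near=> y.
have cy : c.1 y by near: y.
have [by1 Oy] : (box l `&` O) ((c.2 y).1 - c0.1, (c.2 y).2 - c0.2) by near: y.
exists ((c.2 y).1 - c0.1, (c.2 y).2 - c0.2) => //.
by apply: K => //=; rewrite ![c0.1 + _]addrC ![c0.2 + _]addrC !subrK; case: (c.2 y).
Unshelve. all: by end_near.
Qed.

Lemma square_sub q l r : is_square q l -> 0 < r -> r <= l -> is_square q r.
Proof.
move=> [l0 [c [c0 [Ac H C K]]]] r0 rl; split=> //; exists c, c0; split=> //.
- by move=> z /(box_le rl); exact: H.
- by move=> z /(box_le rl); exact: C.
- by move=> y z cy /(box_le rl); exact: K.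
Qed.

Lemma square_at p (O : set S) : M p -> open O -> O p ->
  exists q l, [/\ is_square q l, q (0, 0) = p & forall z, box l z -> O (q z)].
Proof.
move=> Mp oO Op; have [c Ac cp] := chart_at Mp.
case: atlas => _ /(_ c Ac)[oc [V [oV [g [[cV gV cg gc] [_ cg']]]]]] _.
have Vp : V (c.2 p) by apply: cV; exists p.
have gcont w : V w -> {for w, continuous g}.
  by move: cg'; rewrite continuous_open_subspace // => H Vw; apply: H; exact: mem_set.
have nO : nbhs (c.2 p) [set w | V w /\ O (g w)].
  apply: filterI; first exact: open_nbhs_nbhs.
  have gp : g (c.2 p) = p by apply: cg; exact: mem_set.
  have nO : nbhs (g (c.2 p)) O by rewrite gp; exact: (open_nbhs_nbhs (conj oO Op)).
  exact: (gcont _ Vp) nO.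
move: nO => /nbhs_pairP[l l0 Hl].
have Hb z : box l z -> V ((c.2 p).1 + z.1, (c.2 p).2 + z.2) /\ O (g ((c.2 p).1 + z.1, (c.2 p).2 + z.2)).
  by move=> [? ?]; apply: Hl => /=; rewrite addrC addKr.
exists (fun z => g ((c.2 p).1 + z.1, (c.2 p).2 + z.2)), l; split.
- split=> //; exists c, (c.2 p); split=> //.
  + move=> z /Hb[Vz _]; split; first by apply: gV; exists ((c.2 p).1 + z.1, (c.2 p).2 + z.2).
    by apply: gc; exact: mem_set.
  + move=> z /Hb[Vz _]; apply: (@continuous_comp _ _ _ (fun z : R * R => ((c.2 p).1 + z.1, (c.2 p).2 + z.2)) g); last exact: gcont.
    exact: shift_continuous.
  + by move=> y z cy bz <-; apply: cg; exact: mem_set.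
- rewrite !addr0 -surjective_pairing; apply: cg; exact: mem_set.
- by move=> z /Hb[].
Qed.

(* Analytic continuation of the affine form of [phi^n] along segments. *)
Lemma agree n q l q' l' z0 w0 : is_square q l -> is_square q' l' ->
  box l z0 -> box l' w0 -> iter n phi (q z0) = q' w0 ->
  exists k, [/\ signs k, aff (lambda ^+ n) k z0 = w0 &
    forall z, box l z -> box l' (aff (lambda ^+ n) k z) ->
      iter n phi (q z) = q' (aff (lambda ^+ n) k z)].
Proof.
move=> sq sq' bz0 bw0 e0; have mn0 := lambdaX_neq0 n.
have [_ [c [c0 [Ac H C K]]]] := sq; have [_ [d [d0 [Ad H' C' K']]]] := sq'.
pose F z := iter n phi (q z).
have CF z : box l z -> {for z, continuous F}.
  by move=> bz; apply: (@continuous_comp _ _ _ q (iter n phi)); [exact: C|exact: iter_phi_continuous].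
pose P k z := d.1 (F z) /\ d.2 (F z) = (d0.1 + (aff (lambda ^+ n) k z).1, d0.2 + (aff (lambda ^+ n) k z).2).
have loc z : box l z -> d.1 (F z) -> exists2 k, signs k & \forall z' \near z, P k z'.
  move=> bz dz; have [cz _] := H z bz; have [k sk nk] := iter_flat Ac Ad cz dz.
  exists (k.1, ((aff (lambda ^+ n) k c0).1 - d0.1, (aff (lambda ^+ n) k c0).2 - d0.2)) => //.
  have nq := C z bz _ nk; have nb : nbhs z (box l) by apply: open_nbhs_nbhs; split => //; exact: box_open.
  have nd : \forall z' \near z, d.1 (F z').
    by apply: (CF z bz); apply: open_nbhs_nbhs; split => //; exact: chart_open.
  near=> z'; have bz' : box l z' by near: z'.
  split; first by near: z'.
  have -> : d.2 (F z') = aff (lambda ^+ n) k (c.2 (q z')) by near: z'.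
  by have [_ ->] := H z' bz'; rewrite /aff /=; congr (_, _); ring.
have d0z : d.1 (F z0) by rewrite /F e0; have [] := H' w0 bw0.
have [k sk Pk0] := loc z0 bz0 d0z.
have ak0 : aff (lambda ^+ n) k z0 = w0.
  have [_] := nbhs_singleton Pk0; rewrite /F e0; have [_ ->] := H' w0 bw0.
  by move=> [/addrI h1 /addrI h2]; rewrite [RHS]surjective_pairing h1 h2.
exists k; split=> // z bz baz.
have PF w : P k w -> box l' (aff (lambda ^+ n) k w) -> F w = q' (aff (lambda ^+ n) k w).
  by move=> [dw ew] bw; apply/esym; apply: K'.
suff : \forall w \near seg z0 z 1, P k w by rewrite seg1 => /nbhs_singleton /PF; apply.
apply: (@itv_induction R (fun t => \forall w \near seg z0 z t, P k w) 0 1) => //; last by rewrite seg0.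
move=> t t01.
have bt : box l (seg z0 z t) by exact: seg_box.
have bat u : 0 <= u <= 1 -> box l' (aff (lambda ^+ n) k (seg z0 z u)).
  by move=> u01; rewrite aff_seg; apply: seg_box => //; rewrite ak0.
have caff : {for seg z0 z t, continuous (aff (lambda ^+ n) k)}.
  exact: affine_continuous.
(* Where both sides agree, the iterate has some affine form [k'] near the point. If the form [k] is
   valid at one nearby parameter, the two affine maps agree on an open set, hence everywhere. *)
have [et|net] := pselect (F (seg z0 z t) = q' (aff (lambda ^+ n) k (seg z0 z t))).
  have dt : d.1 (F (seg z0 z t)) by rewrite et; have [] := H' _ (bat t t01).
  have [k' sk' Pk'] := loc _ bt dt.
  have [e e0' He] := seg_near (nbhs_interior Pk').
  have [[u [ut Pu]]|nou] := pselect (exists u, `|u - t| < e /\ \forall w \near seg z0 z u, P k w).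
    have akk' : forall w, aff (lambda ^+ n) k w = aff (lambda ^+ n) k' w.
      apply: (@aff_unique _ _ _ _ (seg z0 z u)) => //.
      have P'u : \forall w \near seg z0 z u, P k' w by exact: He.
      near=> w; have [_ e1] : P k w by near: w.
      have [_] : P k' w by near: w.
      by rewrite e1 => -[/addrI h1 /addrI h2]; rewrite /= /aff h1 h2.
    exists e => // u' v _ _ _ vt _; have : \forall w \near seg z0 z v, P k' w by exact: He.
    by apply: filterS => w; rewrite /P akk'.
  by exists e => // u v _ _ ut _ Pu; case: nou; exists u.
(* Where both sides differ, Hausdorff neighbourhoods separate them, so the induction predicate fails
   at all nearby parameters. *)
have : ~ close (F (seg z0 z t)) (q' (aff (lambda ^+ n) k (seg z0 z t))) by rewrite closeE.
rewrite closeEonbhs => /existsNP[U /existsNP[V /not_implyP[[oU Ut] /not_implyP[[oV Vt] UV]]]].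
have nU : nbhs (seg z0 z t) (F @^-1` U) by apply: (CF _ bt); exact: open_nbhs_nbhs.
have nV : nbhs (seg z0 z t) ((q' \o aff (lambda ^+ n) k) @^-1` V).
  apply: (@continuous_comp _ _ _ (aff (lambda ^+ n) k) q' _ caff); last exact: open_nbhs_nbhs.
  exact: C' (bat t t01).
have [e e0' He] := seg_near (filterI nU nV).
exists e => // u v u01 _ ut _ /nbhs_singleton Pu; case: UV; exists (F (seg z0 z u)).
have [Uu Vu] := He u ut; split=> //.
by rewrite (PF _ Pu) //; exact: bat.
Unshelve. all: by end_near.
Qed.

(** A Markov crossing: by the first inequality the stretched image of [q] overshoots [q'] on both
    horizontal sides, and by the second it stays strictly inside the height of [q']. *)
Definition cross (q : R * R -> S) (l : R) (q' : R * R -> S) (l' : R) (n : nat) k : Prop :=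
  [/\ signs k, `|k.2.1| + l' < lambda ^+ n * l, `|k.2.2| + (lambda ^+ n)^-1 * l < l'
    & forall z, box l z -> box l' (aff (lambda ^+ n) k z) ->
        iter n phi (q z) = q' (aff (lambda ^+ n) k z)].

Definition kcomp (m : R) (k k' : R * R * (R * R)) : R * R * (R * R) :=
  (k'.1.1 * k.1.1, k'.1.2 * k.1.2, aff m k' k.2).

Lemma aff_comp (m m' : R) k k' z : aff m' k' (aff m k z) = aff (m' * m) (kcomp m' k k') z.
Proof. by rewrite /aff /= invfM; congr (_, _); ring. Qed.

Lemma sign_mulr_norm (e m x : R) : is_sign e -> 0 <= m -> `|e * m * x| = m * `|x|.
Proof. by move=> se m0; rewrite !normrM (sign_norm se) mul1r ger0_norm. Qed.

(** Vertically, the first crossing keeps the point inside [q1]. Horizontally, a point outside [q1]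
    would be expanded beyond [q2] by the second crossing. *)
Lemma cross_mid q l q1 l1 q2 l2 n k n' k' z :
  cross q l q1 l1 n k -> cross q1 l1 q2 l2 n' k' -> box l z ->
  box l2 (aff (lambda ^+ n') k' (aff (lambda ^+ n) k z)) -> box l1 (aff (lambda ^+ n) k z).
Proof.
move=> [[s1 s2] h1 h2 _] [[s1' s2'] h1' h2' _] [z1 z2] [/= b1 b2].
have m0 := lambdaX_gt0 n; have m0' := lambdaX_gt0 n'.
split => /=.
  rewrite -(ltr_pM2l m0') -(sign_mulr_norm _ s1' (ltW m0')).
  set v := k'.1.1 * _ * _ in b1 *.
  by have := ler_normB (v + k'.2.1) k'.2.1; rewrite addrK; lra.
apply: le_lt_trans (ler_normD _ _) _.
rewrite (sign_mulr_norm _ s2) ?invr_ge0; last exact: ltW.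
by have := ler_wpM2l (ltW (_ : 0 < (lambda ^+ n)^-1)) (ltW z2); rewrite invr_gt0 => /(_ m0); lra.
Qed.

Lemma cross_comp q l q1 l1 q2 l2 n k n' k' :
  cross q l q1 l1 n k -> cross q1 l1 q2 l2 n' k' ->
  cross q l q2 l2 (n' + n) (kcomp (lambda ^+ n') k k').
Proof.
move=> C C'; have [[s1 s2] h1 h2 e] := C; have [[s1' s2'] h1' h2' e'] := C'.
have m0 := lambdaX_gt0 n; have m0' := lambdaX_gt0 n'.
rewrite /cross exprD; split.
- by split; exact: is_signM.
- have := ler_normD (k'.1.1 * lambda ^+ n' * k.2.1) k'.2.1.
  rewrite (sign_mulr_norm _ s1' (ltW m0')) /= -mulrA.
  by have := h1; rewrite -(ltr_pM2l m0'); lra.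
- have := ler_normD (k'.1.2 * (lambda ^+ n')^-1 * k.2.2) k'.2.2.
  rewrite (sign_mulr_norm _ s2') ?invr_ge0; last exact: ltW.
  rewrite /= invfM.
  rewrite -mulrA; have := h2; rewrite -(@ltr_pM2l _ (lambda ^+ n')^-1) ?invr_gt0 //.
  by lra.
- move=> z bz; rewrite -aff_comp => b2; have b1 := cross_mid C C' bz b2.
  by rewrite iterD e // e'.
Qed.

(** The fixed-point equations are solved coordinate by coordinate. With m the expansion factor, the
    denominators have absolute value at least m - 1 and 1 - 1/m, and the inequalities of [cross]
    bound the numerators by [l] times these numbers. *)
Lemma cross_fix q l n k : (0 < n)%N -> 0 < l -> cross q l q l n k ->
  exists2 z, box l z & aff (lambda ^+ n) k z = z.
Proof.
move=> n0 l0 [[s1 s2] h1 h2 _].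
have m1 : 1 < lambda ^+ n by rewrite exprn_egt1 // -lt0n.
set m := lambda ^+ n in m1 h1 h2 *.
have m0 : 0 < m by lra.
have i0 : 0 < m^-1 by rewrite invr_gt0.
have i1 : m^-1 < 1 by rewrite invf_lt1.
have d1 : m - 1 <= `|1 - k.1.1 * m|.
  have := lerB_dist (k.1.1 * m) 1; rewrite normrM (sign_norm s1) mul1r gtr0_norm // normr1.
  by rewrite distrC.
have d2 : 1 - m^-1 <= `|1 - k.1.2 * m^-1|.
  have := lerB_dist 1 (k.1.2 * m^-1); rewrite normrM (sign_norm s2) mul1r gtr0_norm // normr1.
  by [].
have p1 : 0 < `|1 - k.1.1 * m| by lra.
have p2 : 0 < `|1 - k.1.2 * m^-1| by lra.
have u1 : 1 - k.1.1 * m != 0 by rewrite -normr_gt0.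
have u2 : 1 - k.1.2 * m^-1 != 0 by rewrite -normr_gt0.
exists (k.2.1 / (1 - k.1.1 * m), k.2.2 / (1 - k.1.2 * m^-1)).
  split; rewrite /= normrM normfV ltr_pdivrMr //.
    by have := ler_wpM2l (ltW l0) d1; lra.
  by have := ler_wpM2l (ltW l0) d2; lra.
rewrite /aff /=; congr (_, _).
  by rewrite -{2}(divfK u1 k.2.1); ring.
by rewrite -{2}(divfK u2 k.2.2); ring.
Qed.

(** As both points lie in half squares, the translation parts are below l'/2 + ml/2 and l'/2 +
    l/(2m), where m is the expansion factor; the factor 4 leaves room for the remaining terms of
    [cross]. *)
Lemma cross_create n q l q' l' z0 w0 : is_square q l -> is_square q' l' ->
  box (l / 2) z0 -> box (l' / 2) w0 -> iter n phi (q z0) = q' w0 ->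
  4 * l' <= lambda ^+ n * l -> 4 * l <= lambda ^+ n * l' ->
  exists2 k, cross q l q' l' n k & aff (lambda ^+ n) k z0 = w0.
Proof.
move=> sq sq' bz bw e h1 h2; have l0 := square_gt0 sq; have l0' := square_gt0 sq'.
have bz' : box l z0 by apply: box_le bz; lra.
have bw' : box l' w0 by apply: box_le bw; lra.
have [k [[s1 s2] ek H]] := agree sq sq' bz' bw' e.
have m0 := lambdaX_gt0 n; set m := lambda ^+ n in m0 h1 h2 ek H *.
have i0 : 0 < m^-1 by rewrite invr_gt0.
exists k => //; split => //.
  move: bz bw; rewrite -ek => -[z1 z2] [/= w1 w2].
  have := ler_normB (k.1.1 * m * z0.1 + k.2.1) (k.1.1 * m * z0.1).
  rewrite addrC addKr (sign_mulr_norm _ s1 (ltW m0)).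
  by rewrite -/m; have := z1; rewrite -(ltr_pM2l m0); lra.
move: bz bw; rewrite -ek => -[z1 z2] [/= w1 w2].
have := ler_normB (k.1.2 * m^-1 * z0.2 + k.2.2) (k.1.2 * m^-1 * z0.2).
rewrite addrC addKr (sign_mulr_norm _ s2 (ltW i0)).
have : m^-1 * (4 * l) <= l' by rewrite [m^-1 * _]mulrC ler_pdivrMr // [l' * m]mulrC.
by rewrite -/m; have := z2; rewrite -(ltr_pM2l i0); lra.
Qed.
End Squares.

(** * Recurrence *)

Section Packing.
Variable R : realType.

(** Induction on the number of intervals, removing the one with the rightmost centre. *)
Lemma packing1 (T : finType) (Q : {set T}) (c r : T -> R) (lo hi : R) : lo <= hi ->
  (forall t, t \in Q -> 0 < r t /\ lo <= c t - r t /\ c t + r t <= hi) ->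
  (forall s t, s \in Q -> t \in Q -> s != t -> r s + r t <= `|c s - c t|) ->
  \sum_(t in Q) 2 * r t <= hi - lo.
Proof.
move E : #|Q| => n; elim: n Q E hi => [|n IH] Q E hi lohi Qr Qd.
  by rewrite (cards0_eq E) big_set0 subr_ge0.
have [t0 Qt0] : exists t, t \in Q by apply/set0Pn; rewrite -card_gt0 E.
pose t := [arg max_(t > t0 in Q) c t]%O.
have [Qt tmax] : t \in Q /\ forall s, s \in Q -> c s <= c t.
  by rewrite /t; case: arg_maxP => // i Qi H.
have [rt [lot thi]] := Qr t Qt.
rewrite (big_setD1 t) //=.
have cQ : #|Q :\ t| = n by move: E; rewrite (cardsD1 t) Qt => -[].
have {}IH : \sum_(s in Q :\ t) 2 * r s <= (c t - r t) - lo.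
  apply: IH => //.
    move=> s /setD1P[st Qs]; have [rs [los _]] := Qr s Qs; split=> //; split=> //.
    have := Qd s t Qs Qt st; rewrite ler0_norm; first by lra.
    by rewrite subr_le0 tmax.
  by move=> s s' /setD1P[_ Qs] /setD1P[_ Qs']; exact: Qd.
by lra.
Qed.

Lemma overlap (c r c' r' : R) : 0 < r -> 0 < r' ->
  (forall y, `|y - c| < r -> `|y - c'| < r' -> False) -> r + r' <= `|c - c'|.
Proof.
move=> r0 r0' H; rewrite leNgt; apply/negP => lt.
have s0 : 0 < r + r' by lra.
(* The point that divides the segment from [c] to [c'] in the ratio r : r'. *)
apply: (H ((c * r' + c' * r) / (r + r'))).
  have -> : (c * r' + c' * r) / (r + r') - c = (c' - c) * (r / (r + r')) by field; rewrite gt_eqF.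
  rewrite normrM distrC (gtr0_norm (divr_gt0 r0 s0)) mulrCA -[ltRHS]mulr1 ltr_pM2l //.
  by rewrite ltr_pdivrMr // mul1r.
have -> : (c * r' + c' * r) / (r + r') - c' = (c - c') * (r' / (r + r')) by field; rewrite gt_eqF.
rewrite normrM (gtr0_norm (divr_gt0 r0' s0)) mulrCA -[ltRHS]mulr1 ltr_pM2l //.
by rewrite ltr_pdivrMr // mul1r.
Qed.

Lemma packing (I T : finType) (l : I -> R) (i : T -> I) (c r : T -> R) :
  (forall j, 0 <= l j) ->
  (forall t, 0 < r t /\ `|c t| + r t <= l (i t)) ->
  (forall s t y, s != t -> i s = i t -> `|y - c s| < r s -> `|y - c t| < r t -> False) ->
  \sum_t 2 * r t <= \sum_j 2 * l j.
Proof.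
move=> l0 H D; rewrite (partition_big i predT) //=; apply: ler_sum => j _.
rewrite (eq_bigl (fun t => t \in [set t | i t == j]%SET)); last by move=> t; rewrite inE.
have -> : 2 * l j = l j - (- l j) by ring.
apply: (@packing1 _ _ c r) => [|t|s t]; first by have := l0 j; lra.
  rewrite inE => /eqP <-; have [r0 h] := H t.
  by split => //; move: (ler_norm (c t)) (ler_norm (- c t)); rewrite normrN; lra.
rewrite !inE => /eqP es /eqP et st; apply: overlap; [by have [] := H s|by have [] := H t|].
by move=> y; apply: D => //; rewrite es et.
Qed.
End Packing.

(** * Length of horizontal arcs near a prong, and the recurrence theorem *)

Section Quadratic.
Variable R : realType.

Definition quadratic (alpha beta t : R) : R := t ^+ 2 + alpha * t + beta.

Lemma near_R (t : R) (P : set R) : (\forall u \near (t : R^o), P u) <->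
  exists2 e, 0 < e & forall u, `|u - t| < e -> P u.
Proof.
split=> [/nbhs_ballP[e /= e0 H]|[e e0 H]].
  by exists e => // u ut; apply: H; rewrite /ball /= distrC.
by apply/nbhs_ballP; exists e => // u; rewrite /ball /= distrC; exact: H.
Qed.

Lemma quadratic_unique (alpha beta alpha' beta' t : R) :
  (\forall u \near (t : R^o), quadratic alpha beta u = quadratic alpha' beta' u) ->
  alpha = alpha' /\ beta = beta'.
Proof.
move=> /near_R[e e0 H].
have h0 := H t; rewrite subrr normr0 in h0; have {}h0 := h0 e0.
have h1 : quadratic alpha beta (t + e / 2) = quadratic alpha' beta' (t + e / 2).
  by apply: H; rewrite addrC addKr gtr0_norm; lra.
rewrite /quadratic in h0 h1.
have : (alpha - alpha') * (e / 2) = 0 by lra.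
move/eqP; rewrite mulf_eq0 => /orP[|/eqP]; last by lra.
by rewrite subr_eq0 => /eqP ea; split=> //; move: h0; rewrite ea => /addrI.
Qed.

(** Quadratics that agree near a point have equal coefficients, so the local coefficients propagate
    along the interval. *)
Lemma quadratic_global (f : R -> R) (a b : R) : a <= b ->
  (forall t, a <= t <= b -> exists alpha beta, \forall u \near (t : R^o), f u = quadratic alpha beta u) ->
  exists alpha beta, forall t, a <= t <= b -> f t = quadratic alpha beta t.
Proof.
move=> ab loc; have aab : a <= a <= b by rewrite lexx.
have [alpha [beta Ha]] := loc a aab; exists alpha, beta => t /andP[at_ tb].
suff : \forall u \near (t : R^o), f u = quadratic alpha beta u by exact: nbhs_singleton.
apply: (@itv_induction R (fun t => \forall u \near (t : R^o), f u = quadratic alpha beta u) a t) => //.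
move=> u /andP[au ut]; have uab : a <= u <= b by rewrite au (le_trans ut).
have [alpha' [beta' /near_R[e e0 Hu]]] := loc u uab.
have nHu v : `|v - u| < e -> \forall w \near (v : R^o), f w = quadratic alpha' beta' w.
  move=> vu; apply/near_R; exists (e - `|v - u|); first by rewrite subr_gt0.
  move=> w wv; apply: Hu; have := ler_normD (w - v) (v - u); rewrite addrA subrK; lra.
exists e => // v w _ _ vu wu Pv.
have [-> ->] : alpha = alpha' /\ beta = beta'; last exact: nHu.
apply: (@quadratic_unique _ _ _ _ v); near=> x.
have <- : f x = quadratic alpha beta x by near: x.
by near: x; exact: nHu.
Unshelve. all: by end_near.
Qed.

(** The second difference at the end points and the midpoint is (b - a)^2 / 2, and it is at most 4
    rho. The bound is stated linearly to avoid a square root. *)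
Lemma quadratic_bounded (f : R -> R) (a b rho : R) : a <= b ->
  (forall t, a <= t <= b -> exists alpha beta, \forall u \near (t : R^o), f u = quadratic alpha beta u) ->
  (forall t, a <= t <= b -> `|f t| <= rho) -> b - a <= 1 + 8 * rho.
Proof.
move=> ab loc bd; have [alpha [beta H]] := quadratic_global ab loc.
have ha : a <= a <= b by lra.
have hb : a <= b <= b by lra.
have hm : a <= (a + b) / 2 <= b by lra.
have e : f a + f b - 2 * f ((a + b) / 2) = (b - a) ^+ 2 / 2.
  by rewrite (H _ ha) (H _ hb) (H _ hm) /quadratic; field.
have := bd _ ha; have := bd _ hb; have := bd _ hm; rewrite !ler_norml => /andP[? ?] /andP[? ?] /andP[? ?].
have h : (b - a) ^+ 2 <= 8 * rho by lra.
have [h1|h1] := leP (b - a) 1; first by have := le_trans (sqr_ge0 _) h; lra.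
have : b - a <= (b - a) ^+ 2 by rewrite expr2 ler_peMr //; lra.
by lra.
Qed.

Lemma complex_power_bound (x y rho : R) k : 0 <= rho -> x ^+ 2 + y ^+ 2 <= rho ^+ 2 ->
  `|complex.Re ((x +i* y)%C ^+ k)| <= rho ^+ k.
Proof.
move=> rho0 h.
have N : complex.Re ((x +i* y)%C ^+ k) ^+ 2 + complex.Im ((x +i* y)%C ^+ k) ^+ 2 = (x ^+ 2 + y ^+ 2) ^+ k.
  elim: k => [|k IH]; first by rewrite !expr0 /=; ring.
  rewrite [(x +i* y)%C ^+ _]exprS [RHS]exprS -IH; case: ((x +i* y)%C ^+ k) => u v /=; ring.
rewrite -(@ler_pXn2r _ 2) // ?nnegrE ?exprn_ge0 //.
rewrite -normrX ger0_norm ?sqr_ge0 // -exprM mulnC exprM.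
apply: (@le_trans _ _ ((x ^+ 2 + y ^+ 2) ^+ k)); first by rewrite -N lerDl sqr_ge0.
by apply: lerXn2r => //; rewrite nnegrE ?addr_ge0 ?sqr_ge0.
Qed.
End Quadratic.

Lemma compact_finite_cover (T : topologicalType) (B : set T) : compact B -> cover_compact B.
Proof.
have [[x _]|B0] := pselect (B !=set0); last first.
  by move=> _ I D f _ _; exists fset0 => // y By; case: B0; exists y.
pose Tp : ptopologicalType :=
  HB.pack_for ptopologicalType (Topological.sort T) (isPointed.Build (Topological.sort T) x).
have e : @compact Tp = @cover_compact Tp := @compact_cover Tp.
by move=> cB; have : @compact Tp B := cB; rewrite e.
Qed.

Lemma expr_unbounded (R : realType) (x y : R) : 1 < x -> exists n, y <= x ^+ n.
Proof.
move=> x1; have H n : 1 + n%:R * (x - 1) <= x ^+ n.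
  elim: n => [|n IH]; first by rewrite mul0r addr0 expr0.
  rewrite exprS -natr1; have : 0 <= (n%:R : R) by [].
  have x0 : 0 <= x by lra.
  have := ler_wpM2l x0 IH => h nn0.
  have : 0 <= n%:R * ((x - 1) * (x - 1)) by rewrite !mulr_ge0 //; lra.
  by lra.
have [n Hn] : exists n : nat, y / (x - 1) < n%:R.
  by exists (Num.truncn (y / (x - 1))).+1; exact: truncnS_gt.
exists n; apply: le_trans (H n); move: Hn; rewrite ltr_pdivrMr; lra.
Qed.

Lemma mul_addn_sub (n a k k' : nat) : (k < k')%N ->
  (n * (k' + a) = n * (k + a) + n * (k' - k))%N.
Proof. by move=> kk'; rewrite -mulnDr; congr (n * _)%N; lia. Qed.

Section Recurrence.
Variables (R : realType) (S : topologicalType) (phi : homeomorphism S).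
Variables (A : set (flat_chart R S)) (M : set S) (lambda : R).
Hypotheses (S_haus : hausdorff_space S) (lambda_gt1 : 1 < lambda)
  (atlas : foliation_atlas A M) (M_phi : forall p, M p -> M (phi p))
  (phi_flat : forall c d p, A c -> A d -> c.1 p -> d.1 (phi p) ->
        exists e1 e2 a b, [/\ is_sign e1, is_sign e2 & \forall y \near p,
          d.2 (phi y) = (e1 * lambda * (c.2 y).1 + a,
                         e2 * lambda^-1 * (c.2 y).2 + b)]).
Hypothesis S_compact : compact [set: S].
(* [ends z] is the singular point or boundary component through [z]. *)
Variable ends : S -> set S.
Hypotheses (ends_self : forall z, ~ M z -> ends z z)
  (ends_eq : forall z w, ~ M z -> ends z w -> ends w = ends z)
  (ends_sub : forall z w, ~ M z -> ends z w -> ~ M w)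
  (ends_closed : forall z, ~ M z -> closed (ends z))
  (ends_coclosed : forall z, ~ M z -> closed (~` M `\` ends z))
  (ends_prong : forall z, ~ M z -> exists k, prong A (ends z) k).

(** Arcs of horizontal leaves, at unit speed for the flat metric. *)
Definition hor (gam : R -> S) (a b : R) : Prop := forall t, a <= t <= b ->
  [/\ M (gam t), {for t, continuous (gam : R^o -> S)} &
   forall c, A c -> c.1 (gam t) -> exists e a0 b0, is_sign e /\
     \forall u \near (t : R^o), c.2 (gam u) = (e * u + a0, b0)].

Lemma hor_iter n q l y a b : is_square A q l -> `|y| < l ->
  (forall t, a <= t <= b -> `|t| < lambda ^+ n * l) ->
  hor (fun t => iter n phi (q (t / lambda ^+ n, y))) a b.
Proof.
move=> sq yl H t tab; have m0 := lambdaX_gt0 lambda_gt1 n.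
have bt : box l (t / lambda ^+ n, y).
  by split => //=; rewrite normrM normfV (gtr0_norm m0) ltr_pdivrMr // mulrC; exact: H.
have ct : {for t, continuous (fun t : R^o => (t / lambda ^+ n, y) : R * R)}.
  apply: (@continuous_pair R^o R R); last by move=> ?; exact: cvg_cst.
  by move=> u; apply: cvgM; [exact: cvg_id|exact: cvg_cst].
have cqt : {for t, continuous (fun t : R^o => q (t / lambda ^+ n, y))}.
  by apply: (@continuous_comp _ _ _ (fun t : R^o => (t / lambda ^+ n, y) : R * R) q) => //; exact: square_cont sq bt.
have [_ [c [c0 [Ac Hc _ _]]]] := sq.
have Mt := iter_M M_phi n (square_M atlas sq bt).
split => //.
  by apply: (@continuous_comp _ _ _ (fun t : R^o => q (t / lambda ^+ n, y)) (iter n phi)) => //; exact: iter_phi_continuous.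
move=> d Ad dt; have [ct' et] := Hc _ bt.
have [k [s1 s2] nk] := iter_flat atlas M_phi phi_flat Ac Ad ct' dt.
have nk' := cqt _ nk.
have nb : \forall u \near (t : R^o), box l (u / lambda ^+ n, y).
  by apply: ct; apply: open_nbhs_nbhs; split => //; exact: box_open.
exists k.1.1, (k.1.1 * lambda ^+ n * c0.1 + k.2.1), (k.1.2 * (lambda ^+ n)^-1 * (c0.2 + y) + k.2.2).
split => //; near=> u.
have -> : d.2 (iter n phi (q (u / lambda ^+ n, y))) = aff (lambda ^+ n) k (c.2 (q (u / lambda ^+ n, y))) by near: u.
have bu : box l (u / lambda ^+ n, y) by near: u.
have [_ ->] := Hc _ bu; rewrite /aff /=; congr (_, _).
by field; rewrite gt_eqF.
Unshelve. all: by end_near.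
Qed.

(** Along such an arc the real part of z^k is the real part of a squared flat coordinate, that is, a
    monic quadratic in the parameter. It is bounded because z stays in a disc of radius [r], so
    [quadratic_bounded] applies. *)
Lemma prong_short P k : prong A P k -> exists U rho, [/\ open U, P `<=` U, 0 <= rho &
  forall gam a b, a <= b -> hor gam a b -> (forall t, a <= t <= b -> (U `\` P) (gam t)) -> b - a <= rho].
Proof.
case=> U [psi [g [r [[oU PU r0 [[psiB _ _ _] _] _] H]]]].
exists U, (1 + 8 * r ^+ k); split => //.
  by rewrite addr_ge0 // mulr_ge0 // exprn_ge0 // ltW.
move=> gam a b ab hg gU.
pose f t := complex.Re (((psi (gam t)).1 +i* (psi (gam t)).2)%C ^+ k).
apply: (@quadratic_bounded _ f) => // t tab.
  have [Mt ct Ht] := hg t tab.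
  have [c Ac cp] := chart_at atlas Mt.
  have [Ut Pt] := gU t tab.
  have [e [a0 [b0 [se ne]]]] := Ht c Ac cp.
  have [e1 [e2 [a1 [b1 [s1 s2 nz]]]]] := H c (gam t) Ac (conj (conj cp Ut) Pt).
  have nz' := ct _ nz.
  exists (2 * e * (a0 - a1)), ((a0 - a1) ^+ 2 - (b0 - b1) ^+ 2); near=> u.
  rewrite /f; have <- : ((e1 * ((c.2 (gam u)).1 - a1)) +i* (e2 * ((c.2 (gam u)).2 - b1)))%C ^+ 2
        = ((psi (gam u)).1 +i* (psi (gam u)).2)%C ^+ k by near: u.
  have -> : c.2 (gam u) = (e * u + a0, b0) by near: u.
  rewrite expr2 /= /quadratic.
  have ee : e * e = 1 by case: se => ->; ring.
  have e11 : e1 * e1 = 1 by case: s1 => ->; ring.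
  have e22 : e2 * e2 = 1 by case: s2 => ->; ring.
  have -> : e1 * (e * u + a0 - a1) * (e1 * (e * u + a0 - a1)) - e2 * (b0 - b1) * (e2 * (b0 - b1)) =
    (e1 * e1) * ((e * e) * u ^+ 2 + 2 * e * (a0 - a1) * u + (a0 - a1) ^+ 2) - (e2 * e2) * (b0 - b1) ^+ 2 by ring.
  by rewrite ee e11 e22; ring.
have /andP[_ h] : 0 < (psi (gam t)).1 ^+ 2 + (psi (gam t)).2 ^+ 2 < r ^+ 2.
  by apply: psiB; exists (gam t) => //; exact: gU.
by apply: complex_power_bound; exact: ltW.
Unshelve. all: by end_near.
Qed.

Lemma ends_nbhs : exists (s : {fset S}) (D : S -> set S) (rho : S -> R),
  [/\ forall z, z \in s -> ~ M z /\ open (D z), ~` M `<=` \bigcup_(z in [set` s]) D z,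
   forall z w, z \in s -> w \in s -> D z `&` D w !=set0 -> ends z = ends w,
   forall z, 0 <= rho z &
   forall z, z \in s -> forall gam a b, a <= b -> hor gam a b ->
     (forall t, a <= t <= b -> exists w, [/\ w \in s, ends w = ends z & D w (gam t)]) -> b - a <= rho z].
Proof.
have normal := (iffLR (@normal_openP R S)) (compact_normal S_haus S_compact).
have /choice[F HF] : forall P : set S, exists F : set S * R * (set S * set S),
    (exists2 z, ~ M z & P = ends z) ->
    [/\ [/\ open F.1.1, P `<=` F.1.1, 0 <= F.1.2 &
      forall gam a b, a <= b -> hor gam a b -> (forall t, a <= t <= b -> (F.1.1 `\` P) (gam t)) -> b - a <= F.1.2],
      open F.2.1, open F.2.2 & [/\ P `<=` F.2.1, ~` M `\` P `<=` F.2.2 & F.2.1 `&` F.2.2 = set0]].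
  move=> P; have [[z nMz Pz]|nP] := pselect (exists2 z, ~ M z & P = ends z); last first.
    by exists (set0, 0, (set0, set0)).
  have [k pk] := ends_prong nMz.
  have [U [rho UP]] := prong_short pk.
  have [|V [W [oV oW PV ZW VW]]] := normal _ _ (ends_closed nMz) (ends_coclosed nMz).
    by rewrite setDE setIA [ends z `&` _]setIC -setIA setICr setI0.
  by exists (U, rho, (V, W)) => _; rewrite Pz; split.
have HFz z : ~ M z -> _ := fun nMz => HF (ends z) (ex_intro2 _ _ z nMz erefl).
have clM : closed (~` M) by apply: open_closedC; exact: M_open atlas.
have cZ : compact (~` M) by exact: subclosed_compact clM S_compact _.
have : cover_compact (~` M) by exact: compact_finite_cover.
move=> /(_ S (~` M) (fun z => (F (ends z)).1.1 `&` (F (ends z)).2.1)).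
case=> [z nMz|z nMz|s sM scov].
- by have [[oU _ _ _] oV _ _] := HFz z nMz; exact: openI.
- exists z => //; have [[_ PU _ _] _ _ [PV _ _]] := HFz z nMz.
  by split; [apply: PU|apply: PV]; exact: ends_self.
have nM z : z \in s -> ~ M z by move=> /sM /set_mem.
(* Intersecting with the sets [F.2.2] of the other ends makes the neighbourhoods of distinct ends
   disjoint, so that an arc inside their union stays near a single end. *)
pose D z := ((F (ends z)).1.1 `&` (F (ends z)).2.1) `&`
  \bigcap_(w in [set w | (w \in (s : seq S)) && (ends w != ends z)]) (F (ends w)).2.2.
exists s, D, (fun z => if z \in s then (F (ends z)).1.2 else 0).
have disj z w : z \in s -> w \in s -> D z `&` D w !=set0 -> ends z = ends w.
  move=> zs ws [p [[[_ Vp] _] [_ /(_ z)]]] /=; apply: contraPP => /eqP ne.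
  rewrite zs ne /= => /(_ isT) Wp; have [_ _ _ [_ _ VW]] := HFz z (nM z zs).
  by have : (F (ends z)).2.1 p /\ (F (ends z)).2.2 p by []; rewrite -[X in X -> _]/(((F (ends z)).2.1 `&` (F (ends z)).2.2) p) VW.
split => //.
- move=> z zs; have nMz := nM z zs; split => //; apply: openI.
    by have [[oU _ _ _] oV _ _] := HFz z nMz; exact: openI.
  rewrite bigcap_seq_cond big_seq_cond; apply: (big_ind open); [exact: openT|exact: openI|].
  by move=> w /andP[ws _]; have [_ _ oW _] := HFz w (nM w ws).
- move=> p nMp; have [z /= zs [Up Vp]] := scov p nMp.
  exists z => //; split => // w /= /andP[ws ne].
  have [_ _ _ [_ ZW _]] := HFz w (nM w ws).
  have [_ _ _ [_ ZW' VW']] := HFz z (nM z zs).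
  apply: ZW; split => // wp; have ewp := ends_eq (nM w ws) wp.
  have [zp|nzp] := pselect (ends z p).
    by move: ne; rewrite -ewp (ends_eq (nM z zs) zp) eqxx.
  have : ((F (ends z)).2.1 `&` (F (ends z)).2.2) p by split => //; apply: ZW'.
  by rewrite VW'.
- by move=> z; case: ifP => // zs; have [[_ _ ? _] _ _ _] := HFz z (nM z zs).
- move=> z zs gam a b ab hg gD; rewrite zs.
  have [[_ _ _ H] _ _ _] := HFz z (nM z zs); apply: (H gam a b ab hg) => t tab.
  have [w [ws <- [[Ut _] _]]] := gD t tab; split => // wt.
  by have [Mt _ _] := hg t tab; exact: ends_sub (nM w ws) wt Mt.
Qed.

(** An arc that avoids all half squares stays in the neighbourhoods of the ends, by connectedness
    near a single end, and there its length is bounded. *)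
Lemma hor_meets : exists (s : {fset S}) (q : S -> R * R -> S) (l : S -> R) (L0 : R),
  [/\ 0 < L0, forall p, 0 < l p, forall p, p \in s -> is_square A (q p) (l p) &
   forall gam a b, hor gam a b -> L0 <= b - a ->
     exists t p w, [/\ a <= t <= b, p \in s, box (l p / 2) w & gam t = q p w]].
Proof.
have [s [D [rho [sD Dcov Ddisj rho0 Dshort]]]] := ends_nbhs.
have /choice[F HF] : forall p : S, exists F : (R * R -> S) * R, 0 < F.2 /\ (M p -> is_square A F.1 F.2 /\ F.1 (0, 0) = p).
  move=> p; have [Mp|nMp] := pselect (M p); last by exists (fun=> p, 1).
  have [q [l [sq qp _]]] := square_at atlas Mp openT I.
  by exists (q, l); split => //; exact: square_gt0 sq.
(* A cover of [S] indexed by its points: half squares at regular points, the union of all end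
   neighbourhoods at the others. *)
pose H p := if `[< M p >] then (F p).1 @` (box (F p).2 `&` box ((F p).2 / 2)) else \bigcup_(z in [set` s]) D z.
have oD : open (\bigcup_(z in [set` s]) D z) by apply: bigcup_open => z /sD[].
have : cover_compact [set: S] by exact: compact_finite_cover.
move=> /(_ S setT H).
case=> [p _|p _|s2 _ s2cov].
- rewrite /H; case: asboolP => Mp //.
  by have [_ /(_ Mp)[sq _]] := HF p; apply: (square_open atlas sq); exact: box_open.
- exists p => //; rewrite /H; case: asboolP => Mp; last exact: Dcov.
  have [l0 /(_ Mp)[sq e]] := HF p; exists (0, 0) => //.
  by split; apply: (@box0 R) => //; lra.
pose sM := [fset p in s2 | `[< M p >]]%fset.
pose L0 := 1 + \sum_(z <- s) rho z.
have sr0 : 0 <= \sum_(z <- s) rho z by apply: sumr_ge0.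
exists sM, (fun p => (F p).1), (fun p => (F p).2), L0.
split; first by rewrite /L0; lra.
- by move=> p; have [] := HF p.
- by move=> p; rewrite !inE => /andP[_ /asboolP Mp]; have [_ /(_ Mp)[]] := HF p.
move=> gam a b hg Lab; apply: contrapT => no.
have inD t : a <= t <= b -> exists2 z, z \in s & D z (gam t).
  move=> tab; have [p /= ps2] := s2cov (gam t) I; rewrite /H; case: asboolP => Mp; last by case=> z; exists z.
  move=> [w [_ bw] ew]; case: no; exists t, p, w; split => //.
  by rewrite !inE ps2; apply/asboolP.
have ab : a <= b by rewrite /L0 in Lab; lra.
have aab : a <= a <= b by rewrite lexx.
have [z zs Dz] := inD a aab.
have gD t : a <= t <= b -> exists w, [/\ w \in s, ends w = ends z & D w (gam t)].
  move=> /andP[at_ tb].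
  apply: (@itv_induction R (fun t => exists w, [/\ w \in s, ends w = ends z & D w (gam t)]) a t) => //; last by exists z.
  move=> u /andP[au ut]; have uab : a <= u <= b by rewrite au (le_trans ut).
  have [w ws Dw] := inD u uab; have [_ cu _] := hg u uab.
  have /near_R[e e0 He] : \forall v \near (u : R^o), D w (gam v).
    by apply: cu; apply: open_nbhs_nbhs; split => //; have [] := sD w ws.
  exists e => // v v' _ _ vu v'u [w' [w's ew' Dw']].
  exists w; split => //; last exact: He.
  by rewrite -ew'; apply: Ddisj => //; exists (gam v); split => //; exact: He.
have := Dshort z zs gam a b ab hg gD.
have : rho z <= \sum_(z <- s) rho z.
  by rewrite (big_fsetD1 z) //= lerDl sumr_ge0.
by rewrite /L0 in Lab; lra.
Qed.

(** A horizontal arc of length [L0] in the stretched square meets some half square; affine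
    continuation slides the meeting point to the vertical axis of that square, and then along the
    axis. The margin [lm] on either side pays for the horizontal slide. *)
Lemma strip_crossing q0 l0 (s : {fset S}) (q : S -> R * R -> S) (l : S -> R) (L0 : R) (lm : R) n (a : R) :
  is_square A q0 l0 -> (forall p, p \in s -> is_square A (q p) (l p)) ->
  (forall p, p \in s -> l p <= lm) -> 
  (forall gam a b, hor gam a b -> L0 <= b - a ->
     exists t p w, [/\ a <= t <= b, p \in s, box (l p / 2) w & gam t = q p w]) ->
  (forall p, p \in s -> 2 * l0 < lambda ^+ n * l p) -> 0 <= L0 ->
  0 <= a -> a + (L0 + 2 * lm) <= lambda ^+ n * l0 -> 0 < lm ->
  exists p c, [/\ p \in s, `|c| + l0 / lambda ^+ n <= l p &
    forall y, `|y - c| < l0 / lambda ^+ n -> exists z, [/\ box l0 z,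
      a < lambda ^+ n * z.1 < a + (L0 + 2 * lm) & q p (0, y) = iter n phi (q0 z)]].
Proof.
move=> sq0 sq llm meets mu2 L00 a0 aL lm0.
have m0 := lambdaX_gt0 lambda_gt1 n; set mu := lambda ^+ n in m0 mu2 aL *.
have l00 := square_gt0 sq0.
have hh : hor (fun t => iter n phi (q0 (t / mu, 0))) (a + lm) (a + lm + L0).
  apply: hor_iter sq0 _ _; rewrite ?normr0 // => t /andP[t1 t2]; rewrite ger0_norm -/mu; lra.
have [|t [p [w [/andP[t1 t2] ps bw ew]]]] := meets _ _ _ hh; first by lra.
have lp := square_gt0 (sq p ps); have lpm := llm p ps.
have bz : box l0 (t / mu, 0).
  split => /=; rewrite ?normr0 // normrM normfV (gtr0_norm m0) ltr_pdivrMr // mulrC ger0_norm; lra.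
have bw' : box (l p) w by apply: box_le bw; lra.
have [k [[s1 s2] ek H]] := agree S_haus lambda_gt1 atlas M_phi phi_flat sq0 (sq p ps) bz bw' ew.
rewrite -/mu in ek H.
have mun0 : mu != 0 by rewrite gt_eqF.
have lr : l0 / mu < l p / 2.
  by have := mu2 p ps; rewrite ltr_pdivrMr //; lra.
have [w1 w2] := bw.
exists p, w.2; split => //; first by lra.
move=> y yc.
have e11 : k.1.1 * k.1.1 = 1 by case: s1 => ->; ring.
have e22 : k.1.2 * k.1.2 = 1 by case: s2 => ->; ring.
(* Signs being their own inverses, this solves [aff mu k z = (0, y)]. *)
pose z := ((t - k.1.1 * w.1) / mu, k.1.2 * mu * (y - w.2)) : R * R.
have nz1 : `|k.1.1 * w.1| < l p / 2 by rewrite normrM (sign_norm s1) mul1r.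
have bz2 : box l0 z.
  split => /=.
    rewrite normrM normfV (gtr0_norm m0) ltr_pdivrMr // mulrC.
    by move: nz1; rewrite ltr_norml => /andP[? ?]; rewrite ger0_norm; lra.
  rewrite (sign_mulr_norm _ s2 (ltW m0)); move: yc; rewrite ltr_pdivlMr //.
  by rewrite mulrC.
have az : aff mu k z = (0, y).
  move: ek; rewrite /aff /= [w]surjective_pairing => -[ew1 ew2] /=.
  rewrite /z /=; congr (_, _).
    have -> : k.1.1 * mu * ((t - k.1.1 * w.1) / mu) = k.1.1 * t - (k.1.1 * k.1.1) * w.1 by field.
    have : k.1.1 * mu * (t / mu) = k.1.1 * t by field.
    by rewrite e11; lra.
  have -> : k.1.2 / mu * (k.1.2 * mu * (y - w.2)) = (k.1.2 * k.1.2) * (y - w.2) by field.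
  by rewrite e22; lra.
exists z; split => //.
  have -> : mu * z.1 = t - k.1.1 * w.1 by rewrite /z /=; field.
  by move: nz1; rewrite ltr_norml => /andP[? ?]; apply/andP; split; lra.
rewrite -az; apply/esym; apply: H => //; rewrite az; split => /=; first by rewrite normr0.
have := ler_normD (y - w.2) w.2; rewrite subrK; lra.
Qed.

Lemma iter_phi_inj n : injective (iter n phi).
Proof. by elim: n => [|n IH] x y //= /(can_inj (hfunK phi)) /IH. Qed.

(** Without returns after time [n0], the images of a square inside [O] under iterates whose
    exponents differ by at least [n0] are disjoint. Each of them cuts the vertical axes of finitely
    many squares in intervals of total length at least [l0 ^+ 2 / L1], so that [K] iterates exceed
    the total length [F] of these axes. *)
Lemma recurrence (O : set S) (n0 : nat) : open O -> O `<=` M -> O !=set0 ->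
  exists n p, [/\ (n0 <= n)%N, O p & O (iter n phi p)].
Proof.
move=> oO OM [p0 Op0]; apply: contrapT => no.
have {}no n p : (n0 <= n)%N -> O p -> ~ O (iter n phi p) by move=> ? ? ?; apply: no; exists n, p.
have [q0 [l0 [sq0 _ qO]]] := square_at atlas (OM _ Op0) oO Op0.
have l00 := square_gt0 sq0.
have [s [q [l [L0 [L00 lpos sq meets]]]]] := hor_meets.
pose lm := 1 + \sum_(p <- s) l p.
have suml0 : 0 <= \sum_(p <- s) l p by apply: sumr_ge0 => p _; exact: ltW.
have lm0 : 0 < lm by rewrite /lm; lra.
have llm p : p \in s -> l p <= lm.
  move=> ps; apply: (@le_trans _ _ (\sum_(p <- s) l p)); last by rewrite /lm; lra.
  by rewrite (big_fsetD1 p) //= lerDl sumr_ge0 // => *; exact: ltW.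
pose L1 := L0 + 2 * lm; have L10 : 0 < L1 by rewrite /L1; lra.
(* Powers beyond [B] make half of the stretched square at least two pieces long ([HB1]) and its
   height small compared with every square ([HB2]). *)
pose B := 1 + L1 / l0 * 2 + \sum_(p <- s) (2 * l0 / l p + 1).
have [K0 HK0] := expr_unbounded B lambda_gt1.
pose n1 := n0.+1; pose nn k := (n1 * (k + K0))%N.
have HB k : B <= lambda ^+ nn k.
  apply: le_trans HK0 _; rewrite ler_eXn2l // /nn /n1; nia.
have sB0 : 0 <= \sum_(p <- s) (2 * l0 / l p + 1).
  by apply: sumr_ge0 => p _; rewrite addr_ge0 // divr_ge0 // ?ltW // mulr_gt0.
have HB1 k : 2 * L1 <= lambda ^+ nn k * l0.
  have h := HB k; have : L1 / l0 * 2 <= lambda ^+ nn k.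
    by apply: le_trans h; rewrite /B; lra.
  by rewrite mulrAC ler_pdivrMr //; lra.
have HB2 k p : p \in s -> 2 * l0 < lambda ^+ nn k * l p.
  move=> ps; rewrite -ltr_pdivrMr //; apply: lt_le_trans (HB k).
  have h0 : 0 <= L1 / l0 * 2 by rewrite mulr_ge0 // divr_ge0 ?ltW.
  have : 2 * l0 / l p + 1 <= \sum_(p <- s) (2 * l0 / l p + 1).
    rewrite (big_fsetD1 p) //= lerDl; apply: sumr_ge0 => p' _.
    by rewrite addr_ge0 // divr_ge0 // ?ltW // mulr_gt0.
  by rewrite /B; lra.
pose J k := Num.truncn (lambda ^+ nn k * l0 / L1).
have HJ k : (J k)%:R * L1 <= lambda ^+ nn k * l0 /\ lambda ^+ nn k * l0 <= 2 * ((J k)%:R * L1).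
  have g0 : 0 <= lambda ^+ nn k * l0 / L1.
    by rewrite divr_ge0 // ?ltW // mulr_gt0 // lambdaX_gt0.
  have /andP[] := truncn_itv g0; rewrite -/(J k) ler_pdivlMr // ltr_pdivrMr // => h1 h2.
  split => //; move: h2; rewrite -natr1 mulrDl mul1r; have := HB1 k; lra.
pose F : R := \sum_(p <- s) 2 * l p.
have C00 : 0 < l0 ^+ 2 / L1 by rewrite divr_gt0 // exprn_gt0.
pose K := (Num.truncn (F / (l0 ^+ 2 / L1))).+1.
have FK : F < K%:R * (l0 ^+ 2 / L1).
  by rewrite -ltr_pdivrMr //; exact: truncnS_gt.
(* A pair stands for one iterate and one piece of length [L1] of the stretched square. *)
pose T : finType := {k : 'I_K & 'I_(J k)}.
have /choice[cf Hcf] : forall t : T, exists pc : s * R,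
   `|pc.2| + l0 / lambda ^+ nn (tag t) <= l (val pc.1) /\
    forall y, `|y - pc.2| < l0 / lambda ^+ nn (tag t) -> exists z, [/\ box l0 z,
      (tagged t)%:R * L1 < lambda ^+ nn (tag t) * z.1 < (tagged t).+1%:R * L1 &
      q (val pc.1) (0, y) = iter (nn (tag t)) phi (q0 z)].
  move=> [k j] /=.
  have [|||||p [c [ps cl H]]] := @strip_crossing q0 l0 s q l L0 lm (nn k) (j%:R * L1) sq0 sq llm meets.
  - by move=> p; exact: HB2.
  - exact: ltW.
  - by rewrite mulr_ge0 // ltW.
  - rewrite -/L1; have [h _] := HJ k; apply: le_trans h.
    have -> : j%:R * L1 + L1 = j.+1%:R * L1 by rewrite -natr1 mulrDl mul1r.
    by apply: ler_wpM2r; [exact: ltW|rewrite ler_nat].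
  - exact: lm0.
  exists ([` ps]%fset, c); split => //= y /H[z [bz h ez]]; exists z; split => //.
  by rewrite -natr1 mulrDl mul1r.
have mpos k := lambdaX_gt0 lambda_gt1 (nn k).
suff le : \sum_(t : T) 2 * (l0 / lambda ^+ nn (tag t)) <= \sum_(j : s) 2 * l (val j).
  have {}le : \sum_(t : T) 2 * (l0 / lambda ^+ nn (tag t)) <= F by rewrite /F big_seq_fsetE.
  move: FK; rewrite ltNge => /negP; apply; apply: le_trans le.
  have := @sig_big_dep R 0 +%R 'I_K (fun k : 'I_K => 'I_(J k)) predT (fun _ => predT) (fun k j => 2 * (l0 / lambda ^+ nn k)).
  rewrite /= => <-.
  have -> : K%:R * (l0 ^+ 2 / L1) = \sum_(k < K) l0 ^+ 2 / L1.
    by rewrite sumr_const card_ord mulr_natl.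
  apply: ler_sum => k _; rewrite sumr_const card_ord -[leRHS]mulr_natl.
  have [_ h] := HJ k; rewrite ler_pdivrMr // expr2.
  have -> : (J k)%:R * (2 * (l0 / lambda ^+ nn k)) * L1 = l0 * (2 * ((J k)%:R * L1) / lambda ^+ nn k) by ring.
  by apply: ler_wpM2l; [exact: ltW|rewrite ler_pdivlMr // mulrC].
apply: (@packing R s T (fun p => l (val p)) (fun t => (cf t).1) (fun t => (cf t).2)
  (fun t => l0 / lambda ^+ nn (tag t))).
- by move=> p; exact: ltW.
- by move=> t; have [h _] := Hcf t; split => //; rewrite divr_gt0.
(* A common point of two intervals gives a return to [O] if the iterates differ; otherwise
   injectivity puts one point of the square into two distinct pieces. *)
- move=> t t' y tt' ett' yt yt'.
  have [_ /(_ y yt)[z [bz hz ez]]] := Hcf t; have [_ /(_ y yt')[z' [bz' hz' ez']]] := Hcf t'.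
  have wander k k' w w' : (k < k')%N -> box l0 w -> box l0 w' ->
      iter (nn k) phi (q0 w) <> iter (nn k') phi (q0 w').
    move=> kk' bw bw'; have -> : nn k' = (nn k + n1 * (k' - k))%N by exact: mul_addn_sub.
    rewrite iterD => /iter_phi_inj e; apply: (no (n1 * (k' - k))%N (q0 w')).
    - by apply: leq_trans (leqnSn n0) (leq_pmulr n1 _); rewrite subn_gt0.
    - exact: qO.
    - by rewrite -e; exact: qO.
  have e : iter (nn (tag t)) phi (q0 z) = iter (nn (tag t')) phi (q0 z') by rewrite -ez -ez' ett'.
  have [lt|lt|ek] := ltngtP (tag t : nat) (tag t').
  - exact: wander lt bz bz' e.
  - exact: wander lt bz' bz (esym e).
  case: t t' tt' ett' yt yt' hz hz' e ek {ez ez'} => [k j] [k' j'] /= tt' _ _ _ hz hz' e ek.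
  have {}ek : k = k' by apply: val_inj.
  subst k'; move/iter_phi_inj: e => /(square_inj sq0 bz bz') ezz.
  rewrite -ezz in hz'.
  have jj' : j != j' by apply: contraNneq tt' => ->.
  case/andP: hz => h1 h2; case/andP: hz' => h3 h4.
  have {h1 h4} le1 : (j < j'.+1)%N by rewrite -(ltr_nat R) -(ltr_pM2r L10) (lt_trans h1).
  have {h2 h3} le2 : (j' < j.+1)%N by rewrite -(ltr_nat R) -(ltr_pM2r L10) (lt_trans h3).
  by move: jj'; rewrite -val_eqE eqn_leq -ltnS le1 -ltnS le2.
Qed.
End Recurrence.

(** * The regular part of a surface *)

(** Connectedness of [W], in the form in which it is applied: locally constant predicates are
    constant. *)
Definition lc_connected (T : topologicalType) (W : set T) : Prop :=
  forall P : T -> Prop,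
    (forall x, W x -> exists O, [/\ open O, O x & forall y, O y -> W y -> P x <-> P y]) ->
    forall x y, W x -> W y -> P x -> P y.

Lemma within_nbhs (X Y : topologicalType) (A : set X) (f : X -> Y) x (O : set Y) :
  {within A, continuous f} -> A x -> nbhs (f x) O -> \forall y \near x, A y -> O (f y).
Proof. by move=> /subspace_continuousP cf Ax nO; exact: (cf x Ax O nO). Qed.

Section Surface.
Variables (R : realType) (S : topologicalType).
Local Notation rv2 := 'rV[R]_2.

Lemma nbhs_rv2P (v : rv2) (P : set rv2) : nbhs v P <->
  exists2 r, 0 < r & forall w : rv2, `|w 0 0 - v 0 0| < r -> `|w 0 1 - v 0 1| < r -> P w.
Proof.
split=> [/nbhs_ballP[r /= r0 H]|[r r0 H]].
  exists r => // w w0 w1; apply: H; split => // i j; rewrite ord1 /ball /= distrC.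
  by case: (unliftP ord0 j) => [k ->|-> //]; rewrite (_ : fintype.lift ord0 k = 1) //; apply: val_inj; rewrite ord1.
by apply/nbhs_ballP; exists r => //= w [_ wr]; apply: H; rewrite distrC; exact: wr.
Qed.

Definition rvbox (v0 : rv2) (r : R) : set rv2 :=
  [set v | `|v 0 0 - v0 0 0| < r /\ `|v 0 1 - v0 0 1| < r].

Lemma rvbox_open v0 r : open (rvbox v0 r).
Proof.
rewrite openE => v [v1 v2]; apply/nbhs_rv2P.
exists (Num.min (r - `|v 0 0 - v0 0 0|) (r - `|v 0 1 - v0 0 1|)); first by rewrite lt_min !subr_gt0 v1.
move=> w; rewrite !lt_min => /andP[h1 _] /andP[_ h2]; split.
  by have := ler_normD (w 0 0 - v 0 0) (v 0 0 - v0 0 0); rewrite addrA subrK; lra.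
by have := ler_normD (w 0 1 - v 0 1) (v 0 1 - v0 0 1); rewrite addrA subrK; lra.
Qed.

Lemma rvbox_convex v0 r : is_convex (rvbox v0 r).
Proof.
move=> p q t [p1 p2] [q1 q2] /andP[t0 t1]; split; rewrite !mxE.
  have -> : (1 - t) * p 0 0 + t * q 0 0 - v0 0 0 = (1 - t) * (p 0 0 - v0 0 0) + t * (q 0 0 - v0 0 0) by ring.
  exact: conv_lt.
have -> : (1 - t) * p 0 1 + t * q 0 1 - v0 0 1 = (1 - t) * (p 0 1 - v0 0 1) + t * (q 0 1 - v0 0 1) by ring.
exact: conv_lt.
Qed.

Lemma halfplane_convex (phi : rv2 -> R) (a : R) :
  (forall p q t, phi ((1 - t) *: p + t *: q) = (1 - t) * phi p + t * phi q) ->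
  is_convex [set v | a < phi v].
Proof.
move=> lin p q t /= ap aq /andP[t0 t1]; rewrite lin.
have h := mulr_ge0 t0 (ltW (_ : 0 < phi q - a)); rewrite subr_gt0 in h; have {}h := h aq.
have [->|tn1] := eqVneq t 1; first by lra.
have t1' : 0 < 1 - t by rewrite subr_gt0 lt_neqAle tn1.
have := mulr_gt0 t1' (_ : 0 < phi p - a); rewrite subr_gt0 => /(_ ap); lra.
Qed.

Lemma convexI (E : normedModType R) (A B : set E) : is_convex A -> is_convex B -> is_convex (A `&` B).
Proof. by move=> cA cB p q t [Ap Bp] [Aq Bq] t01; split; [exact: cA|exact: cB]. Qed.

Lemma lc_convex (B D : set rv2) (g : rv2 -> S) (W : set S) (P : S -> Prop) :
  (forall x, W x -> exists O, [/\ open O, O x & forall y, O y -> W y -> P x <-> P y]) ->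
  {within B, continuous g} -> D `<=` B -> is_convex D -> (forall v, D v -> W (g v)) ->
  forall v w, D v -> D w -> P (g v) -> P (g w).
Proof.
move=> lc cg DB cD DW v w Dv Dw.
pose ga (t : R^o) : rv2 := (1 - t) *: v + t *: w.
have gaD t : 0 <= t <= 1 -> D (ga t) by move=> t01; exact: cD.
have ga0 : ga 0 = v by rewrite /ga subr0 scale0r scale1r addr0.
have ga1 : ga 1 = w by rewrite /ga subrr scale0r scale1r add0r.
have cga : continuous ga.
  apply: continuous_add; apply: continuous_scale; do ?exact: cst_continuous.
    by move=> z; apply: cvgB; [exact: cvg_cst|exact: cvg_id].
  by move=> ?; exact: cvg_id.
rewrite -ga0 -ga1; apply: (@itv_induction R (fun t => P (g (ga t))) 0 1) => // t t01.
have [ O [ oO Ot HO]] := lc _ (DW _ (gaD t t01)).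
have : {within `[0, 1]%classic : set R^o, continuous (g \o ga)}.
  apply: (@within_comp2 _ _ _ _ B ga g) cg; first exact: continuous_subspaceT.
  by move=> u; rewrite /= in_itv => u01; apply/DB/gaD.
have t01' : (`[0, 1]%classic : set R^o) t by rewrite /= in_itv.
move=> /within_nbhs /(_ t01' (open_nbhs_nbhs (conj oO Ot))) /near_R[e e0 He].
exists e => // u u' u01 u01' ut ut' Pu.
have Ou : O (g (ga u)) by apply: He => //; rewrite /= in_itv.
have Ou' : O (g (ga u')) by apply: He => //; rewrite /= in_itv.
by apply/(HO _ Ou' (DW _ (gaD _ u01')))/(HO _ Ou (DW _ (gaD _ u01))).
Qed.

Hypotheses (S_haus : hausdorff_space S) (S_surface : manifold R 1 S).
Variable Sigma : set S.
Hypothesis Sigma_fin : finite_set Sigma.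
Definition regular : set S := ~` mboundary R 1 S `\` Sigma.

Lemma interior_open : open [set p : S | interior_point R 1 p].
Proof.
rewrite openE => p [U [V [oU Up oV h]]].
by apply: filterS (open_nbhs_nbhs (conj oU Up)) => y Uy; exists U, V.
Qed.

Lemma Sigma_closed (A : set S) : A `<=` Sigma -> closed A.
Proof.
move=> AS; apply: (iffLR accessible_finite_set_closed (hausdorff_accessible S_haus)).
exact: sub_finite_set AS Sigma_fin.
Qed.

Lemma homeo_on_open_cont (X Y : topologicalType) (A : set X) (B : set Y) f g x :
  homeo_on A B f g -> open A -> A x -> {for x, continuous f}.
Proof.
move=> [_ [cf _]] oA Ax; move: cf; rewrite continuous_open_subspace // => /(_ x); apply; exact: mem_set.
Qed.

(** One notion for interior and boundary points: [B] will be a box cut by the half plane. Convexity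
    supplies segments and triangles. *)
Definition disc_chart (B : set rv2) (f : S -> rv2) (g : rv2 -> S) : Prop :=
  [/\ is_convex B, {within B, continuous g}, open (g @` B) &
    forall v, B v -> f (g v) = v /\ {for g v, continuous f}].

(** A small chart contains at most one singular point, its centre, and a box or half box minus its
    centre is connected. Whether a point on the edge of a half box is interior is left open: by
    [dense] such a point, if regular, is compared with nearby points of the open half plane. *)
Lemma nice_chart x (O : set S) : open O -> O x -> exists B f g,
  [/\ disc_chart B f g, (g @` B) x, g @` B `<=` O, (g @` B `&` regular) !=set0 &
   lc_connected (g @` B `&` regular)].
Proof.
move=> oO Ox; have [_ /(_ x)[U [V [oU Ux oV [f [g hfg]]]]]] := S_surface.
have [[fU gV fK gK] [cf cg]] := hfg.
pose v0 := f x; have [Vv0 Hv0] : (V `&` half_space R 1) v0 by apply: fU; exists x.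
have cfp y : U y -> {for y, continuous f} by move=> Uy; exact: homeo_on_open_cont hfg oU Uy.
have gx : g v0 = x by apply: fK; exact: mem_set.
pose O' := O `&` U `&` ~` (Sigma `\ x).
have oO' : open O'.
  by apply: openI; [exact: openI|apply: closed_openC; apply: Sigma_closed => y []].
have O'x : O' x by split; [split|move=> [_]; apply].
have nO' : nbhs (g v0) O' by rewrite gx; exact: open_nbhs_nbhs.
have nO2 := within_nbhs cg (conj Vv0 Hv0) nO'.
have nV : nbhs v0 V by exact: open_nbhs_nbhs.
have nVO : nbhs v0 (V `&` [set v | (V `&` half_space R 1) v -> O' (g v)]) by exact: filterI.
have [r0 r00 Hr0] := iffLR (nbhs_rv2P _ _) nVO.
(* If the centre lies in the open half plane, the box is kept away from the edge, so that one can go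
   all the way round the centre. *)
pose r := if 0 < v0 0 0 then Num.min r0 (v0 0 0) else r0.
have rr0 : r <= r0 by rewrite /r; case: ifP => _ //; rewrite ge_min lexx.
have rpos : 0 < r by rewrite /r; case: ifP => // h; rewrite lt_min r00.
pose B := rvbox v0 r `&` half_space R 1.
have BV v : B v -> V v /\ O' (g v).
  move=> [[v1 v2] Hv]; have [||Vv Ov] := Hr0 v; [lra|lra|].
  by split => //; apply: Ov.
have BVH v : B v -> v \in V `&` half_space R 1.
  by move=> Bv; apply/mem_set; split; [exact: (proj1 (BV v Bv))|case: Bv].
have gB v : B v -> f (g v) = v by move=> /BVH; exact: gK.
have UgB v : B v -> U (g v) by move=> /BV[_ [[]]].
have gimg (C : set rv2) : g @` (B `&` C) = U `&` f @^-1` (rvbox v0 r `&` C).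
  apply/seteqP; split=> [_ [v [Bv Cv] <-]|y [Uy [by_ Cy]]] /=.
    by split; [exact: UgB|rewrite gB //; split => //; case: Bv].
  have [_ Hy] : (V `&` half_space R 1) (f y) by apply: fU; exists y.
  by exists (f y); [do 2?split|apply: fK; exact: mem_set].
have ogimg (C : set rv2) : open C -> open (g @` (B `&` C)).
  move=> oC; rewrite gimg openE => y [Uy by_].
  have := cfp y Uy; move=> /(_ (rvbox v0 r `&` C)) /= ny.
  have : nbhs y (f @^-1` (rvbox v0 r `&` C)).
    by apply: ny; apply: open_nbhs_nbhs; split => //; apply: openI => //; exact: rvbox_open.
  by move=> ?; apply: filterI => //; exact: open_nbhs_nbhs.
have ogB : open (g @` B) by rewrite -[B]setIT; apply: ogimg; exact: openT.
have cHalf : is_convex (half_space R 1 : set rv2).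
  move=> p q t /= p0 q0 /andP[t0 t1]; rewrite /half_space /= !mxE.
  by rewrite addr_ge0 // mulr_ge0 // subr_ge0.
have cB : is_convex B by apply: convexI => //; exact: rvbox_convex.
have cgB : {within B, continuous g}.
  by apply: continuous_subspaceW cg => v Bv; apply/set_mem/BVH.
have Bv0 : B v0 by split => //; split; rewrite subrr normr0.
pose pos : set rv2 := [set v | 0 < v 0 0].
have opos : open pos.
  rewrite openE => v v1; apply/nbhs_rv2P; exists (v 0 0) => // w w1 _.
  by move: w1; rewrite ltr_norml => /andP[? ?]; rewrite /pos /=; lra.
have lin0 (i : 'I_2) (p q : rv2) t : ((1 - t) *: p + t *: q) 0 i = (1 - t) * p 0 i + t * q 0 i by rewrite !mxE.
have cpos : is_convex pos by apply: halfplane_convex => p q t; exact: lin0.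
have intpos v : B v -> pos v -> interior_point R 1 (g v).
  move=> Bv pv; exists (g @` (B `&` pos)), (B `&` pos); split.
  - exact: ogimg.
  - by exists v.
  - have -> : B `&` pos = rvbox v0 r `&` pos.
      apply/seteqP; split=> w [[? ?] ?] //; split => //; split => //.
      by apply: ltW.
    by apply: openI => //; exact: rvbox_open.
  - exists f, g; split; last split.
    + split=> [_ [_ [w [Bw pw] <-] <-]|_ [w Bpw <-]|y|w] /=.
      * by rewrite gB.
      * by exists w.
      * by move=> /set_mem [w [Bw pw] <-]; rewrite gB.
      * by move=> /set_mem [Bw _]; exact: gB.
    + apply/continuous_subspaceW; last exact: cf.
      by move=> _ [w [Bw _] <-]; exact: UgB.
    + apply/continuous_subspaceW; last exact: cgB.
      by move=> w [].
have regpos v : B v -> pos v -> g v != x \/ ~ Sigma x -> regular (g v).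
  move=> Bv pv gvx; split; first by apply; exact: intpos.
  move=> Sgv; have [_ [_ notS]] := BV v Bv.
  have e : g v = x by apply: contrapT => ne; apply: notS.
  by case: gvx => [|]; [rewrite e eqxx|rewrite -e].
pose W := g @` B `&` regular.
have dense y O1 : open O1 -> W y -> O1 y -> exists v, [/\ B v, pos v, v != v0 & O1 (g v)].
  move=> oO1 [[v Bv <-] _] O1y.
  have n1 := within_nbhs cgB Bv (open_nbhs_nbhs (conj oO1 O1y)).
  have nb : nbhs v (rvbox v0 r) by apply: open_nbhs_nbhs; split; [exact: rvbox_open|case: Bv].
  have n1b : nbhs v ([set w | B w -> O1 (g w)] `&` rvbox v0 r) by exact: filterI.
  have [e e0 He] := iffLR (nbhs_rv2P _ _) n1b.
  have [_ Hv] := Bv; rewrite /half_space /= in Hv.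
  pose w c : rv2 := \row_j (if j == 0 then v 0 0 + c else v 0 1).
  have w0 c : w c 0 0 = v 0 0 + c by rewrite mxE eqxx.
  have w1 c : w c 0 1 = v 0 1 by rewrite mxE.
  have ww c : 0 < c < e -> [/\ B (w c), pos (w c) & O1 (g (w c))].
    move=> /andP[c0 ce]; have [||Ow bw] := He (w c).
    - by rewrite w0 addrC addKr gtr0_norm.
    - by rewrite w1 subrr normr0.
    have Bw : B (w c) by split => //; rewrite /half_space /= w0; lra.
    by split => //; [rewrite /pos /= w0; lra|exact: Ow].
  have [e1|ne1] := eqVneq (w (e / 2)) v0.
    have [|? ? ?] := ww (e / 3); first by lra.
    exists (w (e / 3)); split => //; rewrite -e1; apply/eqP => /(congr1 (fun u : rv2 => u 0 0)).
    by rewrite !w0; lra.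
  have [|? ? ?] := ww (e / 2); first by lra.
  by exists (w (e / 2)).
have gne v : B v -> v != v0 -> g v != x.
  by move=> Bv; apply: contraNneq => e; rewrite -(gB v Bv) e.
exists B, f, g; split => //.
- split => // v Bv; split; first exact: gB.
  by apply: cfp; exact: UgB.
- by exists v0.
- by move=> _ [v /BV[_ [[]]] ? ? _ <-].
- have oT : open [set: S] by exact: openT.
  have [v [Bv pv vv0 _]] : exists v, [/\ B v, pos v, v != v0 & True].
    pose w : rv2 := \row_j (if j == 0 then v0 0 0 + r / 2 else v0 0 1).
    have w0 : w 0 0 = v0 0 0 + r / 2 by rewrite mxE eqxx.
    have w1 : w 0 1 = v0 0 1 by rewrite mxE.
    move: Hv0; rewrite /half_space /= => Hv0.
    exists w; split => //.
    + split; last by rewrite /half_space /= w0; lra.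
      by split; rewrite ?w0 ?w1 ?subrr ?normr0 // addrC addKr gtr0_norm; lra.
    + by rewrite /pos /= w0; lra.
    + by apply/eqP => /(congr1 (fun u : rv2 => u 0 0)); rewrite w0; lra.
  exists (g v); split; first by exists v.
  by apply: regpos => //; left; exact: gne.
- move=> P lc.
  have convW D : D `<=` B `&` pos -> (forall v, D v -> v != v0 \/ ~ Sigma x) -> is_convex D ->
      forall v w, D v -> D w -> P (g v) <-> P (g w).
    move=> DB Dx cD v w Dv Dw.
    have DW u : D u -> W (g u).
      move=> Du; have [Bu pu] := DB u Du; split; first by exists u.
      apply: regpos => //; case: (Dx u Du); [by left; exact: gne|by right].
    by split; apply: (lc_convex lc cgB _ cD DW) => // u /DB[].
  have key v w : B v -> pos v -> v != v0 -> B w -> pos w -> w != v0 -> P (g v) <-> P (g w).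
    move=> Bv pv vv0 Bw pw wv0.
    have cBp : is_convex (B `&` pos) by exact: convexI.
    have [Sx|nSx] := pselect (Sigma x); last by apply: (convW (B `&` pos)) => //; right.
    have [v0p|v0n] := ltP 0 (v0 0 0); last first.
      apply: (convW (B `&` pos)) => // u [_ pu]; left; apply: contraTneq pu => ->.
      by rewrite /pos /= -leNgt.
    have rv : r <= v0 0 0 by rewrite /r v0p ge_min lexx orbT.
    have boxB u : rvbox v0 r u -> B u /\ pos u.
      move=> bu; have pu : pos u.
        by have [+ _] := bu; rewrite ltr_norml => /andP[? ?]; rewrite /pos /=; lra.
      by split => //; split => //; apply: ltW.
    (* The four open half boxes around the centre. The corner points [pp], [pn] and [np] lie in two
       of them each and chain the punctured box together. *)
    pose D (i : 'I_2) (s : bool) : set rv2 := rvbox v0 r `&`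
      [set u | (if s then v0 0 i else - v0 0 i) < (if s then u 0 i else - u 0 i)].
    have cDs i s : is_convex (D i s).
      apply: convexI; first exact: rvbox_convex.
      by apply: halfplane_convex => p q t; case: s; rewrite lin0 //; ring.
    have Dc i s u u' : D i s u -> D i s u' -> P (g u) <-> P (g u').
      apply: convW => // {u u'} u [bu Hu]; first exact: boxB.
      by left; apply: contraTneq Hu => ->; case: s => /=; rewrite ltxx.
    pose c (a b : R) : rv2 := \row_j (if j == 0 then v0 0 0 + a else v0 0 1 + b).
    have c0 a b : c a b 0 0 = v0 0 0 + a by rewrite mxE eqxx.
    have c1 a b : c a b 0 1 = v0 0 1 + b by rewrite mxE.
    have r2 : 0 < r / 2 by lra.
    have cb a b : `|a| = r / 2 -> `|b| = r / 2 -> rvbox v0 r (c a b).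
      by move=> a2 b2; split; rewrite ?c0 ?c1 addrC addKr ?a2 ?b2; lra.
    have nr : `|r / 2| = r / 2 by rewrite gtr0_norm.
    have nr' : `|- (r / 2)| = r / 2 by rewrite normrN.
    pose pp := c (r / 2) (r / 2); pose pn := c (r / 2) (- (r / 2)); pose np := c (- (r / 2)) (r / 2).
    have base u : B u -> u != v0 -> P (g u) <-> P (g pp).
      move=> [bu _] uv0.
      have Epn : P (g pn) <-> P (g pp) by apply: (Dc 0 true); (split; [exact: cb|rewrite /= c0; lra]).
      have Enp : P (g np) <-> P (g pp) by apply: (Dc 1 true); (split; [exact: cb|rewrite /= c1; lra]).
      have [lt0|lt0|e0] := ltgtP (v0 0 0) (u 0 0).
      - by apply: (Dc 0 true); split => //; [exact: cb|rewrite /= c0; lra].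
      - rewrite -Enp; apply: (Dc 0 false); split => //=; [lra|exact: cb|rewrite c0; lra].
      have [lt1|lt1|e1] := ltgtP (v0 0 1) (u 0 1).
      - by apply: (Dc 1 true); split => //; [exact: cb|rewrite /= c1; lra].
      - rewrite -Epn; apply: (Dc 1 false); split => //=; [lra|exact: cb|rewrite c1; lra].
      case/eqP: uv0; apply/rowP => j; case: (unliftP ord0 j) => [k ->|-> //].
      by rewrite (_ : fintype.lift ord0 k = 1) //; apply: val_inj; rewrite ord1.
    by rewrite (base v) // (base w).
  have near_pt y : W y -> exists v, [/\ B v, pos v, v != v0 & P y <-> P (g v)].
    move=> Wy; have [ O1 [ oO1 O1y H]] := lc y Wy.
    have [v [Bv pv vv0 Ov]] := dense y O1 oO1 Wy O1y.
    exists v; split => //; apply: H => //; split; first by exists v.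
    by apply: regpos => //; left; exact: gne.
  move=> y z /near_pt[v [Bv pv vv0 ->]] /near_pt[w [Bw pw wv0 ->]].
  by have [h _] := key v w Bv pv vv0 Bw pw wv0.
Qed.

(** Each point of [S] has a chart whose regular part is connected and non-empty, so a locally
    constant [P] takes one value there. The points with value true and those with value false form
    disjoint open sets that cover [S]. *)
Lemma regular_connected : connected [set: S] -> lc_connected regular.
Proof.
move=> conn P lc x y Mx My Px.
pose Q b : set S := [set z | exists O, [/\ open O, O z & forall w, O w -> regular w -> P w <-> b]].
have oQ b : open (Q b).
  rewrite openE => z [ O [ oO Oz H]].
  by apply: filterS (open_nbhs_nbhs (conj oO Oz)) => w Ow; exists O.
have QQ z : Q True z \/ Q False z.
  have [B [f [g [[_ _ oB _] Bz _ [w [Bw Mw]] lcB]]]] := nice_chart openT (I : [set: S] z).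
  have lcB' : forall u, (g @` B `&` regular) u -> exists O, [/\ open O, O u &
      forall v, O v -> (g @` B `&` regular) v -> P u <-> P v].
    by move=> u [_ /lc[ O [ oO Ou H]]]; exists O; split => // v Ov [_ ?]; exact: H.
  have [Pw|nPw] := pselect (P w); [left|right]; exists (g @` B); split => // u Bu Mu; split => //.
    by move=> _; apply: (lcB P lcB' w u).
  by move=> Pu; apply: nPw; apply: (lcB P lcB' u w).
have nQQ z : Q True z -> Q False z -> False.
  move=> [ O [ oO Oz H]] [ O' [ oO' O'z H']].
  have [B [f [g [_ _ BO [w [Bw Mw]] _]]]] := nice_chart (openI oO oO') (conj Oz O'z).
  have [Ow O'w] := BO w Bw.
  by apply/(H' w O'w Mw)/(H w Ow Mw).
have QP z : regular z -> P z <-> Q True z.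
  move=> Mz; split=> [Pz|[ O [_ Oz /(_ z Oz Mz)]]]; last by case=> _; apply.
  have [ O [ oO Oz H]] := lc z Mz; exists O; split => // w Ow Mw.
  by split => // _; apply/(H w Ow Mw).
have -> // : P y = True; apply/propext; split => // _; apply/QP => //.
have : Q True = [set: S].
  apply: conn; first by exists x; apply/QP.
    by exists (Q True); rewrite ?setTI.
  exists (~` Q False); first by apply: open_closedC.
  rewrite setTI; apply/seteqP; split => z; first by move=> qT qF; exact: (@nQQ z).
  by case: (QQ z).
by move=> ->.
Qed.

Lemma homeo_interior (psi : homeomorphism S) p : interior_point R 1 p -> interior_point R 1 (psi p).
Proof.
move=> [U [V [oU Up oV [f [g [[fU gV fK gK] [cf cg]]]]]]].
exists (hinv psi @^-1` U), V; split => //.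
- by apply: open_comp oU => ? _; exact: hinv_continuous.
- by rewrite /= hfunK.
exists (f \o hinv psi), (psi \o g); split; last split.
- split=> [_ [y Uy <-]|_ [v Vv <-]|y|v] /=.
  + by apply: fU; exists (hinv psi y).
  + by rewrite hfunK; apply: gV; exists v.
  + by move=> /set_mem Uy; rewrite fK ?hinvK //; exact: mem_set.
  + by move=> Vv; rewrite hfunK gK.
- apply: (@within_comp2 _ _ _ _ U (hinv psi) f) => //.
  exact/continuous_subspaceT/hinv_continuous.
- apply: (@within_comp2 _ _ _ _ setT g psi) => //.
  exact/continuous_subspaceT/hfun_continuous.
Qed.

Lemma regular_phi (psi : homeomorphism S) p : psi @` Sigma = Sigma -> regular p -> regular (psi p).
Proof.
move=> eS [ip nSp]; split.
  move=> b; apply: ip => i; apply: b; exact: homeo_interior.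
by move=> Spp; apply: nSp; move: Spp; rewrite -{1}eS => -[s Ss /(can_inj (hfunK psi)) <-].
Qed.

Lemma mboundary_closed : closed (mboundary R 1 S).
Proof. by apply: open_closedC; exact: interior_open. Qed.

Definition end_of (z : S) : set S :=
  if `[< mboundary R 1 S z >] then connected_component (mboundary R 1 S) z else [set z].

Lemma nregularP z : ~ regular z -> mboundary R 1 S z \/ (~ mboundary R 1 S z /\ Sigma z).
Proof.
move=> nz; have [bz|nbz] := pselect (mboundary R 1 S z); [by left|right; split => //].
by apply: contrapT => nS; apply: nz; split.
Qed.

Hypothesis Sigma_int : Sigma `<=` ~` mboundary R 1 S.

Lemma end_self z : ~ regular z -> end_of z z.
Proof. by move=> _; rewrite /end_of; case: asboolP => // bz; exact: connected_component_refl. Qed.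

Lemma end_eq z w : ~ regular z -> end_of z w -> end_of w = end_of z.
Proof.
move=> _; rewrite /end_of; case: (asboolP (mboundary R 1 S z)) => [bz zw|nbz ->]; last by case: asboolP.
have bw := connected_component_sub zw.
by case: asboolP => // _; apply/esym; exact: same_connected_component.
Qed.

Lemma end_sub z w : ~ regular z -> end_of z w -> ~ regular w.
Proof.
move=> nz; rewrite /end_of; case: asboolP => [bz /connected_component_sub bw [] //|_ -> //].
Qed.

Lemma end_closed z : ~ regular z -> closed (end_of z).
Proof.
move=> _; rewrite /end_of; case: asboolP => _; first exact/component_closed/mboundary_closed.
exact: accessible_closed_set1 (hausdorff_accessible S_haus) z.
Qed.

Definition row2 (z : R * R) : rv2 := \row_j (if j == 0 then z.1 else z.2).
Definition unrow2 (v : rv2) : R * R := (v 0 0, v 0 1).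

Lemma row2K : cancel row2 unrow2.
Proof. by case=> a b; rewrite /unrow2 !mxE. Qed.

Lemma unrow2K : cancel unrow2 row2.
Proof.
move=> v; apply/rowP => j; rewrite mxE; case: eqP => [-> //|/eqP nj]; congr (v _ _).
by apply: val_inj; case: j nj => [[|[|[]]]].
Qed.

Lemma row2_continuous : continuous row2.
Proof.
move=> z P /nbhs_rv2P[r r0 H]; apply/nbhs_pairP; exists r => // w w1 w2.
by apply: H; rewrite !mxE.
Qed.

Lemma unrow2_continuous : continuous unrow2.
Proof.
move=> v P /nbhs_pairP[r r0 H]; apply/nbhs_rv2P; exists r => // w w1 w2.
by apply: H.
Qed.

(** The prong coordinate identifies [U] minus [P] with a punctured disc, all of whose points are
    interior. Hence no further boundary points accumulate on [P]. *)
Lemma prong_interior (A : set (flat_chart R S)) P k : prong A P k -> closed P -> exists U : set S,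
  [/\ open U, P `<=` U & forall y, U y -> ~ P y -> interior_point R 1 y].
Proof.
move=> [U [psi [g [r [[oU PU r0 [[psiB gB psiK gK] [cpsi cg]] _] _]]]]] clP.
exists U; split => // y Uy nPy.
pose D := [set z : R * R | 0 < z.1 ^+ 2 + z.2 ^+ 2 < r ^+ 2].
have oD : open D.
  have cD : continuous (fun z : R * R => z.1 ^+ 2 + z.2 ^+ 2 : R^o).
    by move=> z; apply: cvgD; rewrite expr2; apply: cvgM; do ?[exact: cvg_fst|exact: cvg_snd].
  have -> : D = (fun z : R * R => z.1 ^+ 2 + z.2 ^+ 2 : R^o) @^-1` [set` `]0, r ^+ 2[].
    by apply/seteqP; split => z; rewrite /D /= in_itv.
  by apply: open_comp => [z _|]; [exact: cD|exact: interval_open].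
exists (U `\` P), (unrow2 @^-1` D); split => //.
- by apply: openI => //; exact: closed_openC.
- by apply: open_comp oD => ? _; exact: unrow2_continuous.
exists (row2 \o psi), (g \o unrow2); split; last split.
- split=> [_ [z Uz <-]|_ [v Dv <-]|z Uz|v /set_mem Dv] /=.
  + by rewrite /preimage /= row2K; apply: psiB; exists z.
  + by apply: gB; exists (unrow2 v).
  + by rewrite row2K psiK.
  + by rewrite gK ?unrow2K //; exact: mem_set.
- apply: (@within_comp2 _ _ _ _ setT psi row2) => //.
  exact/continuous_subspaceT/row2_continuous.
- apply: (@within_comp2 _ _ _ _ D unrow2 g) => //.
  exact/continuous_subspaceT/unrow2_continuous.
Qed.

Variable A : set (flat_chart R S).
Hypothesis prongs : (forall p, Sigma p -> exists2 k, (3 <= k)%N & prong A [set p] k) /\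
  (forall p, mboundary R 1 S p -> exists2 k, (1 <= k)%N &
     prong A (connected_component (mboundary R 1 S) p) k).

Lemma end_prong z : ~ regular z -> exists k, prong A (end_of z) k.
Proof.
move=> nz; rewrite /end_of; case: asboolP => bz; first by have [_ /(_ z bz)[k _ pk]] := prongs; exists k.
have [//|[_ Sz]] := nregularP nz.
by have [/(_ z Sz)[k _ pk] _] := prongs; exists k.
Qed.

Lemma nregularE : ~` regular = mboundary R 1 S `|` Sigma.
Proof.
apply/seteqP; split => z; first by move=> /nregularP[|[]]; [left|right].
by move=> [bz|Sz] [].
Qed.

(** A prong neighbourhood separates a boundary component from the rest of the boundary, and subsets
    of the finite set [Sigma] are closed. *)
Lemma end_coclosed z : ~ regular z -> closed (~` regular `\` end_of z).
Proof.
move=> nz; have clz := end_closed nz; have [k pk] := end_prong nz.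
have [U [oU PU HU]] := prong_interior pk clz.
have [bz|[nbz Sz]] := nregularP nz.
  have -> : ~` regular `\` end_of z = (mboundary R 1 S `\` U) `|` Sigma.
    rewrite nregularE; apply/seteqP; split => w.
      move=> [[bw|Sw] nw]; [left; split => // Uw|by right].
      by apply: bw; exact: HU.
    move=> [[bw nUw]|Sw]; first by split; [left|move=> /PU].
    split; first by right.
    rewrite /end_of; case: asboolP => // _ /connected_component_sub; exact: Sigma_int.
  apply: closedU; last exact: Sigma_closed.
  by apply: closedI; [exact: mboundary_closed|exact: open_closedC].
have -> : ~` regular `\` end_of z = mboundary R 1 S `|` (Sigma `\ z).
  rewrite nregularE /end_of; case: asboolP => // _; apply/seteqP; split => w.
    by move=> [[bw|Sw] nw]; [left|right].
  move=> [bw|[Sw wz]]; split => //; [by left| |by right].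
  by move=> wz; apply: nbz; rewrite -wz.
apply: closedU; first exact: mboundary_closed.
by apply: Sigma_closed => w [].
Qed.
End Surface.

(** * Crossing loops generate the homology *)

Section Linking.
Variables (R : realType) (S : topologicalType) (phi : homeomorphism S).
Variables (A : set (flat_chart R S)) (M : set S) (lambda : R).
Hypotheses (S_haus : hausdorff_space S) (lambda_gt1 : 1 < lambda)
  (atlas : foliation_atlas A M) (M_phi : forall p, M p -> M (phi p))
  (phi_flat : forall c d p, A c -> A d -> c.1 p -> d.1 (phi p) ->
        exists e1 e2 a b, [/\ is_sign e1, is_sign e2 & \forall y \near p,
          d.2 (phi y) = (e1 * lambda * (c.2 y).1 + a,
                         e2 * lambda^-1 * (c.2 y).2 + b)]).
Hypothesis recur : forall (O : set S) (n0 : nat), open O -> O `<=` M -> O !=set0 ->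
  exists n p, [/\ (n0 <= n)%N, O p & O (iter n phi p)].
Hypothesis M_lc : lc_connected M.
Local Notation cross := (cross phi lambda).
Local Notation is_square := (is_square A).

Lemma large_power l l' : 0 < l -> 0 < l' -> exists n1, forall n, (n1 <= n)%N ->
  4 * l' <= lambda ^+ n * l /\ 4 * l <= lambda ^+ n * l'.
Proof.
move=> l0 l0'; have [n1 H] := expr_unbounded (4 * l' / l + 4 * l / l') lambda_gt1.
have p1 : 0 < 4 * l' / l by rewrite divr_gt0 // mulr_gt0.
have p2 : 0 < 4 * l / l' by rewrite divr_gt0 // mulr_gt0.
exists n1 => n n1n; have {}H : 4 * l' / l + 4 * l / l' <= lambda ^+ n.
  by apply: le_trans H _; rewrite ler_eXn2l.
by rewrite -!ler_pdivrMr //; split; lra.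
Qed.

(** Points that meet in these middle parts give crossings by [cross_create]. *)
Definition half (q : R * R -> S) (l : R) : set S := q @` (box l `&` box (l / 2)).

Lemma half_open q l : is_square q l -> open (half q l).
Proof. by move=> sq; apply: (square_open atlas sq); exact: box_open. Qed.

Lemma half_M q l : is_square q l -> half q l `<=` M.
Proof. move=> sq p [z [bz _] <-]; exact (square_M atlas sq bz). Qed.

Lemma half_center q l : is_square q l -> half q l (q (0, 0)).
Proof.
move=> /square_gt0 l0; exists (0, 0) => //.
by split; apply: (@box0 R) => //; rewrite divr_gt0.
Qed.

Lemma cross_of_hit n q l q' l' z w : is_square q l -> is_square q' l' ->
  box (l / 2) z -> box (l' / 2) w -> iter n phi (q z) = q' w ->
  4 * l' <= lambda ^+ n * l -> 4 * l <= lambda ^+ n * l' ->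
  exists2 k, cross q l q' l' n k & aff (lambda ^+ n) k z = w.
Proof. by move=> sq sq' bz bw e; exact: (cross_create S_haus lambda_gt1 atlas M_phi phi_flat sq sq' bz bw e). Qed.

Definition linked q l q' l' := exists n k, (0 < n)%N /\ cross q l q' l' n k.

Lemma linked_trans q l q1 l1 q2 l2 : linked q l q1 l1 -> linked q1 l1 q2 l2 -> linked q l q2 l2.
Proof.
move=> [n [k [n0 C]]] [n' [k' [n0' C']]].
exists (n' + n)%N, (kcomp (lambda ^+ n') k k'); split; first by rewrite addn_gt0 n0'.
exact: cross_comp C C'.
Qed.

(** A point of the overlap that returns to it passes from one half square to the other, and a late
    return provides the expansion needed for a crossing. *)
Lemma linked_overlap q l q' l' : is_square q l -> is_square q' l' ->
  half q l `&` half q' l' !=set0 -> linked q l q' l'.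
Proof.
move=> sq sq' ne.
have [n1 H] := large_power (square_gt0 sq) (square_gt0 sq').
have [||| n [p [n1n [[z [_ bz] <-] _] [_ [w [_ bw] ew]]]]] := @recur (half q l `&` half q' l') n1.+1.
- by apply: openI; exact: half_open.
- by move=> p [/half_M hp _]; exact: hp.
- exact: ne.
have [h1 h2] := H n (ltnW n1n).
have [k C _] := cross_of_hit sq sq' bz bw (esym ew) h1 h2.
by exists n, k; split => //; exact: leq_ltn_trans n1n.
Qed.

(** Overlapping half squares are linked, so lying in a half square linked to [q] is a locally
    constant property of regular points. *)
Lemma linked_all q l q' l' : is_square q l -> is_square q' l' -> linked q l q' l'.
Proof.
move=> sq sq'.
pose P p := exists q1 l1, [/\ is_square q1 l1, half q1 l1 p & linked q l q1 l1].
suff [q1 [l1 [sq1 hp L]]] : P (q' (0, 0)).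
  by apply: linked_trans L _; apply: linked_overlap => //; exists (q' (0, 0)); split => //; exact: half_center.
have ovl q1 l1 : is_square q1 l1 -> half q1 l1 `&` half q1 l1 !=set0.
  by move=> s1; exists (q1 (0, 0)); split; exact: half_center.
apply: (M_lc (P := P) _ (x := q (0, 0))).
- move=> x Mx; have [q1 [l1 [sq1 qx _]]] := square_at atlas Mx openT I.
  exists (half q1 l1); split; first exact: half_open.
    by rewrite -qx; exact: half_center.
  move=> y hy My; have hx : half q1 l1 x by rewrite -qx; exact: half_center.
  have prop u v : half q1 l1 u -> half q1 l1 v -> P u -> P v.
    move=> hu hv [q2 [l2 [sq2 h2 L]]]; exists q1, l1; split => //.
    by apply: linked_trans L _; apply: linked_overlap => //; exists u.
  by split; exact: prop.
- by apply: half_M (half_center sq).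
- by apply: half_M (half_center sq').
- exists q, l; split => //; first exact: half_center.
  by apply: linked_overlap => //; exact: ovl.
Qed.

Lemma cross_large q l q' l' n0 : is_square q l -> is_square q' l' ->
  exists n k, (n0 <= n)%N /\ cross q l q' l' n k.
Proof.
move=> sq sq'; elim: n0 => [|n0 [n [k [n0n C]]]].
  by have [n [k [_ C]]] := linked_all sq sq'; exists n, k.
have [n' [k' [n0' C']]] := linked_all sq' sq'.
exists (n' + n)%N, (kcomp (lambda ^+ n') k k'); split; last exact: cross_comp C C'.
by rewrite -add1n leq_add.
Qed.

Lemma cross_point q l q' l' n k : 0 < l -> 0 < l' -> cross q l q' l' n k ->
  exists2 z, box l z & box l' (aff (lambda ^+ n) k z).
Proof.
move=> l0 l0' [[s1 s2] h1 h2 _]; have m0 := lambdaX_gt0 lambda_gt1 n.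
have mn0 : lambda ^+ n != 0 by rewrite gt_eqF.
have e11 : k.1.1 * k.1.1 = 1 by case: s1 => ->; ring.
(* The first coordinate is chosen so that its image is 0. *)
exists (- (k.1.1 * k.2.1) / lambda ^+ n, 0).
  split; rewrite /= ?normr0 // normrM normfV (gtr0_norm m0) ltr_pdivrMr // normrN normrM (sign_norm s1) mul1r mulrC; lra.
split; rewrite /=.
  have -> : k.1.1 * lambda ^+ n * (- (k.1.1 * k.2.1) / lambda ^+ n) + k.2.1 = (1 - k.1.1 * k.1.1) * k.2.1 by field.
  by rewrite e11 subrr mul0r normr0.
rewrite mulr0 add0r; have : 0 < (lambda ^+ n)^-1 * l by rewrite mulr_gt0 // invr_gt0.
lra.
Qed.
End Linking.

(** * Arcs in charts and their transport along the flow *)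

Ltac gmod GM := repeat first [assumption | apply: (modB GM) | apply: (modD GM)
  | apply: (modN GM) | (apply: (mod_le GM); assumption)].

Section Charts.
Variables (R : realType) (S : topologicalType) (phi : homeomorphism S).
Local Notation N := (mapping_torus R phi).
Local Notation iterh := (iter_homeo phi).

Definition fl (y : S) (a b : R) : chain R 1 N := line (fun t : R^o => Fl phi (y, t)) a b.

Definition sline (E : normedModType R) (g : E -> S) (t : R) (p q : E) : chain R 1 N :=
  line (fun z : E => Fl phi (g z, t)) p q.

Lemma fl_add y a b c : boundary (fl y a b + fl y b c - fl y a c).
Proof.
apply: (@line_tri R N R^o setT) => //.
apply: continuous_subspaceT => t; apply: (@continuous_comp _ _ _ (fun t : R^o => (y, t) : S * R^o) (Fl phi)).
  by apply: continuous_pair; [move=> ?; exact: cvg_cst|move=> ?; exact: cvg_id].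
exact: Fl_continuous.
Qed.

Lemma fl_shift y (a b : R) (n : int) : fl (iterh n y) (a + n%:~R) (b + n%:~R) = fl y a b.
Proof.
apply: line_ext => t t01; rewrite /GRing.scale /=.
have -> : (1 - t) * (a + n%:~R) + t * (b + n%:~R) = ((1 - t) * a + t * b) + n%:~R by ring.
exact: Fl_shift.
Qed.

(** Openness of the image is left out, so that flat squares, modelled on R x R, and disc charts,
    modelled on row vectors, are treated alike. *)
Definition gchart (E : normedModType R) (D : set E) (f : S -> E) (g : E -> S) : Prop :=
  [/\ is_convex D, {within D, continuous g} & forall v, D v -> f (g v) = v /\ {for g v, continuous f}].

Section Gchart.
Variables (E : normedModType R) (D : set E) (g : E -> S).
Hypotheses (cD : is_convex D) (cg : {within D, continuous g}).

Let D2 : set (E * R^o) := [set z | D z.1].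
Let g2 (z : E * R^o) : N := Fl phi (g z.1, z.2).

Lemma chart_strip_convex : is_convex D2.
Proof. by move=> p q t Dp Dq t01; rewrite /D2 /=; exact: cD. Qed.

Lemma chart_strip_continuous : {within D2, continuous g2}.
Proof.
apply: (@within_comp2 _ _ _ _ setT (fun z : E * R^o => (g z.1, z.2) : S * R^o) (Fl phi)) => //; last exact/continuous_subspaceT/Fl_continuous.
have c1 : {within D2, continuous (g \o fst)}.
  apply: (@within_comp2 _ _ _ _ D fst g) => //.
  by apply: continuous_subspaceT => z; exact: cvg_fst.
apply: (@continuous_pair (subspace D2) S R^o (g \o fst) snd c1).
by apply: continuous_subspaceT => z; exact: cvg_snd.
Qed.

Lemma chart_strip_slice t p q : line g2 (p, t) (q, t) = sline g t p q.
Proof.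
apply: line_ext => s s01; rewrite /g2 /= /GRing.scale /=; congr (Fl phi (_, _)).
by ring.
Qed.

Lemma chart_strip_vertical p a b : line g2 (p, a) (p, b) = fl (g p) a b.
Proof.
apply: line_ext => s s01; rewrite /g2 /=; congr (Fl phi (g _, _)).
by rewrite -scalerDl subrK scale1r.
Qed.

Lemma chart_strip_path p q a b : D p -> D q ->
  boundary (line g2 (p, a) (q, b) - (sline g a p q + fl (g q) a b)).
Proof.
move=> Dp Dq; have := @line_tri R N _ D2 g2 (p, a) (q, a) (q, b) chart_strip_convex chart_strip_continuous Dp Dq Dq.
rewrite chart_strip_slice chart_strip_vertical => h; rewrite -opprB; apply: (modN modulus_boundary); exact: h.
Qed.

(** The boundary of the rectangle swept by the arc as it flows from height [a] to height [b]. *)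
Lemma slide p q a b : D p -> D q ->
  boundary (sline g a p q + fl (g q) a b - fl (g p) a b - sline g b p q).
Proof.
move=> Dp Dq; have h1 := chart_strip_path a b Dp Dq.
have h2 := @line_tri R N _ D2 g2 (p, a) (p, b) (q, b) chart_strip_convex chart_strip_continuous Dp Dp Dq.
rewrite chart_strip_slice chart_strip_vertical in h2.
set x := line _ _ _ in h1 h2.
have -> : sline g a p q + fl (g q) a b - fl (g p) a b - sline g b p q =
  - (x - (sline g a p q + fl (g q) a b)) - (fl (g p) a b + sline g b p q - x) by zmod.
by gmod (@modulus_boundary R N).
Qed.

Lemma chart_slice_continuous t : {within D, continuous (fun z : E => @Fl R S phi (g z, t))}.
Proof.
apply: (@within_comp2 _ _ _ _ D2 (fun z : E => (z, t) : E * R^o) g2) chart_strip_continuous => //.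
by apply: continuous_subspaceT; apply: continuous_pair; [move=> ?; exact: cvg_id|move=> ?; exact: cvg_cst].
Qed.

Lemma sline_add t p q r : D p -> D q -> D r ->
  boundary (sline g t p q + sline g t q r - sline g t p r).
Proof. by move=> Dp Dq Dr; exact: (line_tri cD (@chart_slice_continuous t) Dp Dq Dr). Qed.

Lemma sline_rev t p q : D p -> D q -> boundary (sline g t p q + sline g t q p).
Proof. by move=> Dp Dq; exact: (line_rev cD (@chart_slice_continuous t) Dp Dq). Qed.
End Gchart.

Lemma sline_curve (E : normedModType R) (D : set E) f g (gam : R^o -> S) :
  gchart D f g -> {within `[0, 1], continuous gam} ->
  (forall t, 0 <= t <= 1 -> (g @` D) (gam t)) ->
  boundary (line (fun t : R^o => Fl phi (gam t, 0)) 0 1 - sline g 0 (f (gam 0)) (f (gam 1))).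
Proof.
move=> [cD cg fg] cgam gD.
have -> : line (fun t : R^o => Fl phi (gam t, 0)) 0 1 =
    line ((fun z => Fl phi (g z, 0)) \o (f \o gam) : R^o -> N) 0 1.
  apply: line_ext => t t01; rewrite conv01 /=.
  by have [v Dv <-] := gD t t01; have [-> _] := fg v Dv.
apply: (@line_homotopy R N E D) => //; first exact: chart_slice_continuous.
  apply/subspace_continuousP => t t01.
  have t01' : 0 <= t <= 1 by move: t01; rewrite /= in_itv.
  have [v Dv ev] := gD t t01'; have [_ cf] := fg v Dv; rewrite ev in cf.
  move/subspace_continuousP: (cgam) => /(_ t t01) ct.
  exact: (cvg_comp _ _ ct cf).
by move=> t t01; have [v Dv ev] := gD t t01; rewrite /= -ev; have [-> _] := fg v Dv.
Qed.

(** Read in the chart [f], the arc is a curve in a convex set, homotopic there to the segment with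
    the same end points. *)
Lemma sline_two_charts (E E' : normedModType R) (D : set E) f g g' (C : set E') p q :
  gchart D f g -> is_convex C -> {within C, continuous g'} ->
  (forall v, C v -> (g @` D) (g' v)) -> C p -> C q ->
  boundary (sline g' 0 p q - sline g 0 (f (g' p)) (f (g' q))).
Proof.
move=> ch cC cg' gC Cp Cq.
pose gam (t : R^o) := g' ((1 - t) *: p + t *: q).
have e0 : gam 0 = g' p by rewrite /gam subr0 scale1r scale0r addr0.
have e1 : gam 1 = g' q by rewrite /gam subrr scale0r scale1r add0r.
have := @sline_curve _ D f g gam ch; rewrite e0 e1.
have -> : line (fun t : R^o => Fl phi (gam t, 0)) 0 1 = sline g' 0 p q.
  by apply: line_ext => t t01; rewrite conv01.
apply.
  apply: (@within_comp2 _ _ _ _ C (fun t : R^o => (1 - t) *: p + t *: q) g') => //.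
    apply: continuous_subspaceT; apply: continuous_add; apply: continuous_scale; do ?exact: cst_continuous.
      by move=> z; apply: cvgB; [exact: cvg_cst|exact: cvg_id].
    by move=> ?; exact: cvg_id.
  by move=> t; rewrite /= in_itv => t01; apply/cC.
by move=> t t01; apply/gC/cC.
Qed.
End Charts.

Lemma mod_eq (V : zmodType) (G : V -> Prop) a c : G a -> c = a -> G c.
Proof. by move=> Ga ->. Qed.

Section Transport.
Variables (R : realType) (S : topologicalType) (phi : homeomorphism S).
Local Notation N := (mapping_torus R phi).
Let BM := @modulus_boundary R N.

Lemma fl_iter y j (a b : R) : fl phi (iter j phi y) (a + j%:R) (b + j%:R) = fl phi y a b.
Proof. exact: (@fl_shift R S phi y a b j). Qed.

Lemma fl_tail y j (b : R) : fl phi (iter j phi y) j%:R (j%:R + b) = fl phi y 0 b.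
Proof. by rewrite -(fl_iter y j) add0r addrC. Qed.

Lemma sline_iter (E : normedModType R) (g : E -> S) j t p q :
  sline phi (iter j phi \o g) (t + j%:R) p q = sline phi g t p q.
Proof. by apply: line_ext => u u01; exact: (@Fl_shift R S phi _ _ j). Qed.

(** The slice of [iter j phi \o g2] at height [j] is the slice of [g2] at height 0. The rectangle of
    [slide] between the heights 0 and [j] therefore compares arcs in two charts that lie [j]
    iterations apart. *)
Lemma transport (E E' E2 : normedModType R) (D : set E) f g (D' : set E') f' g'
    (C : set E2) g2 j p q :
  gchart D f g -> gchart D' f' g' -> is_convex C -> {within C, continuous g2} ->
  (forall v, C v -> (g' @` D') (g2 v)) ->
  (forall v, C v -> (g @` D) (iter j phi (g2 v))) -> C p -> C q ->
  boundary (sline phi g 0 (f (iter j phi (g2 p))) (f (iter j phi (g2 q)))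
     + fl phi (iter j phi (g2 q)) 0 j%:R
     - fl phi (iter j phi (g2 p)) 0 j%:R - sline phi g' 0 (f' (g2 p)) (f' (g2 q))).
Proof.
move=> ch ch' cC chart_strip_continuous h' h Cp Cq.
have cG : {within C, continuous (iter j phi \o g2)}.
  apply: (@within_comp2 _ _ _ _ setT g2 (iter j phi)) => //.
  by apply: continuous_subspaceT; exact: iter_phi_continuous.
have H1 := slide phi cC cG 0 j%:R Cp Cq.
have H2 := sline_two_charts phi ch cC cG h Cp Cq.
have H3 := sline_two_charts phi ch' cC chart_strip_continuous h' Cp Cq.
have e := sline_iter g2 j 0 p q; rewrite add0r in e; rewrite e in H1.
apply: (mod_eq (modD BM (modB BM H1 H2) H3)) => /=.
rewrite /comp; set x1 := sline _ _ _ _ _; set x2 := fl _ _ _ _; set x3 := fl _ _ _ _.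
set x4 := sline _ _ _ _ _; set x5 := sline _ _ _ _ _; set x6 := sline _ _ _ _ _.
by zmod.
Qed.

Lemma gchart_disc B f g : disc_chart B f g -> @gchart R S _ B f g.
Proof. by case. Qed.

Lemma gchart_add (E : normedModType R) (D : set E) (f : S -> E) g t p q r : gchart D f g -> D p -> D q -> D r ->
  boundary (sline phi g t p q + sline phi g t q r - sline phi g t p r).
Proof. by case=> cD cg _; exact: sline_add. Qed.

Lemma gchart_rev (E : normedModType R) (D : set E) (f : S -> E) g t p q : gchart D f g -> D p -> D q ->
  boundary (sline phi g t p q + sline phi g t q p).
Proof. by case=> cD cg _; exact: sline_rev. Qed.

Lemma sline_const (E : normedModType R) (g : E -> S) t p : boundary (sline phi g t p p).
Proof. exact: line_const. Qed.

Definition plane : normedModType R := (R^o * R^o)%type.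

Lemma box_convex l : @is_convex R plane (box l).
Proof. by move=> p q t Dp Dq t01; exact: (seg_box t01 Dp Dq). Qed.

Lemma square_gchart A M q l : foliation_atlas A M -> is_square A q l ->
  exists f, @gchart R S plane (box l) f q.
Proof.
move=> atlas sq; have [l0 [c [c0 [Ac H C K]]]] := sq.
exists (fun y => ((c.2 y).1 - c0.1, (c.2 y).2 - c0.2) : plane); split.
- exact: box_convex.
- apply: continuous_in_subspaceT => z /set_mem bz; exact: C.
- move=> z bz; have [cz ez] := H z bz; split.
    by rewrite ez /= [_ + z.1]addrC [_ + z.2]addrC !addrK -surjective_pairing.
  have cc := chart_cont atlas Ac cz.
  apply: (@continuous_comp _ _ _ c.2 (fun w : R * R => (w.1 - c0.1, w.2 - c0.2) : R * R)) => //.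
  rewrite (_ : (fun w : R * R => _) = (fun w : R * R => (- c0.1 + w.1, - c0.2 + w.2))); last first.
    by apply/funext => w; rewrite addrC [w.2 - _]addrC.
  exact: (@shift_continuous R (- c0.1, - c0.2)).
Qed.
End Transport.

Section FlowBox.
Variables (R : realType) (S : topologicalType) (phi : homeomorphism S).
Local Notation N := (mapping_torus R phi).
Local Notation E := ('rV[R]_2 * R^o)%type.
Variables (B : set 'rV[R]_2) (f : S -> 'rV[R]_2) (g : 'rV[R]_2 -> S).
Hypothesis dc : disc_chart B f g.

Definition flow_chart (w : E) : N := Fl phi (g w.1, w.2).

Lemma flow_chart_continuous : {within [set w : E | B w.1], continuous flow_chart}.
Proof. by have [_ cg _ _] := dc; exact: chart_strip_continuous. Qed.

Lemma flow_domain_convex : is_convex [set w : E | B w.1].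
Proof. by have [cB _ _ _] := dc; exact: chart_strip_convex. Qed.

Definition flow_box t0 e : set N := Fl phi @` [set w | (g @` B) w.1 /\ t0 - e < w.2 < t0 + e].

Lemma flow_box_open t0 e : open (flow_box t0 e).
Proof.
have [_ _ oB _] := dc; apply: Fl_open.
have -> : [set w : S * R^o | (g @` B) w.1 /\ t0 - e < w.2 < t0 + e] =
    (fun w : S * R^o => w.1) @^-1` (g @` B) `&` (fun w : S * R^o => w.2 : R) @^-1` `]t0 - e, t0 + e[.
  by apply/seteqP; split => w /=; rewrite in_itv.
apply: openI; first by apply: open_comp => // w _; exact: cvg_fst.
by apply: open_comp; [move=> w _; exact: cvg_snd|exact: interval_open].
Qed.

Lemma flow_boxP t0 e xi : flow_box t0 e xi <->
  exists2 w : E, B w.1 /\ t0 - e < w.2 < t0 + e & flow_chart w = xi.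
Proof.
split=> [[[x t] [[v Bv /= <-] tt] <-]|[[v t] [Bv tt] <-]]; first by exists (v, t).
by exists (g v, t) => //; split => //; exists v.
Qed.

Lemma flow_box_center p t e : B p -> 0 < e -> flow_box t e (Fl phi (g p, t)).
Proof. by move=> Bp e0; apply/flow_boxP; exists (p, t) => //; split => //=; apply/andP; split; lra. Qed.

Lemma flow_chart_inj t0 e w w' : e <= 2^-1 -> B w.1 -> B w'.1 ->
  t0 - e < w.2 < t0 + e -> t0 - e < w'.2 < t0 + e -> flow_chart w = flow_chart w' -> w = w'.
Proof.
have [_ _ _ fg] := dc; move=> e2 Bw Bw' tw tw' eq.
pose O : set (S * R^o) := [set w | (g @` B) w.1 /\ t0 - e < w.2 < t0 + e].
have h : t0 + e - (t0 - e) <= 1 by lra.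
have := @Fl_inj R S phi O (t0 - e) (t0 + e) h (fun z Oz => Oz.2) (g w.1, w.2) (g w'.1, w'.2).
have O1 : O (g w.1, w.2) by split => //; exists w.1.
have O2 : O (g w'.1, w'.2) by split => //; exists w'.1.
move=> /(_ O1 O2 eq) [e1 e3].
by rewrite [w]surjective_pairing [w']surjective_pairing e3 -(fg _ Bw).1 e1 (fg _ Bw').1.
Qed.

Lemma flow_box_path t0 e (gam : R^o -> N) a b : e <= 2^-1 -> a <= b ->
  {within `[a, b], continuous gam} -> (forall t, a <= t <= b -> flow_box t0 e (gam t)) ->
  exists u v : E, [/\ [/\ B u.1, t0 - e < u.2 < t0 + e & flow_chart u = gam a],
    [/\ B v.1, t0 - e < v.2 < t0 + e & flow_chart v = gam b]
  & boundary (line gam a b - line flow_chart u v)].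
Proof.
move=> e2 ab cgam Wgam; have [cB cg oB fg] := dc.
pose O : set (S * R^o) := [set w | (g @` B) w.1 /\ t0 - e < w.2 < t0 + e].
have oO : open O.
  have -> : O = (fun w : S * R^o => w.1) @^-1` (g @` B) `&` (fun w : S * R^o => w.2 : R) @^-1` `]t0 - e, t0 + e[.
    by apply/seteqP; split => w /=; rewrite in_itv.
  apply: openI; first by apply: open_comp => // w _; exact: cvg_fst.
  by apply: open_comp; [move=> w _; exact: cvg_snd|exact: interval_open].
have injO : forall z w, O z -> O w -> Fl phi z = Fl phi w -> z = w.
  apply: (@Fl_inj R S phi O (t0 - e) (t0 + e)); first by lra.
  by move=> w [].
have [tau [ctau Htau]] := Fl_lift oO injO cgam Wgam.
pose sig (t : R^o) : E := (f (tau t).1, (tau t).2).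
have gf w : O w -> B (f w.1) /\ g (f w.1) = w.1.
  by move=> [[c Bc ec] _]; rewrite -ec (fg c Bc).1.
have csig : {within `[a, b], continuous sig}.
  apply: (@continuous_pair (subspace `[a, b]) 'rV[R]_2 R^o (fun t => f (tau t).1) (fun t => (tau t).2)).
    apply/subspace_continuousP => t tab.
    have tab' : a <= t <= b by move: tab; rewrite /= in_itv.
    have [[[c Bc ec] _] _] := Htau t tab'; have [_ cf] := fg c Bc; rewrite ec in cf.
    move/subspace_continuousP: (ctau) => /(_ t tab) ct.
    apply: (cvg_comp (fun t => (tau t).1) f _ cf).
    have c1 : {for tau t, continuous (@fst S R^o)} by exact: cvg_fst.
    exact: (cvg_comp _ _ ct c1).
  apply/subspace_continuousP => t tab.
  move/subspace_continuousP: (ctau) => /(_ t tab) ct.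
  have c2 : {for tau t, continuous (@snd S R^o)} by exact: cvg_snd.
  exact: (cvg_comp _ _ ct c2).
have Bsig t : a <= t <= b -> B (sig t).1 by move=> /Htau[Ot _]; exact: (gf _ Ot).1.
have L := line_homotopy ab flow_domain_convex flow_chart_continuous csig Bsig.
have fsig t : a <= t <= b -> flow_chart (sig t) = gam t.
  by move=> /Htau[Ot <-]; rewrite /flow_chart /= (gf _ Ot).2 -surjective_pairing.
have eg : line (flow_chart \o sig : R^o -> N) a b = line gam a b.
  by apply: line_ext => t t01; rewrite /= fsig //; apply: conv_itv => //; rewrite lexx ab.
have iab : a <= a <= b by rewrite lexx ab.
have iab' : a <= b <= b by rewrite lexx ab.
have [[_ ta] _] := Htau a iab; have [[_ tb] _] := Htau b iab'.
rewrite eg in L; exists (sig a), (sig b); split => //; split => //.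
- exact: Bsig.
- exact: fsig.
- exact: Bsig.
- exact: fsig.
Qed.
End FlowBox.

(** * Loops of the base square and paths that end in it *)

Section Potential.
Variables (R : realType) (S : topologicalType) (phi : homeomorphism S).
Variables (A : set (flat_chart R S)) (M : set S) (lambda : R).
Hypotheses (S_haus : hausdorff_space S) (lambda_gt1 : 1 < lambda)
  (atlas : foliation_atlas A M) (M_phi : forall p, M p -> M (phi p))
  (phi_flat : forall c d p, A c -> A d -> c.1 p -> d.1 (phi p) ->
        exists e1 e2 a b, [/\ is_sign e1, is_sign e2 & \forall y \near p,
          d.2 (phi y) = (e1 * lambda * (c.2 y).1 + a,
                         e2 * lambda^-1 * (c.2 y).2 + b)]).
Hypothesis recur : forall (O : set S) (n0 : nat), open O -> O `<=` M -> O !=set0 ->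
  exists n p, [/\ (n0 <= n)%N, O p & O (iter n phi p)].
Hypothesis M_lc : lc_connected M.
Local Notation N := (mapping_torus R phi).
Local Notation cross := (cross phi lambda).
Local Notation is_square := (is_square A).
Local Notation fl := (fl phi).
Local Notation sline := (sline phi).
Local Notation plane := (plane R).
Let BM := @modulus_boundary R N.

(** The upward flow starting at [q' z'] arrives at [q z] after time [n], because its first return
    map is the inverse of [phi]. The chain thus leads from the centre of [q'] to the centre of
    [q]. *)
Definition cpath (q q' : plane -> S) n k (z : plane) : chain R 1 N :=
  let z' : plane := aff (lambda ^+ n) k z in
  sline q' 0 0 z' + fl (q' z') 0 n%:R + sline q 0 z 0.

Definition admissible l l' n k z := box l z /\ box l' (aff (lambda ^+ n) k z).

(** Admissible points form a convex set, so two of them are joined by a segment, which [transport]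
    carries along the flow. *)
Lemma cpath_indep q l q' l' n k z w : is_square q l -> is_square q' l' -> cross q l q' l' n k ->
  admissible l l' n k z -> admissible l l' n k w ->
  boundary (cpath q q' n k z - cpath q q' n k w).
Proof.
move=> sq sq' [_ _ _ C] [bz bz'] [bw bw'].
have [f ch] := square_gchart atlas sq; have [f' ch'] := square_gchart atlas sq'.
have b0 : box l 0 by exact: (box0 (square_gt0 sq)).
have b0' : box l' 0 by exact: (box0 (square_gt0 sq')).
have ez : iter n phi (q z) = q' (aff (lambda ^+ n) k z) by exact: C.
have ew : iter n phi (q w) = q' (aff (lambda ^+ n) k w) by exact: C.
pose D : set plane := box l `&` [set u | box l' (aff (lambda ^+ n) k u)].
have cD : is_convex D.
  move=> u v t [Du1 Du2] [Dv1 Dv2] t01; split; first exact: box_convex.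
  by rewrite /= (_ : _ + _ = seg u v t) // aff_seg; apply: seg_box.
have cq : {within D, continuous q}.
  apply: continuous_in_subspaceT => u /set_mem [bu _]; exact: (square_cont sq bu).
have hq u : D u -> (q @` box l) (q u) by move=> [bu _]; exists u.
have hq' u : D u -> (q' @` box l') (iter n phi (q u)).
  by move=> [bu bu']; rewrite C //; exists (aff (lambda ^+ n) k u).
have H := transport ch' ch cD cq hq hq' (conj bz bz') (conj bw bw').
have [_ _ fq] := ch; have [_ _ fq'] := ch'.
rewrite ez ew (fq' _ bz').1 (fq' _ bw').1 (fq _ bz).1 (fq _ bw).1 in H.
have H1 := gchart_add phi 0 ch' b0' bz' bw'.
have H2 := gchart_add phi 0 ch bz bw b0.
rewrite /cpath; apply: (mod_eq (modB BM (modB BM H1 H) H2)).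
set x1 := sline _ _ _ _; set x2 := fl _ _ _; set x3 := sline _ _ _ _; set x4 := sline _ _ _ _.
set x5 := fl _ _ _; set x6 := sline _ _ _ _; set x7 := sline _ _ _ _; set x8 := sline _ _ _ _.
by zmod.
Qed.

Lemma admissible_ex q l q' l' n k : is_square q l -> is_square q' l' -> cross q l q' l' n k ->
  exists z, admissible l l' n k z.
Proof.
move=> /square_gt0 l0 /square_gt0 l0' C.
by have [z ? ?] := cross_point lambda_gt1 l0 l0' C; exists z.
Qed.

Lemma cpath_comp q l q1 l1 q2 l2 n k n' k' z z1 z2 :
  is_square q l -> is_square q1 l1 -> is_square q2 l2 ->
  cross q l q1 l1 n k -> cross q1 l1 q2 l2 n' k' ->
  admissible l l2 (n' + n) (kcomp (lambda ^+ n') k k') z ->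
  admissible l l1 n k z1 -> admissible l1 l2 n' k' z2 ->
  boundary (cpath q q2 (n' + n) (kcomp (lambda ^+ n') k k') z
    - (cpath q1 q2 n' k' z2 + cpath q q1 n k z1)).
Proof.
move=> sq sq1 sq2 C C' [bz bz2] a1 a2; have [_ _ _ H] := C; have [_ _ _ H'] := C'.
have bz' : box l2 (aff (lambda ^+ n') k' (aff (lambda ^+ n) k z)).
  by rewrite aff_comp -exprD.
have b1 := cross_mid lambda_gt1 C C' bz bz'.
have I1 := cpath_indep sq sq1 C (conj bz b1) a1.
have I2 := cpath_indep sq1 sq2 C' (conj b1 bz') a2.
have [f1 ch1] := square_gchart atlas sq1.
have b0 : box l1 0 by exact: (box0 (square_gt0 sq1)).
have RV := gchart_rev phi 0 ch1 b1 b0.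
pose z' := aff (lambda ^+ n) k z; pose z'' := aff (lambda ^+ n') k' z'.
have ez' : aff (lambda ^+ (n' + n)) (kcomp (lambda ^+ n') k k') z = z''.
  by rewrite exprD -aff_comp.
have e'' : q2 z'' = iter n' phi (q1 z') by rewrite H'.
have FA := fl_add phi (q2 z'') 0 (n'%:R : R) (n'%:R + n%:R : R).
rewrite {2}e'' fl_tail in FA.
have : boundary (cpath q q2 (n' + n) (kcomp (lambda ^+ n') k k') z
    - (cpath q1 q2 n' k' z' + cpath q q1 n k z)).
  rewrite /cpath ez' natrD -/z' -/z''; apply: (mod_eq (modN BM (modD BM FA RV))).
  rewrite -/z'.
  set x1 := sline _ _ _ _; set x2 := fl _ _ _; set x3 := sline _ _ _ _; set x4 := fl _ _ _.
  set x5 := sline _ _ _ _; set x6 := sline _ _ _ _; set x7 := fl _ _ _.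
  by zmod.
move=> H3; apply: (mod_eq (modD BM H3 (modD BM I1 I2))); rewrite -/z'.
set x1 := cpath _ _ _ _ _; set x2 := cpath _ _ _ _ _; set x3 := cpath _ _ _ _ _.
set x4 := cpath _ _ _ _ _; set x5 := cpath _ _ _ _ _.
by zmod.
Qed.

Variables (q0 : plane -> S) (l0 : R).
Hypothesis sq0 : is_square q0 l0.

Definition loop (v : chain R 1 N) := exists n k z,
  [/\ (0 < n)%N, cross q0 l0 q0 l0 n k, admissible l0 l0 n k z & v = cpath q0 q0 n k z].

Lemma loop_ex : exists v, loop v.
Proof.
have [n [k [n0 C]]] := linked_all S_haus lambda_gt1 atlas M_phi phi_flat recur M_lc sq0 sq0.
have [z az] := admissible_ex sq0 sq0 C.
by exists (cpath q0 q0 n k z), n, k, z.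
Qed.

Lemma loop_add v w : loop v -> loop w -> exists2 u, loop u & boundary (u - (v + w)).
Proof.
move=> [n [k [z [n0 C az ->]]]] [n' [k' [z' [n0' C' az' ->]]]].
have C2 := cross_comp lambda_gt1 C' C.
have [z2 az2] := admissible_ex sq0 sq0 C2.
exists (cpath q0 q0 (n + n') (kcomp (lambda ^+ n) k' k) z2).
  exists (n + n')%N, (kcomp (lambda ^+ n) k' k), z2; split => //.
  by rewrite addn_gt0 n0.
exact: (cpath_comp sq0 sq0 sq0 C' C az2 az' az).
Qed.

(** Up to boundaries, sums of loops are loops but opposites need not be; taking differences produces
    a subgroup. *)
Definition loopmod (c : chain R 1 N) := exists v w, [/\ loop v, loop w & boundary (c - (v - w))].

Lemma modulus_loop : modulus loopmod.
Proof.
split.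
- have [v Lv] := loop_ex; exists v, v; split => //; rewrite subrr subr0; exact: mod0.
- move=> a b [v [w [Lv Lw H]]] [v' [w' [Lv' Lw' H']]].
  have [u Lu Hu] := loop_add Lv Lw'; have [u' Lu' Hu'] := loop_add Lw Lv'.
  exists u, u'; split => //; apply: (mod_eq (modB BM (modB BM H H') (modB BM Hu Hu'))).
  by zmod.
- move=> d cd; have [v Lv] := loop_ex; exists v, v; split => //.
  by rewrite subrr subr0; exists d.
Qed.

(* [v] joins [y], at height 0, to the centre of the base square. *)
Definition reach (y : S) (v : chain R 1 N) := exists q l w n k z,
  [/\ is_square q l, box l w /\ box (l / 2) w, q w = y,
      (0 < n)%N /\ cross q0 l0 q l n k
    & admissible l0 l n k z /\ v = sline q 0 w 0 + cpath q0 q n k z].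

Lemma reach_ex y : M y -> exists v, reach y v.
Proof.
move=> My; have [q [l [sq <- _]]] := square_at atlas My openT I.
have [n [k [n0 C]]] := linked_all S_haus lambda_gt1 atlas M_phi phi_flat recur M_lc sq0 sq.
have [z az] := admissible_ex sq0 sq C.
have lp := square_gt0 sq; have lp2 : 0 < l / 2 by rewrite divr_gt0.
exists (sline q 0 0 0 + cpath q0 q n k z), q, l, (0 : plane), n, k, z.
by split => //; split; exact: box0.
Qed.

Lemma reach_M y v : reach y v -> M y.
Proof. by move=> [q [l [w [n [k [z [sq [bw _] <- _ _]]]]]]]; exact: (square_M atlas sq bw). Qed.

(* Both sides are completed to loops of the base square through one common
   point close to [x]. *)
Lemma reach_eq x j v v' : reach (iter j phi x) v -> reach x v' ->
  loopmod (v - fl (iter j phi x) 0 j%:R - v').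
Proof.
move=> [q [l [w [n [k [z [sq [bw bw2] ew [n0 C] [az ->]]]]]]]].
move=> [q' [l' [w' [n' [k' [z' [sq' [bw' bw2'] ew' [n0' C'] [az' ->]]]]]]]].
pose O := half q' l' `&` (iter j phi @^-1` half q l).
have oO : open O.
  apply: openI; first exact: (half_open atlas sq').
  apply: open_comp; last exact: (half_open atlas sq).
  by move=> u _; exact: iter_phi_continuous.
have Ox : O x by split; [exists w'|exists w].
have Mx : M x by rewrite -ew'; exact: (square_M atlas sq' bw').
have [p [r [sp px Op]]] := square_at atlas Mx oO Ox.
have lp := square_gt0 sq; have lp' := square_gt0 sq'; have lp0 := square_gt0 sq0.
have sq0' : is_square q0 (l0 / 2) by apply: (square_sub sq0); lra.
have [n1 N1] := large_power lambda_gt1 lp lp0.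
have [n2 N2] := large_power lambda_gt1 lp' lp0.
(* A crossing from a small square around [x] to the half base square. Its time is so long that, even
   after subtracting [j], it suffices for a crossing that starts at [q]. *)
have [m [km [mn Cm]]] := cross_large S_haus lambda_gt1 atlas M_phi phi_flat recur M_lc (n1 + n2 + j).+1 sp sq0'.
have [m' em] : exists m', m = (m' + j)%N by exists (m - j)%N; lia.
have mn1 : (n1 <= m')%N by lia.
have mn2 : (n2 <= m' + j)%N by lia.
have m0 : (0 < m')%N by lia.
have {mn}em' := em; rewrite {}em in Cm.
have rp := square_gt0 sp; have l2p := square_gt0 sq0'.
have [a ba bu] := cross_point lambda_gt1 rp l2p Cm.
have [_ _ _ /(_ a ba bu)] := Cm; set u := aff _ _ a in bu * => eu.
have [[y' [by0' by2'] ey'] [y [by0 by2] ey]] := Op a ba.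
have eu1 : iter m' phi (q y) = q0 u by rewrite ey -iterD.
have eu2 : iter (m' + j) phi (q' y') = q0 u by rewrite ey'.
have [h1 h2] := N1 m' mn1; have [h1' h2'] := N2 _ mn2.
have [k1 C1 ek1] := cross_of_hit S_haus lambda_gt1 atlas M_phi phi_flat sq sq0 by2 bu eu1 h1 h2.
have [k2 C2 ek2] := cross_of_hit S_haus lambda_gt1 atlas M_phi phi_flat sq' sq0 by2' bu eu2 h1' h2'.
have bu0 : box l0 u by apply: (box_le _ bu); lra.
have a1 : admissible l l0 m' k1 y by split; rewrite ?ek1.
have a2 : admissible l' l0 (m' + j) k2 y' by split; rewrite ?ek2.
have D1 := cross_comp lambda_gt1 C C1; have D2 := cross_comp lambda_gt1 C' C2.
have [z1 az1] := admissible_ex sq0 sq0 D1; have [z2 az2] := admissible_ex sq0 sq0 D2.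
have I1 := cpath_comp sq0 sq sq0 C C1 az1 az a1.
have I2 := cpath_comp sq0 sq' sq0 C' C2 az2 az' a2.
exists (cpath q0 q0 (m' + n) (kcomp (lambda ^+ m') k k1) z1),
  (cpath q0 q0 (m' + j + n') (kcomp (lambda ^+ (m' + j)) k' k2) z2); split.
- by exists (m' + n)%N, (kcomp (lambda ^+ m') k k1), z1; split => //; rewrite addn_gt0 m0.
- by exists (m' + j + n')%N, (kcomp (lambda ^+ (m' + j)) k' k2), z2; split => //; rewrite !addn_gt0 m0.
have [f ch] := square_gchart atlas sq; have [f' ch'] := square_gchart atlas sq'.
have [_ _ fq] := ch; have [_ _ fq'] := ch'.
have [fp [cr cp _]] := square_gchart atlas sp.
have hp c : box r c -> (q' @` box l') (p c) by move=> /Op[[t [bt _] <-] _]; exists t.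
have hjp c : box r c -> (q @` box l) (iter j phi (p c)) by move=> /Op[_ [t [bt _] <-]]; exists t.
have b00 : box r (0, 0) by exact: box0.
have T := transport ch ch' cr cp hp hjp b00 ba.
rewrite px -ew -ey -[in f' x]ew' -ey' (fq _ bw).1 (fq _ by0).1 (fq' _ bw').1 (fq' _ by0').1 in T.
have b0 : box l 0 by exact: (box0 lp).
have b0' : box l' 0 by exact: (box0 lp').
have ADD1 := gchart_add phi 0 ch bw by0 b0.
have ADD2 := gchart_add phi 0 ch' bw' by0' b0'.
have FA := fl_add phi (q0 u) 0 (m'%:R : R) (m'%:R + j%:R : R).
rewrite -{2}eu1 fl_tail in FA.
rewrite -ew; apply: (mod_eq (modD BM (modB BM (modB BM T ADD1) (modB BM FA ADD2)) (modB BM I2 I1))).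
have -> : cpath q q0 m' k1 y = sline q0 0 0 u + fl (q0 u) 0 m'%:R + sline q 0 y 0 by rewrite /cpath ek1.
have -> : cpath q' q0 (m' + j) k2 y' = sline q0 0 0 u + fl (q0 u) 0 (m'%:R + j%:R) + sline q' 0 y' 0.
  by rewrite /cpath ek2 natrD.
do ![set x1 := cpath _ _ _ _ _ | set x2 := cpath _ _ _ _ _ | set x3 := cpath _ _ _ _ _ | set x4 := cpath _ _ _ _ _].
set s1 := sline _ _ _ _; set s2 := fl _ _ _; set s3 := sline _ _ _ _; set s4 := sline _ _ _ _.
set s5 := fl _ _ _; set s6 := sline _ _ _ _; set s7 := sline _ _ _ _; set s8 := fl _ _ _; set s9 := fl _ _ _.
set s10 := sline _ _ _ _.
by zmod.
Qed.

Lemma fl_const y : @boundary R N (fl y 0 0).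
Proof. exact: line_const. Qed.

Lemma reach_eq0 x v v' : reach x v -> reach x v' -> loopmod (v - v').
Proof.
move=> h h'; have H := @reach_eq x 0 v v' h h'.
apply: (mod_eq (modD modulus_loop H (mod_le modulus_loop (fl_const x)))) => /=.
by rewrite (_ : 0%:R = 0) //; set t := fl _ _ _; zmod.
Qed.

Hypothesis nice : forall x (O : set S), open O -> O x -> exists B f g,
  [/\ @disc_chart R S B f g, (g @` B) x, g @` B `<=` O, (g @` B `&` M) !=set0
    & lc_connected (g @` B `&` M)].

(** Moving the end point inside a half square alters both terms by the same arc. The statement is
    therefore locally constant on the regular part of the chart, which is connected. *)
Lemma reach_chart B f g a b va vb : disc_chart B f g -> lc_connected (g @` B `&` M) ->
  B a -> B b -> reach (g a) va -> reach (g b) vb -> loopmod (sline g 0 a b + vb - va).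
Proof.
move=> dc lc Ba Bb ra rb; have ch := gchart_disc dc; have [_ _ oB fg] := dc.
have ML := modulus_loop.
pose P y := forall v, reach y v -> loopmod (sline g 0 a (f y) + v - va).
suff : P (g b) by move=> /(_ vb rb); rewrite (fg b Bb).1.
apply: (lc P _ (g a)); first last.
- move=> v rv; rewrite (fg a Ba).1.
  apply: (mod_eq (modD ML (mod_le ML (sline_const phi g 0 a)) (reach_eq0 rv ra))).
  by set t := sline _ _ _ _; zmod.
- by split; [exists b|exact: reach_M rb].
- by split; [exists a|exact: reach_M ra].
move=> y [gy My]; have [q [r [sq qy Oq]]] := square_at atlas My oB gy.
have [n [k [n0 C]]] := linked_all S_haus lambda_gt1 atlas M_phi phi_flat recur M_lc sq0 sq.
have [z az] := admissible_ex sq0 sq C; have rp := square_gt0 sq.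
have b0 : box r 0 by exact: (box0 rp).
have [fq chq] := square_gchart atlas sq; have [cq cgq _] := chq.
exists (half q r); split; first exact: (half_open atlas sq).
  by rewrite -qy; exact: half_center sq.
have prop u u' : half q r u -> half q r u' -> P u -> P u'.
  move=> [w [bw bw2] <-] [w' [bw' bw2'] <-] Pu v' rv'.
  have ru : reach (q w) (sline q 0 w 0 + cpath q0 q n k z) by exists q, r, w, n, k, z.
  have ru' : reach (q w') (sline q 0 w' 0 + cpath q0 q n k z) by exists q, r, w', n, k, z.
  have H1 := Pu _ ru; have H2 := reach_eq0 rv' ru'.
  have H3 := mod_le ML (sline_two_charts phi ch cq cgq Oq bw bw').
  have H4 := mod_le ML (gchart_add phi 0 chq bw bw' b0).
  have fB t : box r t -> B (f (q t)) by move=> /Oq[s Bs <-]; rewrite (fg s Bs).1.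
  have H5 := mod_le ML (gchart_add phi 0 ch Ba (fB _ bw) (fB _ bw')).
  apply: (mod_eq (modB ML (modD ML (modD ML H1 H2) H4) (modD ML H3 H5))).
  set c := cpath _ _ _ _ _; set x1 := sline _ _ _ _; set x2 := sline _ _ _ _; set x3 := sline _ _ _ _.
  set x4 := sline _ _ _ _; set x5 := sline _ _ _ _; set x6 := sline _ _ _ _.
  by zmod.
move=> y' hy' _; have hy : half q r y by rewrite -qy; exact: half_center sq.
by split; exact: prop.
Qed.

(** Reaches singular and boundary points as well, by a segment of one chart that ends at a regular
    point. *)
Definition nreach x v := exists B f g p p1 vv,
  [/\ disc_chart B f g, lc_connected (g @` B `&` M), B p /\ B p1,
      g p = x /\ reach (g p1) vv & v = sline g 0 p p1 + vv].

Lemma nreach_ex x : exists v, nreach x v.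
Proof.
have [B [f [g [dc [p Bp px] _ [_ [[p1 Bp1 <-] /reach_ex[vv rv]]] lc]]]] := nice openT (I : setT x).
by exists (sline g 0 p p1 + vv), B, f, g, p, p1, vv.
Qed.

(** A small chart around [x], subordinate to both given charts, contains a regular point. There
    [reach_eq] applies, and [transport] moves the segment from [x] to this point. *)
Lemma nreach_eq x j v v' : nreach (iter j phi x) v -> nreach x v' ->
  loopmod (v - fl (iter j phi x) 0 j%:R - v').
Proof.
move=> [B [f [g [p [p1 [vv [dc lc [Bp Bp1] [gp rv] ->]]]]]]].
move=> [B' [f' [g' [p' [p1' [vv' [dc' lc' [Bp' Bp1'] [gp' rv'] ->]]]]]]].
have ML := modulus_loop; have [_ _ oB fg] := dc; have [_ _ oB' fg'] := dc'.
have [||B2 [f2 [g2 [dc2 [s Bs sx] sub [_ [[t Bt <-] Mt]] lc2]]]] :=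
  @nice x (g' @` B' `&` (iter j phi @^-1` (g @` B))).
- apply: openI => //; apply: open_comp => // u _; exact: iter_phi_continuous.
- by split; [exists p'|exists p].
have [v2 rv2] := reach_ex Mt.
have [v1 rv1] := reach_ex (iter_M M_phi j Mt).
have h' v0 : B2 v0 -> (g' @` B') (g2 v0) by move=> Bv; have [] := sub (g2 v0) (ex_intro2 _ _ v0 Bv erefl).
have h v0 : B2 v0 -> (g @` B) (iter j phi (g2 v0)) by move=> Bv; have [] := sub (g2 v0) (ex_intro2 _ _ v0 Bv erefl).
have [cB2 chart_strip_continuous _ _] := dc2.
have T := mod_le ML (transport (gchart_disc dc) (gchart_disc dc') cB2 chart_strip_continuous h' h Bs Bt).
have [a Ba ea] := h t Bt; have [a' Ba' ea'] := h' t Bt.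
rewrite sx -gp -{1}gp' -ea -ea' (fg _ Bp).1 (fg _ Ba).1 (fg' _ Bp').1 (fg' _ Ba').1 in T.
rewrite -ea in rv1; rewrite -ea' in rv2.
have RC := reach_chart dc lc Ba Bp1 rv1 rv; have RC' := reach_chart dc' lc' Ba' Bp1' rv2 rv'.
have ADD := mod_le ML (gchart_add phi 0 (gchart_disc dc) Bp Ba Bp1).
have ADD' := mod_le ML (gchart_add phi 0 (gchart_disc dc') Bp' Ba' Bp1').
have RE : loopmod (v1 - fl (g a) 0 j%:R - v2) by rewrite ea; apply: reach_eq; rewrite -?ea -?ea'.
apply: (mod_eq (modD ML (modD ML (modB ML ADD' ADD) (modB ML RC RC')) (modD ML RE T))).
rewrite -gp; set x1 := sline _ _ _ _; set x2 := fl _ _ _; set x3 := sline _ _ _ _; set x4 := sline _ _ _ _.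
set x5 := sline _ _ _ _; set x6 := sline _ _ _ _; set x7 := sline _ _ _ _; set x8 := fl _ _ _.
by zmod.
Qed.

(** Modulo loops, [nreach_eq] makes [F] depend only on the image under [Fl], and on flow boxes [F]
    is a potential; then [cycle_modulus] applies. *)
Theorem loop_cycle z : Defs.cycle setT set0 z -> loopmod z.
Proof.
have [FS hFS] := choice nreach_ex.
have ML := modulus_loop.
have ex xi : exists w : S * R^o, Fl phi w = xi by have [x [t [_ e]]] := Fl_surj xi; exists (x, t).
have [rep hrep] := choice ex.
pose F (w : S * R^o) := FS w.1 - fl w.1 0 w.2.
have Fk x (t : R) (k : nat) : loopmod (F (iter k phi x, k%:R + t) - F (x, t)).
  have H := nreach_eq (hFS (iter k phi x)) (hFS x).
  have FA := mod_le ML (fl_add phi (iter k phi x) 0 (k%:R : R) (k%:R + t)).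
  rewrite fl_tail in FA.
  apply: (mod_eq (modD ML H FA)); rewrite /F /=.
  set x1 := fl _ _ _; set x2 := fl _ _ _; set x3 := fl _ _ _.
  by zmod.
have Feq w w' : Fl phi w = Fl phi w' -> loopmod (F w - F w').
  case: w w' => [x t] [y u] /Fl_eq[[k|k] [-> ->]].
    have -> : (iter_homeo phi k x, t + k%:~R) = (iter k phi x, k%:R + t) :> S * R^o.
      by congr (_, _); rewrite addrC.
    by apply: (mod_eq (modN ML (Fk x t k))); set f1 := F _; set f2 := F _; zmod.
  have -> : (x, t) = (iter k.+1 phi (iter_homeo phi (Negz k) x), k.+1%:R + (t + (Negz k)%:~R)) :> S * R^o.
    congr (_, _); last by rewrite NegzE mulrNz; ring.
    by rewrite -[LHS](@iterhVK S phi k.+1 x).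
  exact: Fk.
apply: (@cycle_modulus R N loopmod ML (fun xi => F (rep xi))) => xi.
have [x [t0 [_ exi]]] := Fl_surj xi.
have [B [f [g [dc [p Bp px] _ [_ [[p1 Bp1 <-] Mp1]] lc]]]] := nice openT (I : setT x).
have [vv rv] := reach_ex Mp1.
have [cB cg oB fg] := dc; have ch := gchart_disc dc.
have Floc a b t : B a -> B b -> loopmod (sline g t a b - (F (g a, t) - F (g b, t))).
  move=> Ba Bb.
  have nr c : B c -> nreach (g c) (sline g 0 c p1 + vv) by move=> Bc; exists B, f, g, c, p1, vv.
  have Ha := nreach_eq (j := 0) (nr _ Ba) (hFS (g a)); have Hb := nreach_eq (j := 0) (nr _ Bb) (hFS (g b)).
  have Za := mod_le ML (fl_const (g a)); have Zb := mod_le ML (fl_const (g b)).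
  have ADD := mod_le ML (gchart_add phi 0 ch Ba Bb Bp1).
  have SL := mod_le ML (slide phi cB cg 0 t Ba Bb).
  rewrite /= (_ : 0%:R = 0) // in Ha Hb.
  apply: (mod_eq (modB ML (modD ML (modB ML Ha Hb) (modB ML Za Zb)) (modB ML SL ADD))).
  rewrite /F /=.
  set x1 := sline _ _ _ _; set x2 := fl _ _ _; set x3 := fl _ _ _; set x4 := sline _ _ _ _.
  set x5 := sline _ _ _ _; set x6 := fl _ _ _; set x7 := fl _ _ _; set x8 := sline _ _ _ _.
  by zmod.
exists (@flow_box R S phi B g t0 2^-1); split; first exact: (@flow_box_open R S phi B f g dc).
  by rewrite exi -px; apply: flow_box_center => //; rewrite invr_gt0.
move=> gam a b ab cgam Wgam.
have [|u [v [[Ba _ ea] [Bb _ eb] L]]] := flow_box_path dc _ ab cgam Wgam; first by [].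
have P := chart_strip_path phi cB cg u.2 v.2 Ba Bb.
have FA := mod_le ML (fl_add phi (g v.1) 0 u.2 v.2).
have L1 := Floc _ _ u.2 Ba Bb.
have Ra : loopmod (F (g u.1, u.2) - F (rep (gam a))) by apply: Feq; rewrite hrep -ea.
have Rb : loopmod (F (g v.1, v.2) - F (rep (gam b))) by apply: Feq; rewrite hrep -eb.
rewrite -!surjective_pairing in P; apply: (mod_eq (modD ML (modD ML (mod_le ML L) (mod_le ML P)) (modD ML (modD ML L1 FA) (modB ML Ra Rb)))).
rewrite /F /=.
set x1 := line _ _ _; set x2 := line _ _ _; set x3 := sline _ _ _ _; set x4 := fl _ _ _.
set x5 := fl _ _ _; set x6 := fl _ _ _; set x7 := fl _ _ _; set x8 := fl _ _ _.
by zmod.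
Qed.
End Potential.

(** * Finite generation and torsion *)

Section FiniteGeneration.
Variables (R : realType) (N : topologicalType).
Hypotheses (N_compact : compact [set: N]) (N_haus : hausdorff_space N).
Let BM := @modulus_boundary R N.

Definition point (xi : N) : chain R 0 N := << (fun=> xi) >>.

Definition joins (c : chain R 1 N) (xi eta : N) := is_chain setT c /\ bd c = point eta - point xi.

Definition path_connected (W : set N) := forall xi eta, W xi -> W eta ->
  exists gam : R^o -> N, [/\ {within `[0, 1], continuous gam},
    forall t, 0 <= t <= 1 -> W (gam t), gam 0 = xi & gam 1 = eta].

Definition potential_on (W : set N) (f : N -> chain R 1 N) :=
  forall (gam : R^o -> N) a b, a <= b -> {within `[a, b], continuous gam} ->
    (forall t, a <= t <= b -> W (gam t)) -> boundary (line gam a b - (f (gam a) - f (gam b))).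

Lemma joins_sub c c' xi eta zeta : joins c xi zeta -> joins c' eta zeta -> joins (c - c') xi eta.
Proof.
move=> [h e] [h' e']; split; first by apply: is_chainD => //; exact: is_chainN.
by rewrite bdD bdN e e'; zmod.
Qed.

Lemma joins_cycle c xi : joins c xi xi -> Defs.cycle setT set0 c.
Proof. by move=> [h e]; split => //; rewrite e subrr; exact: is_chain0. Qed.

Variable p0 : N.
Hypothesis local : forall xi (O : set N), open O -> O xi -> exists (W : set N) f,
  [/\ open W, W xi, W `<=` O, path_connected W &
      potential_on W f /\ forall eta, W eta -> joins (f eta) eta p0].

(** On a path-connected set the difference of two potentials is constant up to boundaries, and
    finitely many such sets cover the compact set [K]. *)
Lemma finite_difference (Z Z' : set N) f f' K : open Z -> open Z' -> closed K ->
  K `<=` Z `&` Z' -> potential_on Z f -> potential_on Z' f' ->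
  (forall eta, Z eta -> joins (f eta) eta p0) -> (forall eta, Z' eta -> joins (f' eta) eta p0) ->
  exists s : seq (chain R 1 N), (forall c, c \in s -> Defs.cycle setT set0 c) /\
    forall eta, K eta -> exists2 c, c \in s & boundary (f eta - f' eta - c).
Proof.
move=> oZ oZ' cK KZ pf pf' jf jf'.
have Kc : compact K by apply: (subclosed_compact cK N_compact).
have /choice[P HP] : forall eta, exists P : set N, open P /\ (K eta -> [/\ P eta, P `<=` Z `&` Z' & path_connected P]).
  move=> eta; have [Ke|nK] := pselect (K eta); last by exists set0; split => //; exact: open0.
  have [W [_ [oW We sW pW _]]] := local (openI oZ oZ') (KZ _ Ke).
  by exists W.
have [|D DK KD] := @compact_finite_cover _ _ Kc N K P (fun eta _ => (HP eta).1).
  by move=> eta Ke; exists eta => //; have [] := (HP eta).2 Ke.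
exists [seq f eta - f' eta | eta <- enum_fset D]; split.
  move=> c /mapP[eta De ->]; have Ke : K eta by have := DK _ De; move/set_mem.
  have [Ze Ze'] := KZ _ Ke; apply: (@joins_cycle _ eta).
  by apply: joins_sub; [exact: jf|exact: jf'].
move=> eta Ke; have [zeta Dz Pz] := KD _ Ke.
have Kz : K zeta by have := DK _ Dz; move/set_mem.
have [Pzz PZ pc] := (HP zeta).2 Kz.
exists (f zeta - f' zeta); first by apply: map_f.
have [gam [cg gP g0 g1]] := pc _ _ Pz Pzz.
have l01 : 0 <= (1 : R) by [].
have h := pf gam 0 1 l01 cg (fun t ht => (PZ _ (gP t ht)).1).
have h' := pf' gam 0 1 l01 cg (fun t ht => (PZ _ (gP t ht)).2).
rewrite g0 g1 in h h'; apply: (mod_eq (modB BM h' h)).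
by set l := line _ _ _; zmod.
Qed.

(** A Cech-type argument. A global function picks at each point one of finitely many local
    potentials. Along a short path the choice may change, at the cost of one of the finitely many
    cycles of [finite_difference]. The nesting of [V], [W] and [Z] ensures that the potentials
    chosen near a point are defined on a common neighbourhood of it. *)
Lemma finitely_generated : exists s : seq (chain R 1 N),
  (forall c, c \in s -> Defs.cycle setT set0 c) /\
  forall G, modulus G -> (forall c, c \in s -> G c) -> forall z, Defs.cycle setT set0 z -> G z.
Proof.
have reg (eta : N) (O : set N) : open O -> O eta -> exists W, [/\ closed W, W `<=` O & W^° eta].
  move=> oO Oe; have nO : nbhs eta O by exact: open_nbhs_nbhs.
  have [W nW WO] := compact_regular N_haus N_compact filterT nO.
  exists (closure W); split => //; first exact: closed_closure.
  by apply: filterS nW; exact: subset_closure.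
have /choice[F HF] : forall eta, exists F : (set N * (N -> chain R 1 N)) * (set N * set N),
    [/\ open F.1.1 /\ closed F.2.1, closed F.2.2, F.2.1 `<=` F.1.1,
        F.2.2 `<=` F.2.1^° & F.2.2^° eta /\ (potential_on F.1.1 F.1.2 /\
          forall zeta, F.1.1 zeta -> joins (F.1.2 zeta) zeta p0)].
  move=> eta; have [Z [f [oZ Ze _ _ pf]]] := local openT (I : setT eta).
  have [W [cW WZ We]] := reg _ _ oZ Ze.
  have [V [cV VW Ve]] := reg _ _ (@open_interior _ W) We.
  by exists ((Z, f), (W, V)).
pose Z eta := (F eta).1.1; pose f eta := (F eta).1.2; pose W eta := (F eta).2.1; pose V eta := (F eta).2.2.
have oZ i : open (Z i) by have [[]] := HF i.
have cW i : closed (W i) by have [[]] := HF i.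
have cV i : closed (V i) by have [] := HF i.
have WZ i : W i `<=` Z i by have [] := HF i.
have VW i : V i `<=` (W i)^° by have [] := HF i.
have Vi i : (V i)^° i by have [_ _ _ _ []] := HF i.
have pf i : potential_on (Z i) (f i) by have [_ _ _ _ [_ []]] := HF i.
have jf i : forall zeta, Z i zeta -> joins (f i zeta) zeta p0 by have [_ _ _ _ [_ []]] := HF i.
have /choice[s Hs] : forall ij : N * N, exists s : seq (chain R 1 N),
  (forall c, c \in s -> Defs.cycle setT set0 c) /\
    forall eta, (W ij.1 `&` W ij.2) eta -> exists2 c, c \in s & boundary (f ij.1 eta - f ij.2 eta - c).
  move=> [i j]; apply: (finite_difference (oZ i) (oZ j) _ _ (pf i) (pf j) (jf i) (jf j)).
    exact: closedI.
  by move=> eta [/WZ ? /WZ].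
have [||D _ HD] := @compact_finite_cover _ _ N_compact N setT (fun i => (V i)^°).
- by move=> i _; exact: open_interior.
- by move=> i _; exists i.
exists (flatten [seq s ij | ij <- [seq (i, j) | i <- enum_fset D, j <- enum_fset D]]); split.
  by move=> c /flattenP[_ /mapP[ij _ ->]]; exact: (Hs ij).1.
move=> G GM GE z cz.
have /choice[i Hi] : forall eta, exists i, i \in D /\ V i eta.
  by move=> eta; have [i Di Ve] := HD eta I; exists i; split => //; exact: interior_subset.
apply: (@cycle_modulus R N G GM (fun eta => f (i eta) eta) _ z cz) => xi.
(* Inside all [U k], a point of [V k] can occur only if [xi] lies in [V k], and then the
   neighbourhood is contained in [W k]. *)
pose U k := if pselect (V k xi) then W k else ~` V k.
have nU : nbhs xi (\bigcap_(k in [set` D]) U k).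
  apply: filter_bigI => k Dk; rewrite /U; case: pselect => [/VW //|nV].
  by apply: open_nbhs_nbhs; split => //; exact: closed_openC.
exists (\bigcap_(k in [set` D]) U k)^°; split => //; first exact: open_interior.
move=> gam a b ab cgam gU.
have UV eta k : (\bigcap_(k in [set` D]) U k)^° eta -> k \in D -> V k eta -> V k xi.
  move=> /interior_subset Ue Dk Vk; have := Ue k Dk; rewrite /U.
  by case: pselect => // nV /(_ Vk).
have UW eta k : (\bigcap_(k in [set` D]) U k)^° eta -> k \in D -> V k xi -> W k eta.
  by move=> /interior_subset Ue Dk Vk; have := Ue k Dk; rewrite /U; case: pselect.
have Ua := gU a; have Ub := gU b.
have {}Ua : (\bigcap_(k in [set` D]) U k)^° (gam a) by apply: Ua; rewrite lexx ab.
have {}Ub : (\bigcap_(k in [set` D]) U k)^° (gam b) by apply: Ub; rewrite lexx ab.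
have [Da Va] := Hi (gam a); have [Db Vb] := Hi (gam b).
have Vax := UV _ _ Ua Da Va; have Vbx := UV _ _ Ub Db Vb.
have L := pf (i (gam a)) gam a b ab cgam (fun t ht => WZ _ _ (UW _ _ (gU t ht) Da Vax)).
have [c cs Hc] := (Hs (i (gam a), i (gam b))).2 (gam b) (conj (UW _ _ Ub Da Vax) (UW _ _ Ub Db Vbx)).
have Gc : G c.
  apply: GE; apply/flattenP; exists (s (i (gam a), i (gam b))) => //.
  by apply: map_f; apply: allpairs_f.
apply: (mod_eq (modB GM (modB GM (mod_le GM L) (mod_le GM Hc)) Gc)) => /=.
set l := line _ _ _; set x1 := f _ _; set x2 := f _ _; set x3 := f _ _.
by rewrite -[in RHS]addrA -opprD subrK; zmod.
Qed.
End FiniteGeneration.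

Lemma conv_in_itv (R : realType) (lo hi a b t : R) :
  lo < a < hi -> lo < b < hi -> 0 <= t <= 1 -> lo < (1 - t) * a + t * b < hi.
Proof.
move=> /andP[a1 a2] /andP[b1 b2] /andP[t0 t1].
have e : (1 - t) * a + t * b = a + t * (b - a) by ring.
have e' : (1 - t) * a + t * b = b + (1 - t) * (a - b) by ring.
have [ab|ba] := lerP a b.
  have h : 0 <= t * (b - a) by rewrite mulr_ge0 // subr_ge0.
  have h' : 0 <= (1 - t) * (b - a) by rewrite mulr_ge0 ?subr_ge0.
  by apply/andP; split; [rewrite e|rewrite e']; lra.
have h : 0 <= t * (a - b) by rewrite mulr_ge0 // subr_ge0 ltW.
have h' : 0 <= (1 - t) * (a - b) by rewrite mulr_ge0 ?subr_ge0 // ltW.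
by apply/andP; split; [rewrite e'|rewrite e]; lra.
Qed.

(** * Topology of the mapping torus *)

Section MappingTorusTopology.
Variables (R : realType) (S : topologicalType) (phi : homeomorphism S).
Hypotheses (S_compact : compact [set: S]) (S_haus : hausdorff_space S)
  (S_connected : connected [set: S]).
Local Notation N := (mapping_torus R phi).
Let BM := @modulus_boundary R N.

Lemma mapping_torus_compact : compact [set: N].
Proof.
have c01 : compact (`[0, 1]%classic : set R^o) by exact: segment_compact.
have -> : [set: N] = Fl phi @` ([set: S] `*` `[0, 1]%classic).
  apply/seteqP; split => // xi _; have [x [t [t01 ->]]] := Fl_surj xi.
  by exists (x, t) => //; split => //=; rewrite in_itv.
apply: continuous_compact; last exact: compact_setX.
by apply: continuous_subspaceT; exact: Fl_continuous.
Qed.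

Lemma mapping_torus_separate x t y u (O1 O2 : set (S * R^o)) : `|t - u| <= 2^-1 ->
  open O1 -> open O2 -> O1 (x, t) -> O2 (y, u) -> O1 `&` O2 = set0 ->
  exists A B : set N, [/\ open A, open B, A (Fl phi (x, t)), B (Fl phi (y, u)) & A `&` B = set0].
Proof.
move=> tu o1 o2 h1 h2 dis.
(* Two lifts of a common point differ in height by less than 1/2 + 1/4 + 1/4, so the integer shift
   of [Fl_eq] vanishes. *)
pose strip (v : R) : set (S * R^o) := (fun w : S * R^o => w.2 : R) @^-1` `]v - 4^-1, v + 4^-1[.
have os v : open (strip v).
  by apply: open_comp; [move=> w _; exact: cvg_snd|exact: interval_open].
exists (Fl phi @` (O1 `&` strip t)), (Fl phi @` (O2 `&` strip u)); split.
- by apply: Fl_open; exact: openI.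
- by apply: Fl_open; exact: openI.
- by exists (x, t) => //; split => //; rewrite /strip /= in_itv /=; apply/andP; split; lra.
- by exists (y, u) => //; split => //; rewrite /strip /= in_itv /=; apply/andP; split; lra.
apply/seteqP; split => // _ [[[a v] [ O1a sa] <-] [[b w] [ O2b sb] /esym/Fl_eq[n [ew eb]]]].
have n0 : n = 0.
  move: sa sb tu; rewrite /strip /= !in_itv /= ew ler_norml => /andP[? ?] /andP[? ?] /andP[? ?].
  have : -1 < (n%:~R : R) < 1 by lra.
  rewrite -[-1](_ : (-1)%:~R = _) // -[X in _ < _ < X](_ : 1%:~R = _) // !ltr_int.
  by lia.
have : (O1 `&` O2) (a, v) by split => //; move: O2b; rewrite ew eb n0 addr0.
by rewrite dis.
Qed.

Lemma mapping_torus_hausdorff : hausdorff_space N.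
Proof.
rewrite open_hausdorff => xi eta /eqP ne.
have [x [t [_ exi]]] := Fl_surj xi; have [y' [u' [_ eeta]]] := Fl_surj eta.
have [y [u [tu eu]]] : exists y u, `|t - u| <= 2^-1 /\ eta = Fl phi (y, u).
  (* Selects the lift of [eta] whose height is within 1/2 of [t]. *)
  pose n := Num.floor (t - u' + 2^-1).
  exists (iter_homeo phi n y'), (u' + n%:~R); split; last by rewrite Fl_shift.
  have h1 : n%:~R <= t - u' + 2^-1 by exact: ge_floor.
  have h2 : t - u' + 2^-1 < (n + 1)%:~R by exact: lt_succ_floor.
  by rewrite intrD1 in h2; rewrite ler_norml; apply/andP; split; lra.
have [ O1 [ O2 [ o1 o2 h1 h2 dis]]] : exists O1 O2 : set (S * R^o),
    [/\ open O1, open O2, O1 (x, t), O2 (y, u) & O1 `&` O2 = set0].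
  have [exy|nxy] := eqVneq x y.
    have ntu : t <> u by move=> etu; apply: ne; rewrite exi eu exy etu.
    have e0 : 0 < `|t - u| / 2 by rewrite divr_gt0 // normr_gt0 subr_eq0; apply/eqP.
    pose strip (v : R) : set (S * R^o) := (fun w : S * R^o => w.2 : R) @^-1` `]v - `|t - u| / 2, v + `|t - u| / 2[.
    have os v : open (strip v).
      by apply: open_comp; [move=> w _; exact: cvg_snd|exact: interval_open].
    exists (strip t), (strip u); split => //.
    - by rewrite /strip /= in_itv /=; apply/andP; split; lra.
    - by rewrite /strip /= in_itv /=; apply/andP; split; lra.
    apply/seteqP; split => // -[a v] []; rewrite /strip /= !in_itv /= => /andP[].
    move=> h1 h2 /andP[h3 h4]; clear - t u v e0 h1 h2 h3 h4.
    have hD (D : R) : t - D / 2 < v -> v < t + D / 2 -> u - D / 2 < v -> v < u + D / 2 -> `|t - u| < D.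
      by move=> *; rewrite ltr_norml; apply/andP; split; lra.
    by have := hD _ h1 h2 h3 h4; rewrite ltxx.
  move: S_haus; rewrite open_hausdorff => /(_ x y nxy)[[A B] /= [/set_mem Ax /set_mem By] [oA oB /eqP AB]].
  exists (fst @^-1` A), (fst @^-1` B); split => //.
  - by apply: open_comp => // w _; exact: cvg_fst.
  - by apply: open_comp => // w _; exact: cvg_fst.
  by apply/seteqP; split => // w Hw; have : (A `&` B) w.1 by []; rewrite AB.
have [A [B [oA oB Ax By AB]]] := mapping_torus_separate tu o1 o2 h1 h2 dis.
by exists (A, B); split => //=; [apply/mem_set; rewrite exi|apply/mem_set; rewrite eu|apply/eqP].
Qed.

Hypothesis disc : forall x (O : set S), open O -> O x -> exists B f g,
  [/\ @disc_chart R S B f g, (g @` B) x & g @` B `<=` O].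

Lemma line_joins (E : normedModType R) (D : set E) (Psi : E -> N) p q :
  is_convex D -> {within D, continuous Psi} -> D p -> D q -> joins (line Psi p q) (Psi p) (Psi q).
Proof.
move=> cD cPsi Dp Dq; split; last exact: line_bd.
by apply: is_chainU; exact: line_continuous cD cPsi Dp Dq.
Qed.

Lemma joins_trans (c c' : chain R 1 N) xi eta zeta : joins c xi eta -> joins c' eta zeta -> joins (c + c') xi zeta.
Proof.
move=> [h e] [h' e']; split; first exact: is_chainD.
by rewrite bdD e e'; zmod.
Qed.

Lemma joins_ex xi eta : exists c : chain R 1 N, joins c xi eta.
Proof.
have flow x (a b : R) : exists c : chain R 1 N, joins c (Fl phi (x, a)) (Fl phi (x, b)).
  exists (fl phi x a b); apply: (@line_joins R^o setT (fun t => Fl phi (x, t))) => //.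
  apply: continuous_subspaceT => t; apply: (@continuous_comp _ _ _ (fun t : R^o => (x, t) : S * R^o) (Fl phi)).
    by apply: continuous_pair; [move=> ?; exact: cvg_cst|move=> ?; exact: cvg_id].
  exact: Fl_continuous.
suff conn x y : exists c : chain R 1 N, joins c (Fl phi (x, 0)) (Fl phi (y, 0)).
  have [x [t [_ ->]]] := Fl_surj xi; have [y [u [_ ->]]] := Fl_surj eta.
  have [c1 h1] := flow x t 0; have [c2 h2] := conn x y; have [c3 h3] := flow y 0 u.
  by exists (c1 + c2 + c3); apply: joins_trans h3; exact: joins_trans h2.
pose P y := exists c : chain R 1 N, joins c (Fl phi (x, 0)) (Fl phi (y, 0)).
have loc z : exists O, [/\ open O, O z & forall u v, O u -> O v -> P u -> P v].
  have [B [f [g [dc gz _]]]] := disc openT (I : setT z).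
  have [cB cg oB fg] := dc; exists (g @` B); split => // _ _ [p Bp <-] [q Bq <-] [c h].
  exists (c + sline phi g 0 p q); apply: joins_trans h _.
  exact: (line_joins cB (chart_slice_continuous (phi := phi) cg (t := 0)) Bp Bq).
have oP (Q : S -> Prop) : (forall u v, (P u -> P v) -> (P v -> P u) -> Q u -> Q v) -> open [set z | Q z].
  move=> HQ; rewrite openE => z Qz; have [ O [ oO Oz HO]] := loc z.
  have : nbhs z O by exact: open_nbhs_nbhs.
  by apply: filterS => w Ow; apply: HQ Qz => //; exact: HO.
suff PT : [set z | P z] = setT by have : setT y by []; rewrite -PT.
apply: S_connected.
- by exists x; have [c h] := flow x 0 0; exists c.
- by exists [set z | P z]; [apply: oP => u v h _|rewrite setTI].
- exists [set z | P z]; last by rewrite setTI.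
  by rewrite -openC; apply: oP => u v _ h nP /h.
Qed.

(** A flow box of half-height at most 1/2 embeds, and it is convex upstairs. The segment to its
    centre, followed by a fixed chain to [p0], is a potential on it. *)
Lemma mapping_torus_local (p0 : N) xi (O : set N) : open O -> O xi -> exists (W : set N) (f : N -> chain R 1 N),
  [/\ open W, W xi, W `<=` O, path_connected R W &
      potential_on W f /\ forall eta, W eta -> joins (f eta) eta p0].
Proof.
move=> oO Oxi; have [x [t0 [_ exi]]] := Fl_surj xi.
have nO : nbhs (x, t0 : R^o) (Fl phi @^-1` O).
  by apply: (Fl_continuous (x := (x, t0))); apply: open_nbhs_nbhs; split => //; rewrite -exi.
case: nO => -[/= P Q] [nP nQ] PQ.
have [d /= d0 Hd] := nQ.
have [oP Px] : open P^° /\ P^° x by split => //; exact: open_interior.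
have [B [f [g [dc [p Bp px] gBP]]]] := disc oP Px.
pose e := Num.min d 2^-1.
have e0 : 0 < e by rewrite lt_min d0 /= invr_gt0.
have e2 : e <= 2^-1 by rewrite ge_min lexx orbT.
have ed : e <= d by rewrite ge_min lexx.
have Bp' : [set w : 'rV[R]_2 * R^o | B w.1] (p, t0) by [].
have cD := flow_domain_convex dc; have cF := @flow_chart_continuous R S phi B f g dc.
have [sec secP] : exists sec : N -> 'rV[R]_2 * R^o, forall eta, flow_box B g t0 e eta ->
    [/\ B (sec eta).1, t0 - e < (sec eta).2 < t0 + e & flow_chart phi g (sec eta) = eta].
  suff /choice[sec H] : forall eta : N, exists w : 'rV[R]_2 * R^o, flow_box B g t0 e eta ->
    [/\ B w.1, t0 - e < w.2 < t0 + e & flow_chart phi g w = eta] by exists sec.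
  move=> eta; have [/flow_boxP[w [? ?] ?]|nb] := pselect (flow_box B g t0 e eta); first by exists w.
  by exists (p, t0).
have [c0 jc0] := joins_ex (flow_chart phi g (p, t0)) p0.
have in0 : t0 - e < t0 < t0 + e by apply/andP; split; lra.
exists (flow_box B g t0 e), (fun eta => line (flow_chart phi g) (sec eta) (p, t0) + c0); split.
- exact: (@flow_box_open R S phi B f g dc).
- by rewrite exi -px; exact: flow_box_center.
- move=> _ /flow_boxP[[v t] [Bv /= /andP[t1 t2]] <-]; apply: (PQ (g v, t)); split => /=.
    by apply: interior_subset; apply: gBP; exists v.
  by apply: Hd; rewrite /ball /= ltr_norml; apply/andP; split; lra.
- move=> eta zeta /flow_boxP[v [Bv tv] <-] /flow_boxP[w [Bw tw] <-].
  exists (fun t : R^o => flow_chart phi g ((1 - t) *: v + t *: w)); split.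
  + apply: (@within_comp2 _ _ _ _ [set w | B w.1] (fun t : R^o => (1 - t) *: v + t *: w) (flow_chart phi g)) => //.
      apply: continuous_subspaceT; apply: continuous_add; apply: continuous_scale; do ?exact: cst_continuous.
        by move=> z; apply: cvgB; [exact: cvg_cst|exact: cvg_id].
      by move=> ?; exact: cvg_id.
    by move=> t; rewrite /= in_itv => t01; exact: (cD v w t).
  + move=> t t01; apply/flow_boxP; exists ((1 - t) *: v + t *: w) => //; split; first exact: (cD v w t).
    rewrite /= /GRing.scale /=.
    exact: conv_in_itv.
  + by rewrite subr0 scale1r scale0r addr0.
  + by rewrite subrr scale1r scale0r add0r.
split.
  move=> gam a b ab cgam gW.
  have [u [v [[Bu tu eu] [Bv tv ev] L]]] := flow_box_path dc e2 ab cgam gW.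
  have [Ba ta ea] := secP (gam a) (gW a (introT andP (conj (lexx a) ab))).
  have [Bb tb eb] := secP (gam b) (gW b (introT andP (conj ab (lexx b)))).
  have eu' : sec (gam a) = u by exact: (flow_chart_inj dc e2 Ba Bu ta tu (etrans ea (esym eu))).
  have ev' : sec (gam b) = v by exact: (flow_chart_inj dc e2 Bb Bv tb tv (etrans eb (esym ev))).
  have T := line_tri cD cF Bu Bv Bp'.
  rewrite eu' ev'; apply: (mod_eq (modD BM L T)).
  set l1 := line _ _ _; set l2 := line _ _ _; set l3 := line _ _ _; set l4 := line _ _ _.
  by zmod.
move=> eta /secP[Be te ee]; apply: joins_trans jc0.
rewrite -[X in joins _ X]ee; exact: line_joins cD cF Be Bp'.
Qed.
End MappingTorusTopology.

(** * Coordinates and torsion of the first homology *)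

Section Coordinates.
Variables (R : realType) (N : topologicalType) (b : nat) (h : chain R 1 N -> 'rV[int]_b).
Hypothesis h_coords : homology_coords setT h.
Let BM := @modulus_boundary R N.
Local Notation cyc := (@Defs.cycle R 1 N setT set0).

Lemma cyc_bd c : cyc c <-> is_chain setT c /\ bd c = 0.
Proof.
split=> [[cc /is_chain_set0 e]|[cc e]]; first by split.
by split => //; rewrite e; exact: is_chain0.
Qed.

Lemma cycD c c' : cyc c -> cyc c' -> cyc (c + c').
Proof.
move=> /cyc_bd[h1 e1] /cyc_bd[h2 e2]; apply/cyc_bd; split; first exact: is_chainD.
by rewrite bdD e1 e2 addr0.
Qed.

Lemma cycN c : cyc c -> cyc (- c).
Proof.
move=> /cyc_bd[h1 e1]; apply/cyc_bd; split; first exact: is_chainN.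
by rewrite bdN e1 oppr0.
Qed.

Lemma cyc0 : cyc 0.
Proof. by apply/cyc_bd; split; [exact: is_chain0|exact: bd0]. Qed.

Lemma cycB c c' : cyc c -> cyc c' -> cyc (c - c').
Proof. by move=> h1 h2; apply: cycD => //; exact: cycN. Qed.

Lemma cycMn c n : cyc c -> cyc (c *+ n).
Proof.
by move=> h1; elim: n => [|n IH]; [rewrite mulr0n; exact: cyc0|rewrite mulrS; exact: cycD].
Qed.

Lemma cycMz c (n : int) : cyc c -> cyc (c *~ n).
Proof. by case: n => n h1; [exact: cycMn|rewrite NegzE mulrNz; apply/cycN/cycMn]. Qed.

Lemma cyc_sum (I : Type) (r : seq I) (F : I -> chain R 1 N) : (forall i, cyc (F i)) -> cyc (\sum_(i <- r) F i).
Proof. by move=> HF; elim/big_rec: _ => [|i c _ hc]; [exact: cyc0|exact: cycD]. Qed.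

Lemma homologousP (c c' : chain R 1 N) : homologous setT set0 c c' <-> boundary (c - c').
Proof.
split=> [[d [e [cd /is_chain_set0 -> ->]]]|[d cd e]]; first by rewrite addr0; exists d.
by exists d, 0; split; rewrite ?addr0 //; exact: is_chain0.
Qed.

Lemma coordsD c c' : cyc c -> cyc c' -> h (c + c') = h c + h c'.
Proof. by case: h_coords => H _ _; exact: H. Qed.

Lemma coords0 : h 0 = 0.
Proof. by apply: (addrI (h 0)); rewrite -coordsD ?addr0 //; exact: cyc0. Qed.

Lemma coordsN c : cyc c -> h (- c) = - h c.
Proof.
move=> hc; apply: (addrI (h c)); rewrite -coordsD ?subrr ?coords0 //; exact: cycN.
Qed.

Lemma coordsB c c' : cyc c -> cyc c' -> h (c - c') = h c - h c'.
Proof. by move=> h1 h2; rewrite coordsD ?coordsN //; exact: cycN. Qed.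

Lemma coordsMn c n : cyc c -> h (c *+ n) = h c *+ n.
Proof.
move=> hc; elim: n => [|n IH]; first by rewrite !mulr0n coords0.
by rewrite !mulrS coordsD ?IH //; exact: cycMn.
Qed.

Lemma coordsMz c (n : int) : cyc c -> h (c *~ n) = h c *~ n.
Proof.
move=> hc; case: n => n; first exact: coordsMn.
by rewrite NegzE !mulrNz coordsN ?coordsMn //; exact: cycMn.
Qed.

Lemma coords_sum (I : Type) (r : seq I) (F : I -> chain R 1 N) : (forall i, cyc (F i)) ->
  h (\sum_(i <- r) F i) = \sum_(i <- r) h (F i).
Proof.
move=> HF; elim: r => [|i r IH]; first by rewrite !big_nil coords0.
by rewrite !big_cons coordsD ?IH //; exact: cyc_sum.
Qed.

Lemma coords_boundary c : cyc c -> boundary c -> h c = 0.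
Proof.
move=> hc bc; case: h_coords => _ _ /(_ c hc) [_ ->] //.
by exists 1 => //; apply/homologousP; rewrite subr0 scale1r.
Qed.

Lemma coords_eq c c' : cyc c -> cyc c' -> boundary (c - c') -> h c = h c'.
Proof.
move=> h1 h2 bc; apply/eqP; rewrite -subr_eq0 -coordsB //; apply/eqP.
by apply: coords_boundary => //; exact: cycB.
Qed.

Hypothesis fg : exists s : seq (chain R 1 N), (forall c, c \in s -> cyc c) /\
  forall G, modulus G -> (forall c, c \in s -> G c) -> forall z, cyc z -> G z.

(** Subtracting from each generator the combination of the [u j] with the same coordinates leaves a
    torsion class. When a cycle with zero coordinates is expressed in these elements, its part along
    the [u j] vanishes. *)
Lemma torsion_generators : exists (r : nat) (y : 'I_r -> chain R 1 N) (m : 'I_r -> nat),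
  [/\ forall i, cyc (y i), forall i, (0 < m i)%N, forall i, boundary (y i *+ m i)
    & forall z, cyc z -> h z = 0 -> exists n : 'I_r -> int, boundary (z - \sum_i y i *~ n i)].
Proof.
have [s [sc sG]] := fg.
have [_ hs ht] := h_coords.
have /choice[u Hu] : forall j : 'I_b, exists u, cyc u /\ h u = delta_mx 0 j.
  by move=> j; have [c hc ec] := hs (delta_mx 0 j); exists c.
have cu j : cyc (u j) by have [] := Hu j.
pose x (i : 'I_(size s)) : chain R 1 N := nth 0 s i.
have cx i : cyc (x i) by apply: sc; exact: mem_nth.
pose y i := x i - \sum_j u j *~ (h (x i) 0 j).
have cy i : cyc (y i) by apply: cycB => //; apply: cyc_sum => j; exact: cycMz.
have hu (a : 'I_b -> int) : h (\sum_j u j *~ a j) = \row_j a j.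
  rewrite coords_sum; last by move=> j; exact: cycMz.
  rewrite [RHS]row_sum_delta; apply: eq_bigr => j _.
  by rewrite coordsMz // (Hu j).2 mxE -scale_int.
have hy i : h (y i) = 0.
  rewrite coordsB //; last by apply: cyc_sum => j; exact: cycMz.
  by rewrite hu; apply/rowP => j; rewrite !mxE subrr.
have /choice[m Hm] : forall i, exists m, (0 < m)%N /\ boundary (y i *+ m).
  move=> i; have [/(_ (hy i))[m m0 /homologousP]] := ht _ (cy i).
  rewrite subr0 scale_int => bm _; case: m m0 bm => // m m0 bm; exists m; split => //.
exists (size s), y, m; split=> [i|i|i|z cz hz] //; [by have [] := Hm i|by have [] := Hm i|].
pose G c := exists (n : 'I_(size s) -> int) (a : 'I_b -> int),
  boundary (c - (\sum_i y i *~ n i + \sum_j u j *~ a j)).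
have GM : modulus G.
  split.
  - exists (fun=> 0), (fun=> 0); rewrite !big1 ?addr0 ?subr0; [exact: mod0 BM| | ] => i _; exact: mulr0z.
  - move=> c c' [n [a H]] [n' [a' H']]; exists (fun i => n i - n' i), (fun i => a i - a' i).
    apply: (mod_eq (modB BM H H')).
    rewrite (eq_bigr (fun i => y i *~ n i - y i *~ n' i)); last by move=> i _; rewrite mulrzBr.
    rewrite [in X in _ + X](eq_bigr (fun i => u i *~ a i - u i *~ a' i)); last by move=> i _; rewrite mulrzBr.
    rewrite !sumrB; set s1 := \sum_i _; set s2 := \sum_i _; set s3 := \sum_i _; set s4 := \sum_i _.
    by zmod.
  - move=> d cd; exists (fun=> 0), (fun=> 0); rewrite !big1 ?addr0 ?subr0; [by exists d| | ] => i _; exact: mulr0z.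
have Gs c : c \in s -> G c.
  move=> cs; have cs' : (index c s < size s)%N by rewrite index_mem.
  pose i := Ordinal cs'.
  exists (fun k => (k == i)%:R), (fun j => h (x i) 0 j).
  rewrite (bigD1 i) //= eqxx mulr1z big1 ?addr0; last by move=> k /negPf ->; exact: mulr0z.
  rewrite /y subrK /x /= nth_index // subrr; exact: mod0 BM.
have [n [a H]] := sG G GM Gs z cz.
have ca : cyc (\sum_j u j *~ a j) by apply: cyc_sum => j; exact: cycMz.
have cn : cyc (\sum_i y i *~ n i) by apply: cyc_sum => j; exact: cycMz.
have e : h z = \row_j a j.
  rewrite (coords_eq cz (cycD cn ca) H) coordsD // hu coords_sum; last by move=> i; exact: cycMz.
  by rewrite big1 ?add0r // => i _; rewrite coordsMz // hy mul0rz.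
exists n; apply: (mod_eq H); congr (_ - _).
rewrite [X in _ + X]big1 ?addr0 // => j _.
have -> : a j = 0; last exact: mulr0z.
by move/rowP: e => /(_ j); rewrite hz !mxE.
Qed.

(** Exponents of the torsion generators can be reduced modulo their orders, which leaves finitely
    many sums. *)
Lemma torsion_finite : finite_set (@torsion_classes R 1 N setT).
Proof.
have [r [y [m [cy m0 bm Hz]]]] := torsion_generators.
pose K := (\sum_i m i)%N.
pose cls (k : {ffun 'I_r -> 'I_K}) : set (chain R 1 N) :=
  [set z' | cyc z' /\ homologous setT set0 z' (\sum_i y i *+ k i)].
apply: (@sub_finite_set _ _ (cls @` setT)); last by apply: finite_image; exact: finite_finset.
move=> E [z [cz tz ->]]; have [_ _ /(_ z cz)[_ /(_ tz) hz]] := h_coords.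
have [n Hn] := Hz z cz hz.
have kK i : (`|(n i %% m i)%Z|%N < K)%N.
  have lt : (`|(n i %% m i)%Z|%N < m i)%N.
    by rewrite -ltz_nat gez0_abs ?modz_ge0 ?ltz_pmod //; have := m0 i; lia.
  by apply: (leq_trans lt); rewrite /K (bigD1 i) //= leq_addr.
exists [ffun i => Ordinal (kK i)] => //.
have Hk : boundary (z - \sum_i y i *+ [ffun i => Ordinal (kK i)] i).
  have : boundary (\sum_i y i *~ n i - \sum_i y i *+ [ffun i => Ordinal (kK i)] i).
    rewrite -sumrB; apply: (mod_sum BM) => i _; rewrite ffunE /=.
    rewrite pmulrn gez0_abs ?modz_ge0 //; last by have := m0 i; lia.
    rewrite -mulrzBr (_ : n i - (n i %% m i)%Z = (m i)%:Z * (n i %/ m i)%Z); last first.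
      by rewrite {1}(divz_eq (n i) (m i)) addrK mulrC.
    by rewrite mulrzA; apply: (modMz BM); exact: bm.
  move=> H; apply: (mod_eq (modD BM Hn H)).
  by rewrite addrA subrK.
apply/seteqP; split => z' [cz' /homologousP H]; split => //; apply/homologousP.
  apply: (mod_eq (modB BM H Hk)); by rewrite opprB addrA subrK.
by apply: (mod_eq (modD BM H Hk)); rewrite addrA subrK.
Qed.

(** [fset_set] is empty for an infinite set, so positivity rests on [torsion_finite]; the class of 0
    is a member. *)
Lemma torsion_order_gt0 : (0 < @torsion_order R 1 N setT)%N.
Proof.
rewrite /torsion_order cardfs_gt0; apply/fset0Pn.
exists [set z' | cyc z' /\ homologous setT set0 z' 0]; rewrite in_fset_set; last exact: torsion_finite.
apply/mem_set; exists 0; split => //; first exact: cyc0.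
exists 1 => //; apply/homologousP; rewrite subr0 scaler0; exact: mod0 BM.
Qed.
End Coordinates.

(** * Words and closed orbits *)

Section PeriodicOrbits.
Variables (R : realType) (S : topologicalType) (phi : homeomorphism S).
Local Notation N := (mapping_torus R phi).
Local Notation fl := (@fl R S phi).
Let BM := @modulus_boundary R N.

Lemma fl_joins x (a b : R) : joins (fl x a b) (Fl phi (x, a)) (Fl phi (x, b)).
Proof.
apply: (@line_joins R S phi R^o setT (fun t => Fl phi (x, t))) => //.
apply: continuous_subspaceT => t; apply: (@continuous_comp _ _ _ (fun t : R^o => (x, t) : S * R^o) (Fl phi)).
  by apply: continuous_pair; [move=> ?; exact: cvg_cst|move=> ?; exact: cvg_id].
exact: Fl_continuous.
Qed.

Lemma Fl_iter n y t : Fl phi (iter n phi y, t + n%:R) = Fl phi (y, t) :> N.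
Proof. exact: (@Fl_shift R S phi y t n). Qed.

Lemma iter_period j p y : iter p phi y = y -> iter (j * p) phi y = y.
Proof. by move=> e; elim: j => [|j IH] //; rewrite mulSn iterD IH e. Qed.

Lemma fl_period_mul y p k : iter p phi y = y ->
  boundary (fl y 0 (k * p)%:R - fl y 0 p%:R *+ k).
Proof.
move=> ep; elim: k => [|k IH]; first by rewrite mul0n mulr0n subr0; exact: (@fl_const R S phi y).
have ek := iter_period k ep.
have FA := fl_add phi y 0 ((k * p)%:R : R) ((k * p)%:R + p%:R : R).
rewrite -{2}ek fl_tail in FA.
rewrite mulSn [(p + _)%N]addnC natrD mulrSr; apply: (mod_eq (modB BM IH FA)).
set f1 := fl _ _ _; set f2 := fl _ _ _; set f3 := _ *+ _; set f4 := fl _ _ _.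
by zmod.
Qed.

Lemma flow_loopE y (T : R) : flow_loop phi y T = fl y 0 T.
Proof.
rewrite /flow_loop /fl /line; congr (<< _ >>); apply/funext => v.
by rewrite /Fl /= scaler0 add0r /GRing.scale /= mulrC.
Qed.

Lemma fl_cycle y n : iter n phi y = y -> Defs.cycle setT set0 (fl y 0 n%:R).
Proof.
move=> e; have := fl_joins y 0 n%:R.
have := Fl_iter n y 0; rewrite e add0r => ->.
exact: joins_cycle.
Qed.

(** The least positive [p] with [iter p phi y = y] divides [n], and it is the period of the flow
    line because [Fl_eq] allows returns at integer times only. *)
Lemma periodic_orbit y n : (0 < n)%N -> iter n phi y = y -> exists p k : nat,
  [/\ (0 < k)%N, n = (k * p)%N, iter p phi y = y, flow_period phi y (p%:R : R)
    & boundary (fl y 0 n%:R - flow_loop phi y p%:R *+ k)].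
Proof.
move=> n0 en.
have ex : exists p, (0 < p)%N && `[< iter p phi y = y >] by exists n; rewrite n0; apply/asboolP.
have [p /andP[p0 /asboolP ep] pmin] := ex_minnP ex.
have dv : (p %| n)%N.
  rewrite /dvdn; case: (posnP (n %% p)%N) => [_ //|m0].
  have : (p <= n %% p)%N.
    apply: pmin; rewrite m0; apply/asboolP.
    by rewrite -{2}en {2}(divn_eq n p) addnC iterD iter_period.
  by rewrite leqNgt ltn_pmod.
exists p, (n %/ p)%N; rewrite divnK //; split => //.
- by rewrite divn_gt0 //; exact: dvdn_leq.
- split; first by rewrite ltr0n.
    by rewrite -[LHS]/(Fl phi (y, p%:R)) -{1}ep -[p%:R]add0r Fl_iter.
  move=> t /andP[t0 tp] /esym; rewrite -[LHS]/(Fl phi (y, 0)) -[RHS]/(Fl phi (y, t)) => /Fl_eq[m [et ey]].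
  rewrite add0r in et; case: m et ey => m et ey; last first.
    by move: t0; rewrite et NegzE mulrNz oppr_gt0 ltrz0.
  have m0 : (0 < m)%N by move: t0; rewrite et ltr0z; lia.
  have mp : (m < p)%N by move: tp; rewrite et -[p%:R]/(p%:Z%:~R) ltr_int.
  by have := pmin m; rewrite m0 /= => /(_ (introT (asboolP _) (esym ey))); rewrite leqNgt mp.
- by rewrite flow_loopE -{1}(divnK dv); exact: fl_period_mul.
Qed.
End PeriodicOrbits.

Section Words.
Variables (R : realType) (S : topologicalType) (phi : homeomorphism S).
Variables (A : set (flat_chart R S)) (M : set S) (lambda : R).
Hypotheses (S_haus : hausdorff_space S) (lambda_gt1 : 1 < lambda)
  (atlas : foliation_atlas A M).
Local Notation N := (mapping_torus R phi).
Local Notation cross := (cross phi lambda).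
Local Notation is_square := (is_square A).
Local Notation fl := (@fl R S phi).
Local Notation sline := (sline phi).
Local Notation plane := (plane R).
Let BM := @modulus_boundary R N.
Variables (q0 : plane -> S) (l0 : R).
Hypothesis sq0 : is_square q0 l0.
Variables (b : nat) (h : chain R 1 N -> 'rV[int]_b).
Hypothesis h_coords : homology_coords setT h.

Definition letter : Type := (nat * (R * R * (R * R)))%type.
Definition good (a : letter) := (0 < a.1)%N /\ cross q0 l0 q0 l0 a.1 a.2.
Definition time (w : seq letter) : nat := sumn [seq a.1 | a <- w].

Definition trace (z z' : plane) n : chain R 1 N :=
  sline q0 0 0 z' + fl (q0 z') 0 n%:R + sline q0 0 z 0.

(** The intermediate points are recorded because sub-words are compared in [two_letter_word]. *)
Fixpoint run (w : seq letter) (z z' : plane) : Prop :=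
  if w is a :: w' then exists z1 : plane,
    [/\ box l0 z, box l0 z1, aff (lambda ^+ a.1) a.2 z = z1 & run w' z1 z']
  else box l0 z /\ z = z'.

Lemma run_box w z z' : run w z z' -> box l0 z /\ box l0 z'.
Proof.
elim: w z => [|a w IH] z /=; first by move=> [bz <-].
by move=> [z1 [bz _ _ /IH[]]].
Qed.

Lemma run_cat w1 w2 z z' : run (w1 ++ w2) z z' -> exists2 z1, run w1 z z1 & run w2 z1 z'.
Proof.
elim: w1 z => [|a w1 IH] z /=; first by move=> r; exists z => //; have [] := run_box r.
by move=> [z1 [bz bz1 e /IH[z2 r1 r2]]]; exists z2 => //; exists z1.
Qed.

Lemma trace_cycle z z' n : box l0 z -> box l0 z' -> iter n phi (q0 z) = q0 z' ->
  Defs.cycle setT set0 (trace z z' n).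
Proof.
move=> bz bz' e; have [f [cD cq _]] := square_gchart atlas sq0.
have b0 : box l0 0 by exact: (box0 (square_gt0 sq0)).
have cF : {within box l0, continuous (fun w : plane => @Fl R S phi (q0 w, 0))} by exact (@chart_slice_continuous R S phi plane (box l0) q0 cq 0).
have j1 := line_joins (phi := phi) cD cF b0 bz'.
have j2 := fl_joins (R := R) phi (q0 z') 0 n%:R.
have j3 := line_joins (phi := phi) cD cF bz b0.
have en : Fl phi (q0 z', n%:R) = Fl phi (q0 z, 0) :> N by rewrite -e -[n%:R]add0r Fl_iter.
rewrite en in j2; exact: (joins_cycle (joins_trans (joins_trans j1 j2) j3)).
Qed.

Lemma trace_closed z n : box l0 z -> boundary (trace z z n - fl (q0 z) 0 n%:R).
Proof.
move=> bz; have [f ch] := square_gchart atlas sq0.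
have b0 : box l0 0 by exact: (box0 (square_gt0 sq0)).
apply: (mod_eq (gchart_rev phi 0 ch b0 bz)); rewrite /trace.
set s1 := sline _ _ _ _; set s2 := fl _ _ _; set s3 := sline _ _ _ _.
by zmod.
Qed.

(** The arcs between the centre and [z1] cancel, and the two flow segments join up. *)
Lemma trace_cons z z1 z' n t : box l0 z1 -> iter t phi (q0 z1) = q0 z' ->
  boundary (trace z z' (n + t) - (trace z z1 n + trace z1 z' t)).
Proof.
move=> bz1 e; have [f ch] := square_gchart atlas sq0.
have b0 : box l0 0 by exact: (box0 (square_gt0 sq0)).
have RV := gchart_rev phi 0 ch bz1 b0.
have FA := fl_add phi (q0 z') 0 (t%:R : R) (t%:R + n%:R : R).
rewrite -{2}e fl_tail in FA.
rewrite /trace addnC natrD; apply: (mod_eq (modN BM (modD BM FA RV))).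
set s1 := sline _ _ _ _; set s2 := fl _ _ _; set s3 := sline _ _ _ _; set s4 := fl _ _ _.
set s5 := sline _ _ _ _; set s6 := fl _ _ _; set s7 := sline _ _ _ _.
by zmod.
Qed.

Definition has_class (a : letter) (u : 'rV[int]_b) :=
  exists2 z, admissible lambda l0 l0 a.1 a.2 z & h (cpath phi lambda q0 q0 a.1 a.2 z) = u.

Lemma cpath_trace a z z' : aff (lambda ^+ a.1) a.2 z = z' ->
  cpath phi lambda q0 q0 a.1 a.2 z = trace z z' a.1.
Proof. by move=> e; rewrite /cpath e. Qed.

Lemma step_class a u z z' : good a -> has_class a u -> box l0 z -> box l0 z' ->
  aff (lambda ^+ a.1) a.2 z = z' ->
  [/\ iter a.1 phi (q0 z) = q0 z', Defs.cycle setT set0 (trace z z' a.1) & h (trace z z' a.1) = u].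
Proof.
move=> [a0 C] [z2 [bz2 bz2'] <-] bz bz' e; have [_ _ _ H] := C.
have e1 : iter a.1 phi (q0 z) = q0 z' by rewrite H ?e.
have e2 := H _ bz2 bz2'.
have cyc1 := trace_cycle bz bz' e1; have cyc2 := trace_cycle bz2 bz2' e2.
split => //; rewrite (@cpath_trace a z2 _ erefl); apply: (coords_eq h_coords cyc1 cyc2).
rewrite -(cpath_trace e) -(@cpath_trace a z2 _ erefl).
by apply: (cpath_indep atlas sq0 sq0 C); split; rewrite ?e.
Qed.

Lemma run_class w f z z' : (forall a, a \in w -> good a /\ has_class a (f a)) -> run w z z' ->
  [/\ iter (time w) phi (q0 z) = q0 z', Defs.cycle setT set0 (trace z z' (time w))
    & h (trace z z' (time w)) = \sum_(a <- w) f a].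
Proof.
elim: w z => [|a w IH] z Hw /=.
  move=> [bz <-]; have cz : Defs.cycle setT set0 (trace z z 0) by exact: trace_cycle.
  split => //; rewrite big_nil; apply: (coords_boundary h_coords cz).
  have H := modD BM (trace_closed 0 bz) (@fl_const R S phi (q0 z)).
  by apply: (mod_eq H); rewrite subrK.
move=> [z1 [bz bz1 e r]]; have [ga ca] := Hw a (mem_head _ _).
have [e1 c1 h1] := step_class ga ca bz bz1 e.
have [|e2 c2 h2] := IH z1 _ r; first by move=> a' a'w; apply: Hw; rewrite in_cons a'w orbT.
have [_ bz'] := run_box r.
have e3 : iter (time (a :: w)) phi (q0 z) = q0 z' by rewrite /time /= addnC iterD e1.
have c3 : Defs.cycle setT set0 (trace z z' (time (a :: w))) by exact: trace_cycle.
split => //; rewrite big_cons -h1 -h2 -(coordsD h_coords) //.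
apply: (coords_eq h_coords) => //; first exact: cycD.
exact: trace_cons.
Qed.

Lemma run_nseq c u n z z' : good c -> has_class c u -> run (nseq n c) z z' ->
  [/\ iter (n * c.1) phi (q0 z) = q0 z', Defs.cycle setT set0 (trace z z' (n * c.1))
    & h (trace z z' (n * c.1)) = u *+ n].
Proof.
move=> gc cc r; have Hw d : d \in nseq n c -> good d /\ has_class d ((fun=> u) d).
  by rewrite mem_nseq => /andP[_ /eqP ->].
have [] := run_class Hw r; rewrite /time map_nseq sumn_nseq mulnC => e1 e2 e3.
by split => //; rewrite e3 big_nseq iter_addr_0.
Qed.

Lemma word_cross a w : (forall c, c \in a :: w -> good c) -> exists2 k,
  cross q0 l0 q0 l0 (time (a :: w)) k &
  forall z, admissible lambda l0 l0 (time (a :: w)) k z -> run (a :: w) z (aff (lambda ^+ time (a :: w)) k z).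
Proof.
elim: w a => [|c w IH] a Hw.
  have [a0 C] := Hw a (mem_head _ _); rewrite /time /= addn0; exists a.2 => // z [bz bz'].
  by exists (aff (lambda ^+ a.1) a.2 z).
have [a0 C] := Hw a (mem_head _ _).
have [|k Ck Hk] := IH c; first by move=> d dw; apply: Hw; rewrite in_cons dw orbT.
have e : time [:: a, c & w] = (time (c :: w) + a.1)%N by rewrite /time /= addnC.
rewrite e; exists (kcomp (lambda ^+ time (c :: w)) a.2 k); first exact: (cross_comp lambda_gt1 C Ck).
move=> z [bz bz']; rewrite exprD -aff_comp in bz' *.
have bm := cross_mid lambda_gt1 C Ck bz bz'.
by exists (aff (lambda ^+ a.1) a.2 z); split => //; exact: Hk.
Qed.

Lemma word_fix w : w != [::] -> (forall a, a \in w -> good a) -> exists z, run w z z.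
Proof.
case: w => // a w _ Hw; have [k C Hk] := word_cross Hw.
have t0 : (0 < time (a :: w))%N.
  by have [a0 _] := Hw a (mem_head _ _); rewrite /time /= addn_gt0 a0.
have [z bz ez] := cross_fix lambda_gt1 t0 (square_gt0 sq0) C.
exists z; rewrite -{2}ez; apply: Hk; split => //; by rewrite ez.
Qed.

Variable s : 'rV[int]_b.

Lemma word_orbit w f : w != [::] -> (forall a, a \in w -> good a /\ has_class a (f a)) ->
  dot s (\sum_(a <- w) f a) != 0 -> exists z c (k : int) (p : nat),
  [/\ run w z z, closed_orbit h s c, (\sum_(a <- w) f a) = h c *~ k,
      time w = (`|k| * p)%N & iter p phi (q0 z) = q0 z].
Proof.
move=> w0 Hw ds; have [|z r] := word_fix w0; first by move=> a /Hw[].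
have [e cyc1 hc] := run_class Hw r; have [bz _] := run_box r.
have t0 : (0 < time w)%N.
  case: w w0 Hw {ds r e cyc1 hc} => // a w _ Hw.
  by have [[a0 _] _] := Hw a (mem_head _ _); rewrite /time /= addn_gt0 a0.
have [p [k [k0 ek ep fp bk]]] := periodic_orbit R t0 e.
have cl : Defs.cycle setT set0 (flow_loop phi (q0 z) (p%:R : R)) by rewrite flow_loopE; exact: fl_cycle.
have hk : \sum_(a <- w) f a = h (flow_loop phi (q0 z) p%:R) *+ k.
  rewrite -hc -(coordsMn h_coords) //; apply: (coords_eq h_coords) => //; first exact: cycMn.
  apply: (mod_eq (modD BM (trace_closed (time w) bz) bk)).
  by rewrite addrA subrK.
have dk (u : 'rV[int]_b) (n : nat) : dot s (u *+ n) = dot s u *+ n.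
  by rewrite /dot -sumrMnl; apply: eq_bigr => i _; rewrite mulmxnE mulrnAr.
have dN (u : 'rV[int]_b) : dot s (- u) = - dot s u.
  by rewrite /dot -sumrN; apply: eq_bigr => i _; rewrite mxE mulrN.
have d0 : dot s (h (flow_loop phi (q0 z) p%:R)) != 0.
  by apply: contraNneq ds => d0; rewrite hk dk d0 mul0rn.
(* A loop that pairs negatively with [s] is reversed, and its multiplicity becomes negative. *)
have [dpos|dneg] := ltrP 0 (dot s (h (flow_loop phi (q0 z) p%:R))).
  exists z, (flow_loop phi (q0 z) p%:R), k, p; split => //.
  by exists (q0 z), p%:R; split => //; left.
exists z, (- flow_loop phi (q0 z) p%:R), (- k%:Z), p; split => //.
- exists (q0 z), p%:R; split => //; first by right.
  by rewrite (coordsN h_coords) // dN oppr_gt0 lt_neqAle d0.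
- by rewrite (coordsN h_coords) // mulrNz mulNrz opprK hk.
- by rewrite abszN.
Qed.

(* If the prime [q] divided the multiplicity, the orbit would be periodic with
   period [n1 + m * n2]; then the last [n2] letters [a] and [n1] letters [b]
   further on would start at the same point and take the same time. *)
Lemma two_letter_word a b' u v q m z p k : good a -> good b' -> has_class a u -> has_class b' v ->
  (a.1 + b'.1 <= q)%N -> (0 < m)%N ->
  run (nseq q a ++ nseq (q * m) b') z z -> time (nseq q a ++ nseq (q * m) b') = (k * p)%N ->
  iter p phi (q0 z) = q0 z -> (q %| k)%N -> u *+ b'.1 = v *+ a.1.
Proof.
move=> ga gb ca cb qn m0 r et ep /dvdnP[k' ek].
have tn c n : time (nseq n c) = (n * c.1)%N.
  by rewrite /time map_nseq sumn_nseq mulnC.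
have tc w1 w2 : time (w1 ++ w2) = (time w1 + time w2)%N by rewrite /time map_cat sumn_cat.
have q1 : (0 < q)%N by have [a0 _] := ga; lia.
(* As [q] divides [k], it cancels from the total time of the word. *)
have e0 : (a.1 + m * b'.1 = k' * p)%N.
  apply/eqP; rewrite -(eqn_pmul2l q1); apply/eqP.
  have -> : (q * (k' * p) = k * p)%N by rewrite ek mulnA [(q * k')%N]mulnC.
  by rewrite -et tc !tn mulnDr mulnA.
have per j : iter (j * (a.1 + m * b'.1)) phi (q0 z) = q0 z.
  by rewrite e0 mulnA; apply: iter_period.
have q2 : (b'.1 <= q)%N by lia.
have eq1 : nseq q a = nseq (q - b'.1) a ++ nseq b'.1 a by rewrite -nseqD subnK.
have le2 : (b'.1 * m + a.1 <= q * m)%N.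
  have h1 : (b'.1 * m + a.1 * m <= q * m)%N by rewrite -mulnDl leq_mul2r addnC qn orbT.
  have h2 : (a.1 <= a.1 * m)%N by rewrite leq_pmulr.
  lia.
have eq2 : nseq (q * m) b' = nseq (b'.1 * m) b' ++ nseq a.1 b' ++ nseq (q * m - (b'.1 * m + a.1)) b'.
  by rewrite catA -!nseqD subnKC.
rewrite eq1 eq2 in r; have [z1 r1 r2] := run_cat r.
have [za ra1 ra2] := run_cat r1; have [zb rb1 rb2] := run_cat r2; have [zc rc1 _] := run_cat rb2.
have [ea _ _] := run_nseq ga ca ra1; have [e1 _ h1] := run_nseq ga ca ra2.
have [eb _ _] := run_nseq gb cb rb1; have [ec _ hc] := run_nseq gb cb rc1.
have [ba b1] := run_box ra2; have [bb bc] := run_box rc1.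
(* The times at which [za] and [zb] are reached differ by [b'.1] times the period
   [a.1 + m * b'.1]. *)
have eab : q0 zb = q0 za.
  rewrite -eb -e1 -iterD -ea -iterD [(_ + (q - _) * _)%N]addnC iterD; congr (iter _ _ _).
  by rewrite -[RHS](per b'.1); congr (iter _ _ _); lia.
have {}eab := square_inj sq0 bb ba eab; subst zb.
have e1c : q0 z1 = q0 zc by rewrite -e1 -ec mulnC.
have {}e1c := square_inj sq0 b1 bc e1c; subst zc.
by rewrite -h1 -hc mulnC.
Qed.
End Words.

(** * Arithmetic of homology directions *)

Section Minors.
Variable b : nat.
Implicit Types (u v w c : 'rV[int]_b).

Definition minor (ij : 'I_b * 'I_b) u v : int := u 0 ij.1 * v 0 ij.2 - u 0 ij.2 * v 0 ij.1.

Lemma minorDl ij u v w : minor ij (u + v) w = minor ij u w + minor ij v w.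
Proof. by rewrite /minor !mxE; ring. Qed.
Lemma minorDr ij u v w : minor ij w (u + v) = minor ij w u + minor ij w v.
Proof. by rewrite /minor !mxE; ring. Qed.
Lemma minorZl ij (m : int) u w : minor ij (m *: u) w = m * minor ij u w.
Proof. by rewrite /minor !mxE; ring. Qed.
Lemma minorZr ij (m : int) u w : minor ij w (m *: u) = m * minor ij w u.
Proof. by rewrite /minor !mxE; ring. Qed.
Lemma minorC ij u w : minor ij u w = - minor ij w u.
Proof. by rewrite /minor; ring. Qed.
Lemma minor_self ij u : minor ij u u = 0.
Proof. by rewrite /minor; ring. Qed.

Lemma lin_dep_minor u v : lin_dep u v -> forall ij, minor ij u v = 0.
Proof.
move=> [m [n [mn e]]] ij; apply/eqP; have [m0|m0] := eqVneq m 0.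
  have n0 : n != 0 by apply/eqP => n0; apply: mn; rewrite m0 n0.
  have : n * minor ij u v = 0.
    have nv : n *: v = 0 by move: e; rewrite m0 scale0r add0r.
    by rewrite -minorZr nv /minor !mxE !mulr0 subrr.
  by move/eqP; rewrite mulf_eq0 (negPf n0).
have : m * minor ij u v = 0.
  have -> : m * minor ij u v = minor ij (m *: u + n *: v) v by rewrite minorDl !minorZl minor_self; ring.
  by rewrite e /minor !mxE; ring.
by move/eqP; rewrite mulf_eq0 (negPf m0).
Qed.

Lemma lin_dep_refl u : lin_dep u u.
Proof. by exists 1, (-1); split => //; rewrite scale1r scaleN1r subrr. Qed.

Lemma rV_neq0 w : w != 0 -> exists k, w 0 k != 0.
Proof.
move=> w0; apply: contrapT => H; case/negP: w0; apply/eqP/rowP => k; rewrite mxE.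
by apply: contrapT => /eqP hk; apply: H; exists k.
Qed.

(** A nonzero vector proportional to both [u] and [v] would make them proportional: a three-term
    identity writes [w 0 k] times a minor of [u] and [v] through minors that involve [w]. *)
Lemma minor_nontrivial u v w ij : minor ij u v != 0 -> w != 0 ->
  exists kl, (minor kl u w != 0) || (minor kl v w != 0).
Proof.
move=> uv w0; apply: contrapT => H; case/negP: uv; apply/eqP.
have [k wk] := rV_neq0 w0.
have mu i j : minor (i, j) u w = 0.
  by apply: contrapT => /eqP hn; apply: H; exists (i, j); rewrite hn.
have mv i j : minor (i, j) v w = 0.
  by apply: contrapT => /eqP hn; apply: H; exists (i, j); rewrite hn orbT.
apply: (mulfI wk); rewrite mulr0; case: ij => i j.
have := mu i k; have := mu j k; have := mv i j; rewrite /minor /= => e1 e2 e3.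
transitivity (v 0 j * (u 0 i * w 0 k - u 0 k * w 0 i) - v 0 i * (u 0 j * w 0 k - u 0 k * w 0 j)
  - u 0 k * (v 0 i * w 0 j - v 0 j * w 0 i)); first by ring.
by rewrite e1 e2 e3; ring.
Qed.

Lemma dotDr (s u v : 'rV[int]_b) : dot s (u + v) = dot s u + dot s v.
Proof. by rewrite /dot -big_split; apply: eq_bigr => i _; rewrite mxE mulrDr. Qed.
Lemma dotZr (s u : 'rV[int]_b) (m : int) : dot s (m *: u) = m * dot s u.
Proof. by rewrite /dot mulr_sumr; apply: eq_bigr => i _; rewrite mxE; ring. Qed.

Lemma dvdn_divisibility d u : (d %| divisibility u)%N <-> forall i, (d %| absz (u 0%R i))%N.
Proof.
rewrite /divisibility; split=> [H i|H].
  by apply: (dvdn_trans H); rewrite (bigD1 i) //= dvdn_gcdl.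
by apply/dvdn_biggcdP => i _; exact: H.
Qed.

Lemma divisibility_gt0 u : u != 0 -> (0 < divisibility u)%N.
Proof.
move=> /rV_neq0[k uk]; rewrite lt0n; apply: contraNneq uk => e.
have /dvdn_divisibility/(_ k) : (divisibility u %| divisibility u)%N by [].
by rewrite e dvd0n absz_eq0.
Qed.

Lemma dot_branched (s x c : 'rV[int]_b) : 0 < dot s x -> 0 < dot s c -> 0 < dot s (branched_class x c).
Proof.
move=> sx sc; have c0 : c != 0.
  by apply: contraTneq sc => ->; rewrite /dot big1 ?ltxx // => i _; rewrite mxE mulr0.
rewrite /branched_class dotDr !dotZr; have := divisibility_gt0 c0.
set d := divisibility c; case: d => // d _.
have h1 : 0 < d.+1%:Z * dot s x by rewrite mulr_gt0.
have h2 : 0 <= (d.+1%:Z - 1) * dot s c by apply: mulr_ge0; [lia|exact: ltW].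
lra.
Qed.
End Minors.

Lemma eventually_all (T : eqType) (ws : seq T) (P : T -> nat -> Prop) :
  (forall w, w \in ws -> exists n0, forall n, (n0 <= n)%N -> P w n) ->
  exists n0, forall n, (n0 <= n)%N -> forall w, w \in ws -> P w n.
Proof.
elim: ws => [|w ws IH] H; first by exists 0%N.
have [|n1 H1] := IH; first by move=> v vw; apply: H; rewrite in_cons vw orbT.
have [n2 H2] := H w (mem_head _ _).
exists (n1 + n2)%N => n nn v; rewrite in_cons => /orP[/eqP ->|vw].
  by apply: H2; apply: leq_trans nn; rewrite leq_addl.
by apply: H1 => //; apply: leq_trans nn; rewrite leq_addr.
Qed.

(** One representative of each class suffices, since [lin_dep_refl] puts every element into its own
    class. *)
Lemma finite_classes (X : Type) (O P : set X) (b : nat) (psi : X -> 'rV[int]_b) :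
  finite_set (classes_of O P (fun c c' => lin_dep (psi c) (psi c'))) ->
  exists ws : seq 'rV[int]_b, (forall w, w \in ws -> exists2 c, O c & w = psi c) /\
    forall c, O c -> P c -> exists2 w, w \in ws & lin_dep w (psi c).
Proof.
set K := classes_of _ _ _ => /finite_seqP[sK eK].
have [[c0 _]|none] := pselect (exists c, O c /\ P c); last first.
  by exists [::]; split => // c Oc Pc; case: none; exists c.
have /choice[rep Hrep] : forall E, exists c, K E -> [/\ O c, P c & E = [set c' | O c' /\ lin_dep (psi c) (psi c')]].
  move=> E; have [[c hc]|nK] := pselect (K E); first by exists c.
  by exists c0.
exists [seq psi (rep E) | E <- sK]; split=> [w /mapP[E EK ->]|c Oc Pc].
  have KE : K E by rewrite eK.
  by have [Or _ _] := Hrep E KE; exists (rep E).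
pose E := [set c' | O c' /\ lin_dep (psi c) (psi c')].
have KE : K E by exists c.
have [Or _ eE] := Hrep E KE; exists (psi (rep E)).
  by apply: map_f; move: KE; rewrite eK.
have : E c by split => //; exact: lin_dep_refl.
by rewrite {1}eE => -[].
Qed.

(** * Additive semigroups whose differences fill the lattice *)

Section Loops.
Variables (b : nat) (L : 'rV[int]_b -> Prop) (s : 'rV[int]_b).
Hypotheses (L_add : forall u v, L u -> L v -> L (u + v))
  (L_diff : forall f, exists u v, [/\ L u, L v & f = u - v]).

Lemma L_mul u n : L u -> (0 < n)%N -> L (n%:Z *: u).
Proof.
move=> Lu; case: n => // n _; elim: n => [|n IH]; first by rewrite scale1r.
by rewrite (intS n.+1) scalerDl scale1r; exact: L_add.
Qed.

Lemma L_positive : s != 0 -> exists2 g, L g & dot s g != 0.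
Proof.
move=> /rV_neq0[k sk]; have [u [v [Lu Lv e]]] := L_diff (delta_mx 0 k).
have [su|su] := eqVneq (dot s u) 0; last by exists u.
exists v => //; apply: contraNneq sk => sv.
have : dot s (delta_mx 0 k) = s 0 k.
  rewrite /dot (bigD1 k) //= mxE !eqxx mulr1 big1 ?addr0 // => i /negPf ik.
  by rewrite mxE ik andbF mulr0.
by move=> <-; rewrite e -scaleN1r dotDr dotZr su sv; apply/eqP; ring.
Qed.

(** Only sums stay in [L], so [f = u - v] is corrected by a multiple of [m] that contains at least
    as many copies of [v] as are subtracted; further copies of [g] fix the sign of the pairing with
    [s]. *)
Lemma L_congruent g f (m : nat) : L g -> dot s g != 0 -> (0 < m)%N ->
  exists u e, [/\ L u, u = f + m%:Z *: e & 0 < dot s g * dot s u].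
Proof.
move=> Lg sg m0; have [u [v [Lu Lv ef]]] := L_diff f.
(* [K] gives the pairing of [e1] with [s] the sign of [dot s g], and [n] makes it outweigh
   [dot s f]. *)
pose K := `|dot s v|.+1; pose e1 := v + K%:Z *: g.
have Le1 : L e1 by apply: L_add => //; exact: L_mul.
pose n := `|dot s f|.+1.
exists (f + (m * n)%N%:Z *: e1), (n%:Z *: e1); split.
- have -> : f + (m * n)%N%:Z *: e1 = u + ((m * n).-1%:Z *: v + (m * n * K)%N%:Z *: g).
    rewrite ef /e1; apply/rowP => i; rewrite !mxE.
    have e : (m * n)%N%:Z = 1 + (m * n).-1%:Z by rewrite -intS prednK // muln_gt0 m0.
    by rewrite (PoszM (m * n)%N K) e; ring.
  have LK : L ((m * n * K)%N%:Z *: g) by apply: L_mul => //; rewrite !muln_gt0 m0.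
  case E : (m * n).-1 => [|j]; first by rewrite scale0r add0r; exact: L_add.
  by apply: L_add => //; apply: L_add => //; exact: L_mul.
- by rewrite PoszM scalerA.
rewrite dotDr dotZr /e1 dotDr dotZr PoszM.
move: sg; rewrite /K /n; move: (dot s g) (dot s v) (dot s f) => G V F G0.
have m1 : 1 <= m%:Z by lia.
have G1 : 1 <= `|G| by rewrite -gtz0_ge1 normr_gt0.
have GG : G * G = `|G| * `|G| by rewrite -normrM ger0_norm // -expr2 sqr_ge0.
have hV : - (`|G| * `|V|) <= G * V by rewrite -normrM; exact: lerNnormlW.
have hF : - (`|G| * `|F|) <= G * F by rewrite -normrM; exact: lerNnormlW.
rewrite !(intS `|_|) !abszE.
have p1 : 0 <= `|V| by []; have p2 : 0 <= `|F| by [].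
have q1 : `|G| <= G * (V + (1 + `|V|) * G).
  rewrite mulrDr mulrCA GG.
  have : (1 + `|V|) * `|G| <= (1 + `|V|) * (`|G| * `|G|) by rewrite ler_wpM2l ?ler_peMr //; lia.
  lra.
have q2 : (1 + `|F|) * `|G| <= m%:Z * (1 + `|F|) * (G * (V + (1 + `|V|) * G)).
  move: q1; set X := G * _ => q1; have X0 : 0 <= X by apply: le_trans q1.
  have f0 : 0 <= 1 + `|F| by lra.
  have a1 : (1 + `|F|) * `|G| <= (1 + `|F|) * X by exact: ler_wpM2l.
  rewrite -mulrA; apply: le_trans a1 _; rewrite -[leLHS]mul1r; apply: ler_wpM2r => //.
  exact: mulr_ge0.
rewrite mulrDr [G * (_ * _)]mulrCA; lra.
Qed.
End Loops.

Lemma linear_nonzero (al be : int) : (al != 0) || (be != 0) ->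
  exists n0, forall n, (n0 <= n)%N -> al + n%:Z * be != 0.
Proof.
have [->|be0] := eqVneq be 0; first by rewrite orbF => al0; exists 0%N => n _; rewrite mulr0 addr0.
move=> _; exists (absz al).+1 => n nn; apply/eqP => e.
have e' : n%:Z * be = - al by rewrite -[LHS](addKr al) e addr0.
have := congr1 absz e'; rewrite abszN abszM absz_nat => e2.
have : (n <= n * absz be)%N by rewrite leq_pmulr // absz_gt0.
lia.
Qed.

Section Arithmetic.
Variables (b : nat) (L : 'rV[int]_b -> Prop) (s x : 'rV[int]_b).
Hypotheses (b_gt1 : (1 < b)%N)
  (L_add : forall u v, L u -> L v -> L (u + v))
  (L_diff : forall f, exists u v, [/\ L u, L v & f = u - v]).

Lemma transverse u v ij (ws : seq 'rV[int]_b) : minor ij u v != 0 -> (forall w, w \in ws -> w != 0) ->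
  exists n0, forall n, (n0 <= n)%N -> forall w, w \in ws -> exists kl, minor kl (u + n%:Z *: v) w != 0.
Proof.
move=> uv hw; apply: eventually_all => w /hw w0.
have [kl /linear_nonzero[n0 H]] := minor_nontrivial uv w0.
by exists n0 => n /H nn; exists kl; rewrite minorDl minorZl.
Qed.

(** With [v] congruent to a basis vector modulo |u_i| + 1, the minor is congruent to u_i, which is
    nonzero and smaller than the modulus. *)
Lemma L_independent g u : L g -> dot s g != 0 -> u != 0 ->
  exists v ij, [/\ L v, 0 < dot s g * dot s v & minor ij u v != 0].
Proof.
move=> Lg sg /rV_neq0[i ui].
have [j ji] : exists j : 'I_b, j != i.
  have [->|i0] := eqVneq i (Ordinal (ltnW b_gt1)); first by exists (Ordinal b_gt1).
  by exists (Ordinal (ltnW b_gt1)); rewrite eq_sym.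
have [v [e [Lv ev dv]]] := L_congruent L_add L_diff (delta_mx 0 j) Lg sg (ltn0Sn (absz (u 0 i))).
exists v, (i, j); split => //; apply/eqP.
rewrite ev minorDr minorZr; set X := minor _ u e.
have -> : minor (i, j) u (delta_mx 0 j) = u 0 i.
  by rewrite /minor !mxE !eqxx eq_sym (negPf ji) andbF mulr0 subr0 mulr1.
move=> eX; have [X0|X0] := eqVneq X 0; first by move: ui; rewrite -eX X0 mulr0 addr0 eqxx.
have e2 : (absz (u 0 i)).+1%:Z * X = - u 0 i by rewrite -[LHS](addKr (u 0 i)) eX addr0.
have := congr1 absz e2; rewrite abszN abszM absz_nat.
have : ((absz (u 0%R i)).+1 <= (absz (u 0%R i)).+1 * absz X)%N by rewrite leq_pmulr // absz_gt0.
lia.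
Qed.

(* Few lattice points [c] on the line through [- x] of direction [w] have
   multiples in the pencil of the vectors [J r + v]. *)
Lemma pencil_line r v w ij kl : minor ij v r != 0 -> minor kl r w != 0 ->
  exists n0, forall J, (n0 <= J)%N -> forall c (k : int),
    J%:Z *: r + v = k *: c -> ~ lin_dep w (c + x).
Proof.
move=> vr rw; pose K := (absz (minor kl v w) + absz (minor ij v r) * absz (minor kl x w))%N.
exists K.+1 => J JK c k e /lin_dep_minor/(_ kl); rewrite minorDr => e1.
have e2 : minor kl c w = - minor kl x w by rewrite (minorC kl c) (minorC kl x) opprK; apply/esym/eqP; rewrite -addr_eq0 addrC e1.
have e3 : J%:Z * minor kl r w + minor kl v w = - (k * minor kl x w).
  by rewrite -minorZl -minorDl e minorZl e2 mulrN.
have e4 : minor ij v r = k * minor ij c r.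
  by rewrite -minorZl -e minorDl minorZl minor_self mulr0 add0r.
have c0 : minor ij c r != 0 by apply: contraNneq vr => c0; rewrite e4 c0 mulr0.
have k1 : (absz k <= absz (minor ij v r))%N by rewrite e4 abszM leq_pmulr // absz_gt0.
have e5 : J%:Z * minor kl r w = - (k * minor kl x w) - minor kl v w by rewrite -e3 addrK.
have := congr1 absz e5; rewrite abszM absz_nat => e6.
have h1 : (J <= J * absz (minor kl r w))%N by rewrite leq_pmulr // absz_gt0.
have h2 : (absz (- (k * minor kl x w) - minor kl v w) <= absz k * absz (minor kl x w) + absz (minor kl v w))%N.
  have := leqD_dist (- (k * minor kl x w)) 0 (minor kl v w).
  by rewrite subr0 sub0r !abszN abszM.
have h3 : (absz k * absz (minor kl x w) <= absz (minor ij v r) * absz (minor kl x w))%N by rewrite leq_mul2r k1 orbT.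
by move: JK; rewrite /K; lia.
Qed.

(** For large [t] the direction [r = g + t v] is independent of every vector of [ws], while its
    minor with [v] stays that of [g]. Then [pencil_line] excludes all the lines at once for large
    [J]. *)
Lemma infinite_lines (O : 'rV[int]_b -> Prop) (ws : seq 'rV[int]_b) : s != 0 ->
  (forall w, w \in ws -> w != 0) ->
  (forall u, L u -> dot s u != 0 -> exists c k, O c /\ u = k *: c) ->
  exists2 c, O c & forall w, w \in ws -> ~ lin_dep w (c + x).
Proof.
move=> s0 hw HO; have [g Lg sg] := L_positive L_diff s0.
have g0 : g != 0 by apply: contraNneq sg => ->; rewrite /dot big1 // => i _; rewrite mxE mulr0.
have [v [ij [Lv dv mv]]] := L_independent Lg sg g0.
have dg : 0 < dot s g * dot s g by rewrite -expr2 exprn_even_gt0.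
have [n0 H0] := transverse mv hw; pose t := n0.+1; pose r := g + t%:Z *: v.
have mr : minor ij v r != 0.
  by rewrite /r minorDr minorZr minor_self mulr0 addr0 minorC oppr_eq0.
have [w ww|n1 H1] := @eventually_all _ ws (fun w J => forall c (k : int),
    J%:Z *: r + v = k *: c -> ~ lin_dep w (c + x)).
  have [kl hkl] := H0 t (leqnSn n0) w ww; exact: pencil_line mr hkl.
pose J := n1.+1.
have LJ : L (J%:Z *: r + v).
  apply: (L_add) => //; apply: (L_mul L_add) => //; apply: L_add => //; exact: (L_mul L_add).
have dJ : dot s (J%:Z *: r + v) != 0.
  have : 0 < dot s g * dot s (J%:Z *: r + v).
    rewrite dotDr dotZr dotDr dotZr !mulrDr; rewrite ltr_pwDr // addr_ge0 //.
      by rewrite mulrCA mulr_ge0 // ltW.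
    by rewrite mulrCA mulr_ge0 // mulrCA mulr_ge0 // ltW.
  by apply: contraTneq => ->; rewrite mulr0 ltxx.
have [c [k [Oc e]]] := HO _ LJ dJ; exists c => // w ww.
exact: (H1 J (leqnSn n1) w ww c k e).
Qed.

(** Dependence equates (d - 1) q times a nonzero minor of [w] and [c'] with d times the minor of [w]
    and [x], up to sign. As d is at most 2 (d - 1), this bounds [q]. *)
Lemma branched_line r w kl : minor kl r w != 0 -> exists n0, forall q, (n0 <= q)%N ->
  forall c c' (k : int), c = q%:Z *: c' -> r = k *: c' -> (1 < divisibility c)%N ->
  ~ lin_dep w (branched_class x c).
Proof.
move=> rw; exists (2 * absz (minor kl x w)).+1 => q qn c c' k ec er d1 /lin_dep_minor/(_ kl).
rewrite /branched_class; set d := divisibility c in d1 *; rewrite minorDr !minorZr => e.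
have m0 : minor kl w c' != 0.
  by apply: contraNneq rw => m0; rewrite er minorZl minorC m0 oppr0 mulr0.
have e1 : (d%:Z - 1) * (q%:Z * minor kl w c') = - (d%:Z * minor kl w x).
  by rewrite -minorZr -ec; apply/eqP; rewrite -addr_eq0 addrC e.
have ed : d%:Z - 1 = d.-1%:Z by lia.
have := congr1 absz e1; rewrite ed abszN !abszM !absz_nat (minorC kl w x) abszN => e2.
have h1 : (d.-1 * q <= d.-1 * (q * absz (minor kl w c')))%N.
  by rewrite leq_mul2l leq_pmulr ?orbT // absz_gt0.
have h2 : (d * absz (minor kl x w) <= 2 * d.-1 * absz (minor kl x w))%N by rewrite leq_mul2r; lia.
have : (d.-1 * q <= d.-1 * (2 * absz (minor kl x w)))%N by lia.
by rewrite leq_pmul2l; lia.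
Qed.

(* The last hypothesis will be met by the words [u^q v^(q m)]. *)
Lemma infinite_branched_lines (O : 'rV[int]_b -> Prop) (ws : seq 'rV[int]_b) tau : s != 0 -> (0 < tau)%N ->
  (forall w, w \in ws -> w != 0) ->
  (forall u v ij, L u -> L v -> minor ij u v != 0 -> 0 < dot s u * dot s v ->
    exists n0, forall q m, (n0 <= q)%N -> prime q -> (0 < m)%N ->
      exists c k, [/\ O c, q%:Z *: (u + m%:Z *: v) = k *: c & ~~ (q %| absz k)%N]) ->
  exists c, [/\ O c, (1 < divisibility c)%N, coprime (divisibility c) tau
    & forall w, w \in ws -> ~ lin_dep w (branched_class x c)].
Proof.
move=> s0 tau0 hw HO; have [g Lg sg] := L_positive L_diff s0.
pose i0 : 'I_b := Ordinal (ltnW b_gt1).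
(* As [u] is a basis vector modulo [tau] and [m] is a multiple of [tau], the coordinate [i0] of [r]
   is 1 modulo [tau]. *)
have [u [e [Lu eu du]]] := L_congruent L_add L_diff (delta_mx 0 i0) Lg sg tau0.
have u0 : u != 0.
  by apply: contraTneq du => ->; rewrite /dot [X in _ * X]big1 ?mulr0 ?ltxx // => i _; rewrite mxE mulr0.
have [v [ij [Lv dv mv]]] := L_independent Lg sg u0.
have duv : 0 < dot s u * dot s v.
  have : 0 < (dot s g * dot s g) * (dot s u * dot s v) by rewrite mulrACA mulr_gt0.
  by rewrite pmulr_rgt0 // -expr2 exprn_even_gt0.
have [n0 H0] := transverse mv hw; pose m := (tau * n0.+1)%N.
have m0 : (0 < m)%N by rewrite muln_gt0 tau0.
have nm : (n0 <= m)%N by rewrite /m; nia.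
pose r := u + m%:Z *: v.
have [w ww|n1 H1] := @eventually_all _ ws (fun w q => forall c c' (k : int),
   c = q%:Z *: c' -> r = k *: c' -> (1 < divisibility c)%N -> ~ lin_dep w (branched_class x c)).
  have [kl hkl] := H0 m nm w ww; exact: branched_line hkl.
have [n2 H2] := HO u v ij Lu Lv mv duv.
(* Beyond [n1] to avoid the lines, beyond [n2] for the words, and beyond [tau] to be coprime to
   it. *)
have [q qn pq] := prime_above (n1 + n2 + tau).
have [|c [k [Oc ec qk]]] := H2 q m _ pq m0; first by lia.
have q1 := prime_gt1 pq.
have qZ : q%:Z != 0 by lia.
have qc i : (q %| absz (c 0%R i))%N.
  have := congr1 (fun v : 'rV_b => absz (v 0 i)) ec; rewrite !mxE !abszM absz_nat => e1.
  have cop : coprime q (absz k) by rewrite prime_coprime.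
  by rewrite -(Gauss_dvdr _ cop) -e1 dvdn_mulr.
have [c' ecc] : exists c', c = q%:Z *: c'.
  exists (\row_i divz (c 0 i) q%:Z).
  by apply/rowP => i; rewrite !mxE mulrC divzK //; exact: qc.
have er : r = k *: c'.
  apply/rowP => i; have := congr1 (fun v : 'rV_b => v 0 i) ec; rewrite ecc !mxE => e1.
  by apply: (mulfI qZ); rewrite mulrCA -e1.
have c0 : c != 0.
  apply: contraNneq mv => c0; move: ec; rewrite c0 scaler0 => e1.
  have er0 : r = 0.
    apply/rowP => i; have := congr1 (fun v : 'rV_b => v 0 i) e1; rewrite !mxE => e2.
    by apply/eqP; have /eqP := e2; rewrite mulf_eq0 (negPf qZ).
  have -> : minor ij u v = minor ij r v by rewrite /r minorDl minorZl minor_self mulr0 addr0.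
  by rewrite er0 /minor !mxE; apply/eqP; ring.
have qd : (q %| divisibility c)%N by apply/dvdn_divisibility.
have d1 : (1 < divisibility c)%N by apply: leq_trans q1 _; rewrite dvdn_leq // divisibility_gt0.
exists c; split => //; last first.
  by move=> w ww; apply: (H1 q _ w ww c c' k ecc er d1); lia.
rewrite /coprime; apply: contrapT => /negP; case: (gcdn _ _) (dvdn_gcdl (divisibility c) tau) (dvdn_gcdr (divisibility c) tau) => [|[//|G]] hd ht _.
  by move: ht; rewrite dvd0n => /eqP t0; rewrite t0 in tau0.
(* A prime [l] dividing both numbers differs from [q], so it divides the coordinate [i0] of [c'] and
   hence that of [r], which is 1 modulo [l]. *)
have pl := pdiv_prime (isT : (1 < G.+2)%N); set l := pdiv _ in pl.
have ld : (l %| divisibility c)%N by apply: dvdn_trans hd; exact: pdiv_dvd.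
have lt : (l %| tau)%N by apply: dvdn_trans ht; exact: pdiv_dvd.
have l1 := prime_gt1 pl.
have lq : coprime l q.
  rewrite prime_coprime // dvdn_prime2 //; apply/eqP => lq.
  by have := dvdn_leq tau0 lt; rewrite lq leqNgt (leq_ltn_trans _ qn) // leq_addl.
have /dvdn_divisibility/(_ i0) := ld; rewrite ecc !mxE abszM absz_nat Gauss_dvdr // => lc.
have lr : (l%:Z %| r 0%R i0)%Z by rewrite er !mxE dvdz_mull.
have ltz : (l%:Z %| tau%:Z)%Z by [].
move: lr; rewrite /r eu !mxE !eqxx /= /m PoszM; move: (e _ _) (v _ _) => E V lr.
have : (l%:Z %| 1)%Z.
  have -> : 1 = (1 + tau%:Z * E + tau%:Z * n0.+1%:Z * V) - tau%:Z * (E + n0.+1%:Z * V) :> int by ring.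
  by apply: rpredB => //; rewrite dvdz_mulr.
by rewrite dvdz1 absz_nat => /eqP; lia.
Qed.
End Arithmetic.

Section LoopClasses.
Variables (R : realType) (S : topologicalType) (phi : homeomorphism S).
Variables (A : set (flat_chart R S)) (M : set S) (lambda : R).
Hypotheses (S_haus : hausdorff_space S) (lambda_gt1 : 1 < lambda)
  (atlas : foliation_atlas A M) (M_phi : forall p, M p -> M (phi p))
  (phi_flat : forall c d p, A c -> A d -> c.1 p -> d.1 (phi p) ->
        exists e1 e2 a b, [/\ is_sign e1, is_sign e2 & \forall y \near p,
          d.2 (phi y) = (e1 * lambda * (c.2 y).1 + a,
                         e2 * lambda^-1 * (c.2 y).2 + b)]).
Hypothesis recur : forall (O : set S) (n0 : nat), open O -> O `<=` M -> O !=set0 ->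
  exists n p, [/\ (n0 <= n)%N, O p & O (iter n phi p)].
Hypothesis M_lc : lc_connected M.
Hypothesis nice : forall x (O : set S), open O -> O x -> exists B f g,
  [/\ @disc_chart R S B f g, (g @` B) x, g @` B `<=` O, (g @` B `&` M) !=set0
    & lc_connected (g @` B `&` M)].
Local Notation N := (mapping_torus R phi).
Variables (q0 : plane R -> S) (l0 : R).
Hypothesis sq0 : is_square A q0 l0.
Variables (b : nat) (h : chain R 1 N -> 'rV[int]_b).
Hypothesis h_coords : homology_coords setT h.
Local Notation loop := (@loop R S phi lambda q0 l0).
Local Notation good := (good phi lambda q0 l0).
Local Notation has_class := (has_class lambda q0 l0 h).

Definition loop_class (u : 'rV[int]_b) := exists2 v, loop v & h v = u.

Lemma loop_cyc v : loop v -> Defs.cycle setT set0 v.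
Proof.
move=> [n [k [z [n0 C [bz bz'] ->]]]]; have [_ _ _ H] := C.
rewrite (@cpath_trace R S phi lambda q0 (n, k) z _ erefl).
exact: (trace_cycle atlas sq0 bz bz' (H z bz bz')).
Qed.

Lemma loop_class_letter u : loop_class u -> exists a, good a /\ has_class a u.
Proof.
move=> [v [n [k [z [n0 C az ->]]]] hv]; exists (n, k); split; first by [].
by exists z.
Qed.

Lemma loop_class_add u v : loop_class u -> loop_class v -> loop_class (u + v).
Proof.
move=> [c Lc <-] [c' Lc' <-]; have [d Ld bd'] := loop_add lambda_gt1 atlas sq0 Lc Lc'.
have h1 := loop_cyc Lc; have h2 := loop_cyc Lc'; have h3 := loop_cyc Ld.
exists d => //; rewrite -(coordsD h_coords) //; apply: (coords_eq h_coords) => //.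
exact: cycD.
Qed.

Lemma loop_class_diff f : exists u v, [/\ loop_class u, loop_class v & f = u - v].
Proof.
have [_ hs _] := h_coords; have [z cz <-] := hs f.
have [c [c' [Lc Lc' bd']]] := loop_cycle S_haus lambda_gt1 atlas M_phi phi_flat recur M_lc sq0 nice cz.
have h1 := loop_cyc Lc; have h2 := loop_cyc Lc'.
exists (h c), (h c'); split; [by exists c|by exists c'|].
rewrite -(coordsB h_coords) //; apply: (coords_eq h_coords) => //; exact: cycB.
Qed.

Variable s : 'rV[int]_b.

Definition orbit_class (u : 'rV[int]_b) := exists2 c, closed_orbit h s c & h c = u.

Lemma loop_orbit u : loop_class u -> dot s u != 0 -> exists c (k : int), orbit_class c /\ u = k *: c.
Proof.
move=> /loop_class_letter[a [ga ca]] du.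
have w0 : [:: a] != [::] by [].
have Hw d : d \in [:: a] -> good d /\ has_class d ((fun=> u) d) by rewrite inE => /eqP ->.
have ds : dot s (\sum_(d <- [:: a]) (fun=> u) d) != 0 by rewrite big_seq1.
have [z [c [k [p [_ oc e _ _]]]]] := word_orbit lambda_gt1 atlas sq0 h_coords w0 Hw ds.
exists (h c), k; split; first by exists c.
by rewrite scale_int -e big_seq1.
Qed.

Lemma has_class_uniq a u v : good a -> has_class a u -> has_class a v -> u = v.
Proof.
move=> ga ca cb; have [z [bz bz'] _] := ca.
have [_ _ <-] := step_class atlas sq0 h_coords ga ca bz bz' erefl.
by have [_ _ <-] := step_class atlas sq0 h_coords ga cb bz bz' erefl.
Qed.

Lemma two_letter_orbit u v ij : loop_class u -> loop_class v -> minor ij u v != 0 ->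
  0 < dot s u * dot s v -> exists n0, forall q m, (n0 <= q)%N -> prime q -> (0 < m)%N ->
    exists c (k : int), [/\ orbit_class c, q%:Z *: (u + m%:Z *: v) = k *: c & ~~ (q %| absz k)%N].
Proof.
move=> /loop_class_letter[a [ga ca]] /loop_class_letter[a' [ga' ca']] uv duv.
(* [f] below distinguishes the letters by equality, and equal letters would have equal classes. *)
have neq : a' != a.
  apply: contraNneq uv => e; rewrite e in ga' ca'.
  by rewrite (has_class_uniq ga ca ca') minor_self.
exists (a.1 + a'.1)%N => q m qn pq m0; have q0' := prime_gt0 pq.
pose f c := if c == a then u else v.
pose w := nseq q a ++ nseq (q * m) a'.
have Hw c : c \in w -> good c /\ has_class c (f c).
  rewrite mem_cat !mem_nseq => /orP[] /andP[_ /eqP ->]; rewrite /f ?eqxx //.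
  by rewrite (negPf neq).
have sw : \sum_(c <- w) f c = q%:Z *: (u + m%:Z *: v).
  rewrite big_cat !big_nseq !iter_addr_0 /f eqxx (negPf neq) scalerDr scalerA.
  by rewrite -PoszM !scale_int -!pmulrn.
have ds : dot s (\sum_(c <- w) f c) != 0.
  rewrite sw dotZr dotDr dotZr mulf_neq0 //; first by lia.
  have : 0 < dot s u * (dot s u + m%:Z * dot s v).
    rewrite mulrDr ltr_wpDl //; first by rewrite -expr2 sqr_ge0.
    by rewrite mulrCA mulr_gt0.
  by apply: contraTneq => ->; rewrite mulr0 ltxx.
have w0 : w != [::] by rewrite /w; case: (q) q0'.
have [z [c [k [p [r oc e et ep]]]]] := word_orbit lambda_gt1 atlas sq0 h_coords w0 Hw ds.
exists (h c), k; split; [by exists c|by rewrite -sw e scale_int|].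
apply/negP => qk; have := two_letter_word lambda_gt1 atlas sq0 h_coords ga ga' ca ca' qn m0 r et ep qk.
move=> e2; have a0 : (0 < a'.1)%N by case: ga'.
have : a'.1%:Z * minor ij u v = 0.
  by rewrite -minorZl scale_int -pmulrn e2 pmulrn -scale_int minorZl minor_self mulr0.
by move/eqP; rewrite mulf_eq0 (negPf uv) orbF; lia.
Qed.
End LoopClasses.

Unset Implicit Arguments.
Set Strict Implicit.
Set Printing Implicit Defensive.

Theorem lemma4p5 (R : realType) (S : topologicalType)
    (S_compact : compact [set: S]) (S_connected : connected [set: S])
    (S_surface : manifold R 1 S)
    (oS : chain R 2 S) (S_oriented : orientation setT (mboundary R 1 S) oS)
    (S_hyperbolic : euler R [set: S] < 0)
    (phi : homeomorphism S) (phi_oriented : orientation_preserving oS phi)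
    (phi_pA : pseudo_anosov R phi)
    (oN : chain R 3 (mapping_torus R phi))
    (N_oriented :
       orientation setT (mboundary R 2 (mapping_torus R phi)) oN)
    (b : nat) (h : chain R 1 (mapping_torus R phi) -> 'rV[int]_b)
    (h_coords : homology_coords setT h) (b_gt1 : (1 < b)%N)
    (nu : 'rV[R]_b -> R) (nu_norm : is_thurston_norm oN h nu)
    (s : 'rV[int]_b)
    (s_dual : dual_to oN h s (push (@fiber_incl R S phi) oS))
    (C : set 'rV[R]_b) (C_cone : top_face_cone nu C) (C_s : C (to_real R s))
    (x : 'rV[int]_b)
    (x_dual : forall alpha, C alpha -> nu alpha = dot alpha (to_real R x)) :
  infinite_set
    (classes_of (closed_orbit h s) setT (drilling_equiv h x)) /\
  infinite_set
    (classes_of (closed_orbit h s)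
       [set c | (1 < divisibility (h c))%N /\
          coprime (divisibility (h c))
            (torsion_order R 1 [set: mapping_torus R phi])]
       (branched_equiv h x)).
Proof.
have S_haus : hausdorff_space S by case: S_surface.
(* The open cone over a top face does not contain 0, and on it the norm is the pairing with [x]. *)
have [s0 sx] : s != 0 /\ 0 < dot s x.
  have [y [F [[_ -> _] eC]]] := C_cone.
  have [[nu0 nuD nuZ] _] := nu_norm.
  move: (C_s); rewrite eC => -[t [v [t0 [[_ vy] _] es]]].
  have ds : dot (to_real R s) y = t.
    rewrite es /dot -[RHS]mulr1 -vy /dot mulr_sumr.
    by apply: eq_bigr => i _; rewrite mxE mulrA.
  have s0 : to_real R s != 0.
    apply: contraTneq t0 => s0; rewrite -ds s0 /dot big1 ?ltxx // => i _.
    by rewrite mxE mul0r.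
  have nuN u : nu (- u) = nu u by rewrite -scaleN1r nuZ normrN1 mul1r.
  have nu_ge0 u : 0 <= nu u.
    have := nuD u (- u); rewrite subrr nuN -[X in nu X](scale0r u) nuZ normr0 mul0r.
    by rewrite -mulr2n pmulrn_lge0.
  split; first by apply: contraNneq s0 => ->; apply/eqP/rowP => i; rewrite !mxE.
  have : 0 < nu (to_real R s).
    by rewrite lt_neqAle nu_ge0 andbT eq_sym; apply: contraNneq s0 => /nu0 ->.
  rewrite (x_dual _ C_s); suff -> : dot (to_real R s) (to_real R x) = (dot s x)%:~R by rewrite ltr0z.
  by rewrite /dot rmorph_sum; apply: eq_bigr => i _; rewrite !mxE rmorphM.
have [A [Sigma [lambda [lambda_gt1 [Sigma_fin Sigma_int] atlas prongs [Sigma_phi phi_flat]]]]] := phi_pA.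
pose M := regular R Sigma.
have M_phi p : M p -> M (phi p) by exact: regular_phi.
have recur := recurrence S_haus lambda_gt1 atlas M_phi phi_flat S_compact
  (end_self (Sigma := Sigma)) (end_eq (Sigma := Sigma)) (end_sub (Sigma := Sigma))
  (end_closed S_haus (Sigma := Sigma)) (end_coclosed S_haus Sigma_fin Sigma_int prongs) (end_prong prongs).
have M_lc := regular_connected S_haus S_surface Sigma_fin S_connected.
have nice := nice_chart S_haus S_surface Sigma_fin.
(* An empty surface would have a mapping torus without nonzero chains, whereas the coordinates [h]
   are onto. *)
have [y0 _] : exists y0 : S, True.
  apply: contrapT => H; have [_ hs _] := h_coords.
  have [z [cz _] hz] := hs (const_mx 1).
  have z0 : z = 0.
    apply: is_chain_set0 => f /cz[cf _]; split => // xi [v _ _].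
    by have [y [t _]] := Fl_surj xi; case: H; exists y.
  move/rowP: hz => /(_ (Ordinal (ltnW b_gt1))).
  by rewrite z0 (coords0 h_coords) !mxE => /eqP; rewrite eq_sym oner_eq0.
have [B0 [f0 [g0 [_ _ _ [y [_ My]] _]]]] := nice y0 setT openT I.
have [q0 [l0 [sq0 _ _]]] := square_at atlas My openT I.
have disc y1 (O : set S) : open O -> O y1 -> exists B f g,
    [/\ @disc_chart R S B f g, (g @` B) y1 & g @` B `<=` O].
  by move=> oO Oy; have [B [f [g [? ? ? _ _]]]] := nice y1 O oO Oy; exists B, f, g.
have fg := finitely_generated (@mapping_torus_compact R S phi S_compact) (@mapping_torus_hausdorff R S phi S_haus)
  (mapping_torus_local S_connected disc (Fl phi (y0, 0))).
have tau0 := torsion_order_gt0 h_coords fg.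
have La := loop_class_add lambda_gt1 atlas sq0 h_coords.
have Ld := loop_class_diff S_haus lambda_gt1 atlas M_phi phi_flat recur M_lc nice sq0 h_coords.
split.
  move=> /finite_classes[ws [hw hc]].
  have [|u Lu du|c [c0 oc <-] H] := infinite_lines x b_gt1 La Ld (O := orbit_class h s) (ws := ws) s0.
  (* The vectors to be compared pair positively with [s], hence are nonzero. *)
  - move=> w /hw[c [y1 [T [_ _ dc]]] ->]; have : 0 < dot s (h c + x) by rewrite dotDr addr_gt0.
    by apply: contraTneq => ->; rewrite /dot big1 ?ltxx // => i _; rewrite mxE mulr0.
  - exact: (loop_orbit lambda_gt1 atlas sq0 h_coords Lu du).
  have [w ww lw] := hc c0 oc I; exact: H ww lw.
move=> /finite_classes[ws [hw hc]].
have [||c [[c0 oc <-] d1 cop H]] := infinite_branched_lines x b_gt1 La Ld (O := orbit_class h s) (ws := ws) s0 tau0.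
- move=> w /hw[c [y1 [T [_ _ dc]]] ->].
  by apply: contraTneq (dot_branched sx dc) => ->; rewrite /dot big1 ?ltxx // => i _; rewrite mxE mulr0.
- exact: (two_letter_orbit lambda_gt1 atlas sq0 h_coords).
by have [w ww lw] := hc c0 oc (conj d1 cop); exact: H ww lw.
Qed.
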